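(* For all sufficiently small $h>0$ there is a constant $c_h$, depending on $h$, such that for every $f\in L^2(\mathbb{S}^{d-1})$, $$f(\omega)=c_h\int_{\mathbb{S}^{d-1}}\mathrm{d}\xi\int_{\xi^\perp}\mathrm{d}x\;\phi_{x,\xi}(\omega)\int_{\mathbb{S}^{d-1}}\mathrm{d}\omega'\;\overline{\phi_{x,\xi}(\omega')}\,f(\omega'),$$ and $c_h\sim 2^{(d-1)/2}(2\pi h)^{-3(d-1)/2}$ as $h\to0$.
   Context: $\mathbb{S}^{d-1}$ is the unit sphere of $\mathbb{R}^d$ with its standard surface measure, and $\xi^\perp\subset\mathbb{R}^d$ is the hyperplane orthogonal to $\xi\in\mathbb{S}^{d-1}$ with its Lebesgue measure. Fix $\chi\in C^\infty(\mathbb{R};[0,1])$ with $\chi(r)=1$ for $r\le1/2$ and $\chi(r)=0$ for $r\ge3/4$. For $\xi\in\mathbb{S}^{d-1}$ and $x\in\mathbb{R}^d$, the Gaussian state $\phi_{x,\xi}$ is the function on $\mathbb{S}^{d-1}$ given by $$\phi_{x,\xi}(\omega)=\chi\Big(\frac{|\omega-\xi|}{h^{1/3}}\Big)e^{-\frac ih x\cdot\omega}e^{-\frac1{2h}|\omega-\xi|^2},$$ where $|\cdot|$ is the Euclidean norm of $\mathbb{R}^d$. The formula is an identity in $L^2(\mathbb{S}^{d-1})$, and the integrals are iterated, with the integral over $x\in\xi^\perp$ understood as an inverse Fourier integral in the $L^2$ sense. *)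

(* Defs.v *)
From HB Require Import structures.
From mathcomp Require Import all_boot all_order all_algebra.
From mathcomp Require Import all_classical all_reals all_analysis.
From mathcomp Require Import measurable_realfun complex.

Set Implicit Arguments.
Unset Strict Implicit.
Unset Printing Implicit Defensive.

Import Order.TTheory GRing.Theory Num.Theory.
Import numFieldNormedType.Exports.

Local Open Scope classical_set_scope.
Local Open Scope ring_scope.
Local Open Scope complex_scope.

(* The product sigma-algebra of R^n, generated by the coordinates; it is the
   Borel sigma-algebra. *)
Section row_vector_measurable.
Context {R : realType} (n : nat).

Definition rV_display : measure_display -> measure_display.
Proof. exact. Qed.

Definition rV_coord (i : 'I_n) (x : 'rV[R]_n) : measurableTypeR R := x ord0 i.

Let rV_set0 : g_sigma_preimage rV_coord set0.
Proof. exact: sigma_algebra0. Qed.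

Let rV_setC A : g_sigma_preimage rV_coord A -> g_sigma_preimage rV_coord (~` A).
Proof. exact: sigma_algebraC. Qed.

Let rV_bigcup (F : (set 'rV[R]_n)^nat) :
  (forall i, g_sigma_preimage rV_coord (F i)) ->
  g_sigma_preimage rV_coord (\bigcup_i (F i)).
Proof. exact: sigma_algebra_bigcup. Qed.

HB.instance Definition _ :=
  @isMeasurable.Build (rV_display default_measure_display)
    'rV[R]_n (g_sigma_preimage rV_coord) rV_set0 rV_setC rV_bigcup.

End row_vector_measurable.

Section measurability.
Context {R : realType}.

Lemma measurable_rV_coord n (i : 'I_n) :
  measurable_fun [set: 'rV[R]_n] (fun x : 'rV[R]_n => x ord0 i).
Proof.
move=> _ Y mY; rewrite setTI; apply: sub_sigma_algebra => /=.
rewrite -bigcup_seq/=; exists i => /=; first by rewrite mem_index_enum.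
by exists Y => //; rewrite setTI.
Qed.

Lemma measurable_fun_rVP d (T : measurableType d) n (f : T -> 'rV[R]_n) :
  (forall i, measurable_fun [set: T] (fun x => f x ord0 i)) ->
  measurable_fun [set: T] f.
Proof.
move=> mf _ Y mY; rewrite setTI.
suff : [set B | measurable (f @^-1` B)] Y by [].
apply: mY; split.
  split => /=.
  - by rewrite preimage_set0.
  - by move=> A /= mA; rewrite setTD preimage_setC; exact: measurableC.
  - by move=> F mF /=; rewrite preimage_bigcup; exact: bigcupT_measurable.
move=> A; rewrite -bigcup_seq/= => -[i _ [B mB <-]] /=.
rewrite setTI -[X in measurable X]setTI.
exact: (mf i).
Qed.

End measurability.

Section euclidean.
Context {R : realType}.

Definition dot n (x y : 'rV[R]_n) : R := \sum_i x ord0 i * y ord0 i.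

Definition enorm n (x : 'rV[R]_n) : R := Num.sqrt (dot x x).

Definition sphere n : set 'rV[R]_n := [set x | enorm x = 1].

Definition orth n (xi : 'rV[R]_n) : set 'rV[R]_n := [set x | dot x xi = 0].

Definition orth_proj n (xi x : 'rV[R]_n) : 'rV[R]_n := x - dot x xi *: xi.

Lemma measurable_dot d (T : measurableType d) n (f g : T -> 'rV[R]_n) :
  measurable_fun setT f -> measurable_fun setT g ->
  measurable_fun setT (fun x => dot (f x) (g x)).
Proof.
move=> mf mg; apply: measurable_sum => i; apply: measurable_funM.
  exact: (measurableT_comp (measurable_rV_coord i) mf).
exact: (measurableT_comp (measurable_rV_coord i) mg).
Qed.

Lemma measurable_enorm n : measurable_fun setT (@enorm n).
Proof.
apply: (@measurableT_comp _ _ _ _ _ _ (@Num.sqrt R)).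
  exact: (continuous_measurable_fun (@sqrt_continuous R)).
exact: measurable_dot.
Qed.

Lemma measurable_unit_ball n : measurable [set x : 'rV[R]_n | enorm x <= 1].
Proof.
rewrite -[X in measurable X]setTI.
rewrite (_ : [set x | _] = @enorm n @^-1` `]-oo, 1]).
  by apply: measurable_enorm.
by apply/seteqP; split => x /=; rewrite in_itv.
Qed.

End euclidean.

Section lebesgue.
Context {R : realType}.

Definition rV_cons n (p : measurableTypeR R * 'rV[R]_n) : 'rV[R]_n.+1 :=
  row_mx (p.1 : R)%:M p.2.

Lemma measurable_rV_cons n : measurable_fun setT (@rV_cons n).
Proof.
apply: measurable_fun_rVP => i.
case: (splitP (i : 'I_(1 + n))) => j ij.
  rewrite (_ : (fun _ => _) = fst); first exact: measurable_fst.
  apply/funext => x; have -> : i = lshift n j :> 'I_(1 + n) by exact/val_inj.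
  by apply: etrans (row_mxEl _ _ _ _) _; rewrite mxE [j]ord1 eqxx mulr1n.
rewrite (_ : (fun _ => _) = (fun x : 'rV[R]_n => x ord0 j) \o snd).
  exact: (measurableT_comp (measurable_rV_coord j) measurable_snd).
apply/funext => x; have -> : i = rshift 1 j :> 'I_(1 + n) by exact/val_inj.
exact: row_mxEr.
Qed.

Definition image_measure d1 d2 (T1 : measurableType d1) (T2 : measurableType d2)
    (m : {measure set T1 -> \bar R}) (f : T1 -> T2)
    (mf : measurable_fun [set: T1] f) : set T2 -> \bar R :=
  pushforward m f.

Section image_measure.
Context d1 d2 (T1 : measurableType d1) (T2 : measurableType d2).
Variables (m : {measure set T1 -> \bar R}) (f : T1 -> T2).
Variable mf : measurable_fun [set: T1] f.

Let im0 : image_measure m mf set0 = 0%E. Proof. exact: measure0. Qed.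

Let im_ge0 A : (0 <= image_measure m mf A)%E. Proof. exact: measure_ge0. Qed.

Let im_sigma_additive : semi_sigma_additive (image_measure m mf).
Proof. exact: measure_semi_sigma_additive. Qed.

HB.instance Definition _ := isMeasure.Build _ _ _ (image_measure m mf)
  im0 im_ge0 im_sigma_additive.

End image_measure.

Section step.
Variables (n : nat) (m : {sigma_finite_measure set 'rV[R]_n -> \bar R}).

Definition lebesgue_rV_step : set 'rV[R]_n.+1 -> \bar R :=
  image_measure (lebesgue_measure \x m)%E (@measurable_rV_cons n).

HB.instance Definition _ := Measure.on lebesgue_rV_step.

Let step_sigma_finite : sigma_finite setT lebesgue_rV_step.
Proof.
have /sigma_finiteP[F [TF ndF Foo]] := sigma_finiteT (@lebesgue_measure R).
have /sigma_finiteP[G [TG ndG Goo]] := sigma_finiteT m.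
pose hd (x : 'rV[R]_n.+1) : measurableTypeR R := x ord0 ord0.
pose tl (x : 'rV[R]_n.+1) : 'rV[R]_n := rsubmx (x : 'rV[R]_(1 + n)).
have mhd : measurable_fun setT hd by exact: measurable_rV_coord.
have mtl : measurable_fun setT tl.
  apply: measurable_fun_rVP => i; rewrite (_ : (fun _ => _) =
      fun x : 'rV[R]_n.+1 => x ord0 (rshift 1 i)); last first.
    by apply/funext => x; rewrite mxE.
  exact: measurable_rV_coord.
exists (fun k => hd @^-1` F k `&` tl @^-1` G k).
  apply/seteqP; split => // x _.
  have : setT (hd x) by []. rewrite TF => -[i _ Fx].
  have : setT (tl x) by []. rewrite TG => -[j _ Gx].
  exists (maxn i j) => //; split.
    by have /(_ _ Fx) : F i `<=` F (maxn i j) by exact/subsetPset/ndF/leq_maxl.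
  by have /(_ _ Gx) : G j `<=` G (maxn i j) by exact/subsetPset/ndG/leq_maxr.
move=> k; have [mF Fk] := Foo k; have [mG Gk] := Goo k; split.
  by apply: measurableI; rewrite -[X in measurable X]setTI; [exact: mhd|exact: mtl].
rewrite /lebesgue_rV_step /image_measure /pushforward.
rewrite (_ : _ @^-1` _ = F k `*` G k).
  have /= -> := product_measure1E (@lebesgue_measure R) m mF mG.
  by rewrite lte_mul_pinfty// ge0_fin_numE.
have hdE (p : measurableTypeR R * 'rV[R]_n) : hd (rV_cons p) = p.1.
  rewrite /hd /rV_cons (_ : ord0 = lshift n ord0 :> 'I_(1 + n)); last exact/val_inj.
  by apply: etrans (row_mxEl _ _ _ _) _; rewrite mxE eqxx mulr1n.
have tlE (p : measurableTypeR R * 'rV[R]_n) : tl (rV_cons p) = p.2.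
  exact: row_mxKr.
by apply/seteqP; split => p /=; rewrite hdE tlE.
Qed.

HB.instance Definition _ := Measure_isSigmaFinite.Build _ _ _
  lebesgue_rV_step step_sigma_finite.

End step.

Fixpoint lebesgue_rV n : {sigma_finite_measure set 'rV[R]_n -> \bar R} :=
  match n with
  | 0%N => @dirac _ _ (0 : 'rV[R]_0) R
  | k.+1 => lebesgue_rV_step (lebesgue_rV k)
  end.

End lebesgue.

Section sphere_and_hyperplane.
Context {R : realType}.

Definition normalize n (x : 'rV[R]_n) : 'rV[R]_n := (enorm x)^-1 *: x.

Lemma measurable_normalize n : measurable_fun setT (@normalize n).
Proof.
apply: measurable_fun_rVP => i.
rewrite (_ : (fun _ => _) = (fun x : 'rV[R]_n => enorm x `^ (-1) * x ord0 i)).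
  apply: measurable_funM; last exact: measurable_rV_coord.
  exact: (measurableT_comp (measurable_powR (-1)) (@measurable_enorm R n)).
by apply/funext => x; rewrite mxE powR_inv1 // sqrtr_ge0.
Qed.

(* Surface measure of S^(n-1) through the cones over its subsets:
   A |-> n * |{x : |x| <= 1 and x / |x| \in A}|. *)
Definition sphere_measure n : set 'rV[R]_n -> \bar R :=
  mscale (n%:R%:nng) (image_measure
    (mrestr (lebesgue_rV n) (@measurable_unit_ball R n))
    (@measurable_normalize n)).

HB.instance Definition _ n := Measure.on (@sphere_measure n).

(* The rows of B form an orthonormal basis of the hyperplane orthogonal to xi. *)
Definition orth_frames n (xi : 'rV[R]_n) : set 'M[R]_(n.-1, n) :=
  [set B | B *m B^T = 1%:M /\ B *m xi^T = 0].

Definition orth_frame n (xi : 'rV[R]_n) : 'M[R]_(n.-1, n) :=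
  get (orth_frames xi).

Lemma measurable_mulmxr m n (B : 'M[R]_(m, n)) :
  measurable_fun setT (fun y : 'rV[R]_m => y *m B).
Proof.
apply: measurable_fun_rVP => i.
rewrite (_ : (fun _ => _) = fun x : 'rV[R]_m => \sum_j x ord0 j * B j i).
  apply: measurable_sum => j; apply: measurable_funM => //.
  exact: measurable_rV_coord.
by apply/funext => x; rewrite mxE.
Qed.

(* Lebesgue measure of the hyperplane orthogonal to the unit vector xi, in
   orthonormal coordinates; it does not depend on the frame that is chosen. *)
Definition orth_lebesgue n (xi : 'rV[R]_n) : set 'rV[R]_n -> \bar R :=
  image_measure (lebesgue_rV n.-1) (measurable_mulmxr (orth_frame xi)).

HB.instance Definition _ n (xi : 'rV[R]_n) := Measure.on (orth_lebesgue xi).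

End sphere_and_hyperplane.

Section complex_integral.
Context d (T : measurableType d) (R : realType).
Variables (mu : {measure set T -> \bar R}) (D : set T).
Implicit Type f : T -> R[i].

Definition cmeasurable f : Prop :=
  measurable_fun D (fun x => complex.Re (f x)) /\
  measurable_fun D (fun x => complex.Im (f x)).

Definition cintegrable f : Prop :=
  mu.-integrable D (fun x => (complex.Re (f x))%:E) /\
  mu.-integrable D (fun x => (complex.Im (f x))%:E).

Definition cintegral f : R[i] :=
  (\int[mu]_(x in D) complex.Re (f x)) +i*
  (\int[mu]_(x in D) complex.Im (f x)).

Definition sqnorm_L2 f : \bar R :=
  (\int[mu]_(x in D) (ComplexField.Normc.normc (f x) ^+ 2)%:E)%E.

Definition is_L2 f : Prop := cmeasurable f /\ (sqnorm_L2 f < +oo)%E.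

End complex_integral.

Section gaussian_states.
Context {R : realType} (d : nat).
Implicit Types (h : R) (x y xi w : 'rV[R]_d).

Definition smooth (g : R -> R) : Prop :=
  forall (n : nat) (t : R), derivable (derive1n n g) t 1.

Definition expi (t : R) : R[i] := cos t +i* sin t.

Definition plane_wave h x w : R[i] := expi (- (dot x w / h)).

Definition amplitude (chi : R -> R) h xi w : R :=
  chi (enorm (w - xi) / h `^ (3^-1)) * expR (- (enorm (w - xi) ^+ 2 / (2 * h))).

Definition gaussian_state (chi : R -> R) h x xi w : R[i] :=
  (amplitude chi h xi w)%:C * plane_wave h x w.

Definition coefficient (chi : R -> R) h (f : 'rV[R]_d -> R[i]) xi x : R[i] :=
  cintegral (@sphere_measure R d) (@sphere R d)
    (fun w => (gaussian_state chi h x xi w)^* * f w).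

Definition truncated_fourier h xi (F : 'rV[R]_d -> R[i]) (r : R) y : R[i] :=
  cintegral (orth_lebesgue xi) (orth xi `&` [set x | enorm x <= r])
    (fun x => plane_wave h x y * F x).

(* U(y) = int_{x _|_ xi} e^{- i x.y / h} F(x) dx in the L^2 sense: the integrals
   over |x| <= r converge to U in L^2 of the hyperplane as r -> +oo. *)
Definition is_L2_fourier h xi (F U : 'rV[R]_d -> R[i]) : Prop :=
  [/\ is_L2 (orth_lebesgue xi) (orth xi) F,
      is_L2 (orth_lebesgue xi) (orth xi) U
    & sqnorm_L2 (orth_lebesgue xi) (orth xi)
        (fun y => U y - truncated_fourier h xi F r y) @[r --> +oo] --> 0%E].

(* G (xi, w) is a jointly measurable version of
     int_{x _|_ xi} phi_{x,xi}(w) <phi_{x,xi}, f> dx,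
   the x-integral being taken in the L^2 sense; for x _|_ xi,
   phi_{x,xi}(w) = amplitude xi w * e^{- i x.(orth_proj xi w) / h}. *)
Definition is_fiber_integral (chi : R -> R) h (f : 'rV[R]_d -> R[i])
    (G : 'rV[R]_d * 'rV[R]_d -> R[i]) : Prop :=
  cmeasurable (@sphere R d `*` @sphere R d) G /\
  forall xi, sphere xi -> exists U : 'rV[R]_d -> R[i],
    is_L2_fourier h xi (coefficient chi h f xi) U /\
    {ae @sphere_measure R d, forall w, sphere w ->
      G (xi, w) = (amplitude chi h xi w)%:C * U (orth_proj xi w)}.

End gaussian_states.

(* Main.v *)
From HB Require Import structures.
Require Import Defs.
From mathcomp Require Import all_boot all_order all_algebra.
From mathcomp Require Import all_classical all_reals all_analysis.
From mathcomp Require Import measurable_realfun complex ring lra.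

Set Implicit Arguments.
Unset Strict Implicit.
Unset Printing Implicit Defensive.

Import Order.TTheory GRing.Theory Num.Theory.
Import numFieldNormedType.Exports.

Local Open Scope classical_set_scope.
Local Open Scope ring_scope.
Local Open Scope complex_scope.

(** Fix a point [xi] of the sphere and put n = d - 1.  Near [xi] the sphere is
    the graph of [height y = sqrt (1 - |y|^2)] over the hyperplane orthogonal to
    [xi], and surface measure is [dy / height y] there
    ([ge0_integral_graph]).  A frequency [x] orthogonal to [xi] sees only the
    coordinate [y], so the coefficient <phi_{x,xi}, f> is the Fourier transform,
    at scale 1/h, of the function [g = amplitude * f / height] of n variables
    ([coefficient_frame]).  The integral over [x] inverts this transform and
    returns (2 pi h)^n g ([fourier_inversion_L2]); multiplied by the remaining
    amplitude it is
<<
      (2 pi h)^n * amplitude xi w ^+ 2 / (w . xi) * f w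
>>
    for almost every [w] ([fiber_transform_sphere]).  Integrating over [xi], the
    factor [f w] comes out.  What is left does not depend on [w], because the
    amplitude depends only on the distance of [xi] and [w]: in graph coordinates
    centred at [w] it becomes the integral [normalizer]
    ([integral_sphere_kernel]).  Hence c_h is the inverse of
    (2 pi h)^n * normalizer.

    For the asymptotics substitute y = sqrt h u in the normalizing integral.  The
    squared distance of [xi] to the graph point over [y] is 2 - 2 height y, which
    is about h |u|^2, and the cutoff tends to 1 because its radius h^(1/3) is much
    larger than sqrt h.  So the integrand tends to exp (- |u|^2).  It is at most
    4 exp (- |u|^2), because the cutoff only leaves points with [w . xi] above
    1/2; by dominated convergence the normalizer is equivalent to (pi h)^(n/2)
    ([normalizer_cvg]).

    The inner integral exists only as a limit in L^2, and the Fourier analysis is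
    developed for that purpose: the Plancherel identity for integrable functions
    on the line ([plancherel1]), then in n variables by Fubini ([plancherel]).
    Expanding the square and using Plancherel twice, the squared L^2 error of the
    transform truncated to |x| <= r is a constant times the mass of the transform
    of [g] outside that ball, which tends to 0.

    An L^2 limit is determined up to null sets, separately for every [xi].
    A null set of the hyperplane corresponds to a null set of the part of the
    sphere where the amplitude does not vanish ([fiber_value_unique]), and Tonelli
    exchanges the quantifiers: two versions of the fiber integral that agree for
    every [xi] at almost every [w] agree for almost every [w] at almost every [xi]
    ([ae_swap]). *)

(** * Complex-valued integrals *)

Local Notation cabs := ComplexField.Normc.normc.

Section complex_numbers.
Context {R : realType}.
Implicit Types (z w : R[i]) (t : R).
Local Notation Re := complex.Re.
Local Notation Im := complex.Im.

Lemma cReM z w : Re (z * w) = Re z * Re w - Im z * Im w.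
Proof. by case: z w => a b [c d]. Qed.

Lemma cImM z w : Im (z * w) = Re z * Im w + Im z * Re w.
Proof. by case: z w => a b [c d]. Qed.

Lemma cReD z w : Re (z + w) = Re z + Re w.
Proof. by case: z w => a b [c d]. Qed.

Lemma cImD z w : Im (z + w) = Im z + Im w.
Proof. by case: z w => a b [c d]. Qed.

Lemma cReN z : Re (- z) = - Re z. Proof. by case: z. Qed.
Lemma cImN z : Im (- z) = - Im z. Proof. by case: z. Qed.
Lemma cReJ z : Re z^* = Re z. Proof. by case: z. Qed.
Lemma cImJ z : Im z^* = - Im z. Proof. by case: z. Qed.
Lemma cRereal t : Re (t%:C) = t. Proof. by []. Qed.
Lemma cImreal t : Im (t%:C) = 0. Proof. by []. Qed.

(** Reduces an identity in [R[i]] to polynomial identities between real and imaginary parts.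
    *)
Definition partsE := (cReM, cImM, cReD, cImD, cReN, cImN, cReJ, cImJ, cRereal, cImreal).

Lemma complex_eq z w : Re z = Re w -> Im z = Im w -> z = w.
Proof. by case: z w => a b [c d] /= -> ->. Qed.

Lemma cabs_sqr z : cabs z ^+ 2 = Re z ^+ 2 + Im z ^+ 2.
Proof. by case: z => a b /=; rewrite sqr_sqrtr// addr_ge0 ?sqr_ge0. Qed.

Lemma cabs_ge0 z : 0 <= cabs z.
Proof. by case: z => a b /=; rewrite sqrtr_ge0. Qed.

Lemma cabsM z w : cabs (z * w) = cabs z * cabs w.
Proof. exact: ComplexField.Normc.normcM. Qed.

Lemma cabsD z w : cabs (z + w) <= cabs z + cabs w.
Proof. exact: le_normcD. Qed.

Lemma cabsN z : cabs (- z) = cabs z.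
Proof. by case: z => a b /=; rewrite !sqrrN. Qed.

Lemma cabsJ z : cabs z^* = cabs z.
Proof. by case: z => a b /=; rewrite sqrrN. Qed.

Lemma cabs0 : cabs (0 : R[i]) = 0.
Proof. by rewrite /= expr0n /= addr0 sqrtr0. Qed.

Lemma cabs_eq0 z : cabs z = 0 -> z = 0.
Proof. exact: ComplexField.Normc.eq0_normc. Qed.

Lemma cabs_real t : cabs t%:C = `|t|.
Proof. by rewrite /= expr0n /= addr0 sqrtr_sqr. Qed.

Lemma cabs_expi t : cabs (expi t) = 1.
Proof. by rewrite /= cos2Dsin2 sqrtr1. Qed.

Lemma normr_Re z : `|Re z| <= cabs z.
Proof.
by rewrite -(ler_pXn2r (n := 2))// ?nnegrE ?cabs_ge0// cabs_sqr real_normK ?num_real// lerDl sqr_ge0.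
Qed.

Lemma normr_Im z : `|Im z| <= cabs z.
Proof.
by rewrite -(ler_pXn2r (n := 2))// ?nnegrE ?cabs_ge0// cabs_sqr real_normK ?num_real// lerDr sqr_ge0.
Qed.

Lemma cabs_le_parts z : cabs z <= `|Re z| + `|Im z|.
Proof.
rewrite -(ler_pXn2r (n := 2))// ?nnegrE ?cabs_ge0 ?addr_ge0//.
rewrite cabs_sqr sqrrD !real_normK ?num_real// addrAC lerDl.
by rewrite mulrn_wge0// mulr_ge0.
Qed.

Lemma mulJc z : z^* * z = (cabs z ^+ 2)%:C.
Proof. by apply: complex_eq; rewrite ?partsE ?cabs_sqr; ring. Qed.

Lemma expiD t u : expi (t + u) = expi t * expi u :> R[i].
Proof. by apply: complex_eq; rewrite ?partsE /= ?cosD ?sinD; ring. Qed.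

Lemma expiN t : expi (- t) = (expi t)^* :> R[i].
Proof. by rewrite /expi cosN sinN. Qed.

Lemma expi0 : expi (0 : R) = 1.
Proof. by rewrite /expi cos0 sin0. Qed.

End complex_numbers.

Section complex_measurability.
Context d (T : measurableType d) (R : realType) (D : set T).
Implicit Types f g : T -> R[i].
Local Notation Re := complex.Re.
Local Notation Im := complex.Im.

Lemma cmeasurable_cabs f : cmeasurable D f -> measurable_fun D (fun x => cabs (f x)).
Proof.
move=> [mr mi].
rewrite (_ : (fun x => _) = fun x => Num.sqrt (Re (f x) ^+ 2 + Im (f x) ^+ 2)).
  apply: (@measurableT_comp _ _ _ _ _ _ (@Num.sqrt R)).
    exact: (continuous_measurable_fun (@sqrt_continuous R)).
  by apply: measurable_funD; exact: measurable_funX.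
by apply/funext => x; case: (f x).
Qed.

Lemma cmeasurable_cst (c : R[i]) : cmeasurable D (fun=> c).
Proof. by split; exact: measurable_cst. Qed.

Lemma cmeasurable_real (f : T -> R) : measurable_fun D f -> cmeasurable D (fun x => (f x)%:C).
Proof. by move=> mf; split => //; exact: measurable_cst. Qed.

Lemma cmeasurableM f g : cmeasurable D f -> cmeasurable D g ->
  cmeasurable D (fun x => f x * g x).
Proof.
move=> [rf jf] [rg jg]; split.
  under eq_fun do rewrite cReM.
  by apply: measurable_funB; exact: measurable_funM.
under eq_fun do rewrite cImM.
by apply: measurable_funD; exact: measurable_funM.
Qed.

Lemma cmeasurableD f g : cmeasurable D f -> cmeasurable D g ->
  cmeasurable D (fun x => f x + g x).
Proof.
move=> [rf jf] [rg jg]; split; under eq_fun do rewrite partsE;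
  exact: measurable_funD.
Qed.

Lemma cmeasurableN f : cmeasurable D f -> cmeasurable D (fun x => - f x).
Proof.
move=> [rf jf]; split; under eq_fun do rewrite partsE;
  exact: measurableT_comp.
Qed.

Lemma cmeasurableB f g : cmeasurable D f -> cmeasurable D g ->
  cmeasurable D (fun x => f x - g x).
Proof. by move=> mf mg; apply: cmeasurableD => //; exact: cmeasurableN. Qed.

Lemma cmeasurableJ f : cmeasurable D f -> cmeasurable D (fun x => (f x)^*).
Proof.
move=> [rf jf]; split; first by under eq_fun do rewrite cReJ.
by under eq_fun do rewrite cImJ; exact: measurableT_comp.
Qed.

Lemma cmeasurable_expi (f : T -> R) : measurable_fun D f ->
  cmeasurable D (fun x => expi (f x)).
Proof.
move=> mf; split => /=; (apply: measurableT_comp => //; apply: continuous_measurable_fun).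
  exact: continuous_cos.
exact: continuous_sin.
Qed.

End complex_measurability.

Lemma cmeasurable_comp d1 d2 (T1 : measurableType d1) (T2 : measurableType d2)
    (R : realType) (f : T2 -> R[i]) (g : T1 -> T2) :
  cmeasurable setT f -> measurable_fun setT g -> cmeasurable setT (fun x => f (g x)).
Proof.
by move=> [rf jf] mg; split; [exact: (measurableT_comp rf mg)|exact: (measurableT_comp jf mg)].
Qed.

Section complex_integrals.
Context d (T : measurableType d) (R : realType).
Variables (mu : {measure set T -> \bar R}) (D : set T) (mD : measurable D).
Implicit Types f g : T -> R[i].
Local Notation Re := complex.Re.
Local Notation Im := complex.Im.

Lemma cintegrable_measurable f : cintegrable mu D f -> cmeasurable D f.
Proof.
by move=> [/measurable_int/measurable_EFinP ? /measurable_int/measurable_EFinP ?].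
Qed.

Lemma integrable_norm_lty (f : T -> R) : measurable_fun D f ->
  (\int[mu]_(x in D) `|f x|%:E < +oo)%E -> mu.-integrable D (EFin \o f).
Proof.
by move=> mf fi; apply/integrableP; split; first exact/measurable_EFinP.
Qed.

(** Integrability of both parts is integrability of the modulus; this turns domination and
    Tonelli arguments into arguments about one nonnegative function. *)
Lemma cintegrableP f : cintegrable mu D f <->
  cmeasurable D f /\ (\int[mu]_(x in D) (cabs (f x))%:E < +oo)%E.
Proof.
split=> [If|[mf fi]].
  have mf := cintegrable_measurable If; split => //.
  case: If => /integrableP[_ ri] /integrableP[_ ii].
  have m1 : measurable_fun D (fun x => `|(Re (f x))%:E|%E).
    by apply: measurableT_comp => //; apply/measurable_EFinP; exact: mf.1.
  have m2 : measurable_fun D (fun x => `|(Im (f x))%:E|%E).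
    by apply: measurableT_comp => //; apply/measurable_EFinP; exact: mf.2.
  have := lte_add_pinfty ri ii.
  rewrite -ge0_integralD//=; apply: le_lt_trans; apply: ge0_le_integral => //.
  - by move=> x _; rewrite lee_fin cabs_ge0.
  - exact/measurable_EFinP/cmeasurable_cabs.
  - exact: emeasurable_funD.
  - by move=> x _; rewrite -EFinD lee_fin cabs_le_parts.
have mc := cmeasurable_cabs mf; case: mf => mr mi.
split; (apply: integrable_norm_lty => //; apply: le_lt_trans fi;
  apply: ge0_le_integral => //; [|exact/measurable_EFinP|]).
- by apply/measurable_EFinP; apply: measurableT_comp.
- by move=> x _; rewrite lee_fin normr_Re.
- by apply/measurable_EFinP; apply: measurableT_comp.
- by move=> x _; rewrite lee_fin normr_Im.
Qed.

Lemma integrable_cabs f : cintegrable mu D f ->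
  mu.-integrable D (fun x => (cabs (f x))%:E).
Proof.
move=> /cintegrableP[mf fi]; apply: integrable_norm_lty => //.
  exact: cmeasurable_cabs.
by under eq_integral do rewrite ger0_norm ?cabs_ge0//.
Qed.

Lemma integrable_scale (c : R) (f : T -> R) : mu.-integrable D (EFin \o f) ->
  mu.-integrable D (EFin \o (fun x => c * f x)).
Proof. by move=> fi; exact: (integrableZl mD c fi). Qed.

Lemma le_cintegrable f (g : T -> R) : cmeasurable D f ->
  mu.-integrable D (EFin \o g) -> (forall x, D x -> cabs (f x) <= g x) ->
  cintegrable mu D f.
Proof.
move=> mf ig fg; apply/cintegrableP; split => //.
have /integrableP[mg] := ig; apply: le_lt_trans; apply: ge0_le_integral => //.
- by move=> x _; rewrite lee_fin cabs_ge0.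
- exact/measurable_EFinP/cmeasurable_cabs.
- exact: measurableT_comp.
- by move=> x Dx; rewrite lee_fin (le_trans (fg _ Dx))// ler_norm.
Qed.

Lemma cintegrable_le f g : cmeasurable D f -> cintegrable mu D g ->
  (forall x, D x -> cabs (f x) <= cabs (g x)) -> cintegrable mu D f.
Proof. by move=> mf ig fg; apply: le_cintegrable (integrable_cabs ig) fg. Qed.

Lemma cintegrableM_bounded f g (M : R) : cmeasurable D f -> cintegrable mu D g ->
  (forall x, D x -> cabs (f x) <= M) -> cintegrable mu D (fun x => f x * g x).
Proof.
move=> mf ig fM; apply: (@le_cintegrable _ (fun x => M * cabs (g x))).
- by apply: cmeasurableM => //; exact: cintegrable_measurable ig.
- exact: (integrable_scale M (integrable_cabs ig)).
- by move=> x Dx; rewrite cabsM ler_wpM2r ?cabs_ge0// fM.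
Qed.

Lemma cintegrableZl (c : R[i]) f : cintegrable mu D f -> cintegrable mu D (fun x => c * f x).
Proof.
move=> If; have mc : cmeasurable D (fun=> c) by exact: cmeasurable_cst.
by apply: (cintegrableM_bounded mc If (M := cabs c)) => x _.
Qed.

Lemma cintegrableJ f : cintegrable mu D f -> cintegrable mu D (fun x => (f x)^*).
Proof.
move=> If; apply: (cintegrable_le _ If).
  exact: (cmeasurableJ (cintegrable_measurable If)).
by move=> x _; rewrite cabsJ.
Qed.

Lemma Re_cintegral f : Re (cintegral mu D f) = Rintegral mu D (fun x => Re (f x)).
Proof. by []. Qed.

Lemma Im_cintegral f : Im (cintegral mu D f) = Rintegral mu D (fun x => Im (f x)).
Proof. by []. Qed.

Lemma cintegralZl (c : R[i]) f : cintegrable mu D f ->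
  cintegral mu D (fun x => c * f x) = c * cintegral mu D f.
Proof.
move=> [ri ii]; apply: complex_eq; rewrite ?cReM ?cImM.
  rewrite 2!Re_cintegral Im_cintegral; under eq_Rintegral do rewrite cReM.
  rewrite RintegralB ?RintegralZl//.
  - exact: integrable_scale.
  - exact: integrable_scale.
rewrite 2!Im_cintegral Re_cintegral; under eq_Rintegral do rewrite cImM.
rewrite RintegralD ?RintegralZl//.
- exact: integrable_scale.
- exact: integrable_scale.
Qed.

Lemma cintegralJ f : cintegrable mu D f ->
  cintegral mu D (fun x => (f x)^*) = (cintegral mu D f)^*.
Proof.
move=> [ri ii]; apply: complex_eq; rewrite ?(cReJ, cImJ).
  by rewrite 2!Re_cintegral; apply: eq_Rintegral => x _; rewrite cReJ.
rewrite 2!Im_cintegral -mulN1r -RintegralZl//; apply: eq_Rintegral => x _.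
by rewrite cImJ mulN1r.
Qed.

Lemma eq_cintegral f g : (forall x, D x -> f x = g x) -> cintegral mu D f = cintegral mu D g.
Proof.
by move=> fg; congr Complex; apply: eq_Rintegral => x /set_mem Dx; rewrite fg.
Qed.

(** Multiplied by its own conjugate the integral becomes a nonnegative real, hence the
    integral of a real part. *)
Lemma cabs_cintegral f : cintegrable mu D f ->
  ((cabs (cintegral mu D f))%:E <= \int[mu]_(x in D) (cabs (f x))%:E)%E.
Proof.
move=> If; set z := cintegral mu D f.
have ai := integrable_cabs If.
have afin : (\int[mu]_(x in D) (cabs (f x))%:E)%E \is a fin_num by apply: integrable_fin_num.
rewrite -(fineK afin) lee_fin -/(Rintegral mu D (fun x => cabs (f x))).
set I := Rintegral _ _ _.
have I0 : 0 <= I by apply: Rintegral_ge0 => x _; exact: cabs_ge0.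
have [->//|z0] := eqVneq (cabs z) 0.
have z_gt0 : 0 < cabs z by rewrite lt_neqAle eq_sym z0 cabs_ge0.
rewrite -(ler_pM2l z_gt0) -expr2.
rewrite -[cabs z ^+ 2]/(Re (cabs z ^+ 2)%:C) -mulJc -cintegralZl// Re_cintegral.
rewrite -RintegralZl//.
apply: le_Rintegral => //.
- exact: (cintegrableZl _ If).1.
- exact: integrable_scale.
- move=> x _; rewrite (le_trans (ler_norm _))// (le_trans (normr_Re _))//.
  by rewrite cabsM cabsJ.
Qed.

End complex_integrals.

Section almost_everywhere.
Context d (T : measurableType d) (R : realType) (mu : {measure set T -> \bar R}).
Implicit Types P Q S : T -> Prop.

Lemma ae_imp P Q : {ae mu, forall x, P x} -> (forall x, P x -> Q x) -> {ae mu, forall x, Q x}.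
Proof.
by move=> aP PQ; exact: (@filterS _ _ (ae_filter_ringOfSetsType mu) _ _ PQ aP).
Qed.

Lemma ae_imp2 P Q S : {ae mu, forall x, P x} -> {ae mu, forall x, Q x} ->
  (forall x, P x -> Q x -> S x) -> {ae mu, forall x, S x}.
Proof.
by move=> aP aQ PQ; exact: (@filterS2 _ _ (ae_filter_ringOfSetsType mu) _ _ _ PQ aP aQ).
Qed.

End almost_everywhere.

Section ae_complex.
Context d (T : measurableType d) (R : realType) (m : {measure set T -> \bar R}).
Variables (D : set T) (mD : measurable D).
Implicit Types f g : T -> R[i].

Lemma ae_cintegrable f g : cmeasurable D f -> cintegrable m D g ->
  {ae m, forall x, D x -> f x = g x} -> cintegrable m D f.
Proof.
move=> mf Ig fg; have [mg fin] := (cintegrableP m mD g).1 Ig.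
apply/(cintegrableP m mD); split => //; apply: le_lt_trans fin.
rewrite le_eqVlt; apply/orP; left; apply/eqP.
apply: ae_eq_integral => //.
- by apply/measurable_EFinP; exact: cmeasurable_cabs.
- by apply/measurable_EFinP; exact: cmeasurable_cabs.
- by apply: (ae_imp fg) => x fgx Dx; rewrite fgx.
Qed.

Lemma ae_cintegral f g : cmeasurable D f -> cmeasurable D g ->
  {ae m, forall x, D x -> f x = g x} -> cintegral m D f = cintegral m D g.
Proof.
move=> [rf jf] [rg jg] fg; congr Complex; congr fine; apply: ae_eq_integral => //;
  try exact/measurable_EFinP; by apply: (ae_imp fg) => x fgx Dx; rewrite fgx.
Qed.

End ae_complex.

Lemma integral_cabs_sqr_ge0 d (X : measurableType d) (R : realType) (m : {measure set X -> \bar R}) (f : X -> R[i]) :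
  (0 <= \int[m]_x (cabs (f x) ^+ 2)%:E)%E.
Proof. by apply: integral_ge0 => x _; rewrite lee_fin exprn_ge0// cabs_ge0. Qed.

Lemma measurable_cabs_sqr d (X : measurableType d) (R : realType) (D : set X) (f : X -> R[i]) :
  cmeasurable D f ->
  measurable_fun D (fun x => (cabs (f x) ^+ 2)%:E).
Proof. by move=> mf; apply/measurable_EFinP; apply: measurable_funX; exact: cmeasurable_cabs. Qed.

Section fubini.
Context d1 d2 (T1 : measurableType d1) (T2 : measurableType d2) (R : realType).
Variables (m1 : {sigma_finite_measure set T1 -> \bar R}).
Variables (m2 : {sigma_finite_measure set T2 -> \bar R}).
Local Notation Re := complex.Re.
Local Notation Im := complex.Im.

Lemma measurable_Rintegral (f : T1 * T2 -> R) : measurable_fun setT f ->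
  measurable_fun setT (fun x => Rintegral m2 setT (fun y => f (x, y))).
Proof.
move=> /measurable_EFinP mf.
rewrite (_ : (fun _ => _) = fine \o
    (fubini_F m2 (EFin \o f)^\+ \- fubini_F m2 (EFin \o f)^\-)%E).
  apply: measurableT_comp; first exact: fine_measurable.
  apply: emeasurable_funB; apply: measurable_fun_fubini_tonelli_F => //.
    exact: measurable_funepos.
  exact: measurable_funeneg.
apply/funext => x; rewrite /Rintegral /= integralE; congr fine.
by congr (_ - _)%E; apply: eq_integral => y _; rewrite ?(funeposE, funenegE).
Qed.

Lemma cmeasurable_cintegral (F : T1 * T2 -> R[i]) : cmeasurable setT F ->
  cmeasurable setT (fun x => cintegral m2 setT (fun y => F (x, y))).
Proof. by move=> [rF iF]; split; [exact: (measurable_Rintegral rF)|exact: (measurable_Rintegral iF)]. Qed.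

Lemma integrable_fine d (T : measurableType d) (m : {measure set T -> \bar R}) (f : T -> \bar R) :
  m.-integrable setT f -> m.-integrable setT (EFin \o (fine \o f)).
Proof.
move=> If; have mf := measurable_int _ If; apply: le_integrable If => //.
  by apply/measurable_EFinP; apply: measurableT_comp => //; exact: fine_measurable.
by move=> x _ /=; case: (f x) => [r| |] /=; rewrite ?lexx ?leey.
Qed.

Lemma integral_fine d (T : measurableType d) (m : {measure set T -> \bar R}) (f : T -> \bar R) :
  m.-integrable setT f -> (\int[m]_x (fine (f x))%:E = \int[m]_x f x)%E.
Proof.
move=> If; apply: ae_eq_integral => //.
- exact: measurable_int (integrable_fine If).
- exact: measurable_int If.
- have := integrable_ae measurableT If.
  by apply: filterS => x /(_ I) fx _; rewrite fineK.
Qed.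

Lemma RFubini (f : T1 * T2 -> R) : (m1 \x m2)%E.-integrable setT (EFin \o f) ->
  Rintegral m1 setT (fun x => Rintegral m2 setT (fun y => f (x, y))) =
  Rintegral m2 setT (fun y => Rintegral m1 setT (fun x => f (x, y))).
Proof.
move=> If; rewrite /Rintegral; congr fine.
have IF := integrable_fubini_F If.
have IG : m2.-integrable setT (fun y => \int[m1]_x (f (x, y))%:E)%E.
  have mf := measurable_int _ If.
  apply/integrableP; split; first exact: (measurable_fubini_G If).
  have := (integrable21ltyP m1 m2 mf).1 If; apply: le_lt_trans.
  apply: ge0_le_integral => //.
  - by apply: measurableT_comp => //; exact: (measurable_fubini_G If).
  - apply: (measurable_fun_fubini_tonelli_G (fun z => `|(EFin \o f) z|%E)) => //.
    exact: measurableT_comp.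
  - move=> y _; apply: le_abse_integral => //.
    exact: (measurableT_comp mf (pair2_measurable _)).
rewrite (integral_fine IF) (integral_fine IG).
exact: (Fubini If).
Qed.

Lemma cintegrable_prod (F : T1 * T2 -> R[i]) : cmeasurable setT F ->
  (\int[m1]_x \int[m2]_y (cabs (F (x, y)))%:E < +oo)%E ->
  cintegrable (m1 \x m2)%E setT F.
Proof.
move=> mF IF; apply/cintegrableP => //; split => //.
rewrite fubini_tonelli1//; first exact/measurable_EFinP/cmeasurable_cabs.
by move=> x; rewrite lee_fin cabs_ge0.
Qed.

(** Fubini, applied to the real and the imaginary part. *)
Lemma cFubini (F : T1 * T2 -> R[i]) : cmeasurable setT F ->
  (\int[m1]_x \int[m2]_y (cabs (F (x, y)))%:E < +oo)%E ->
  cintegral m1 setT (fun x => cintegral m2 setT (fun y => F (x, y))) =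
  cintegral m2 setT (fun y => cintegral m1 setT (fun x => F (x, y))).
Proof.
move=> mF /(cintegrable_prod mF)[Ir Ii].
by congr Complex; rewrite /=; [exact: (RFubini Ir)|exact: (RFubini Ii)].
Qed.

Lemma cintegrable_fubini (F : T1 * T2 -> R[i]) : cmeasurable setT F ->
  (\int[m1]_x \int[m2]_y (cabs (F (x, y)))%:E < +oo)%E ->
  cintegrable m1 setT (fun x => cintegral m2 setT (fun y => F (x, y))).
Proof.
move=> mF /(cintegrable_prod mF)[Ir Ii]; split; apply: integrable_fine.
  exact: (integrable_fubini_F Ir).
exact: (integrable_fubini_F Ii).
Qed.

Section multiplication_formula.
Variables (k : T1 * T2 -> R[i]) (u : T2 -> R[i]) (v : T1 -> R[i]).
Hypotheses (mk : cmeasurable setT k) (k1 : forall z, cabs (k z) = 1).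
Hypotheses (Iu : cintegrable m2 setT u) (Iv : cintegrable m1 setT v).

Let mu_ := cintegrable_measurable Iu.
Let mv_ := cintegrable_measurable Iv.

Let F z := v z.1 * (k z * u z.2).

Let mF : cmeasurable setT F.
Proof.
apply: cmeasurableM; first exact: (cmeasurable_comp mv_ measurable_fst).
by apply: cmeasurableM => //; exact: (cmeasurable_comp mu_ measurable_snd).
Qed.

Let IF : (\int[m1]_x \int[m2]_y (cabs (F (x, y)))%:E < +oo)%E.
Proof.
rewrite (_ : (\int[m1]_x _)%E = (\int[m1]_x (cabs (v x))%:E * \int[m2]_y (cabs (u y))%:E)%E).
  by rewrite lte_mul_pinfty// ?integral_ge0//; 
     [move=> ? _; rewrite lee_fin cabs_ge0|
      exact: integrable_fin_num (integrable_cabs _ Iv)|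
      exact: ((cintegrableP _ measurableT _).1 Iu).2].
rewrite -ge0_integralZr//; last 3 first.
- exact/measurable_EFinP/cmeasurable_cabs.
- by move=> x _; rewrite lee_fin cabs_ge0.
- by apply: integral_ge0 => x _; rewrite lee_fin cabs_ge0.
apply: eq_integral => x _; rewrite -ge0_integralZl//; last 3 first.
- exact/measurable_EFinP/cmeasurable_cabs.
- by move=> y _; rewrite lee_fin cabs_ge0.
- by rewrite lee_fin cabs_ge0.
by apply: eq_integral => y _; rewrite /F !cabsM k1 mul1r EFinM.
Qed.

Let mkx x : cmeasurable setT (fun y => k (x, y)).
Proof. exact: (cmeasurable_comp mk (pair1_measurable x)). Qed.

Let mky y : cmeasurable setT (fun x => k (x, y)).
Proof. exact: (cmeasurable_comp mk (pair2_measurable y)). Qed.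

(** The two sides are the two iterated integrals of [v x * k (x, y) * u y]. With [k] a plane
    wave this moves a Fourier transform from one factor of a product to the other. *)
Lemma multiplication_formula :
  cintegral m1 setT (fun x => cintegral m2 setT (fun y => k (x, y) * u y) * v x) =
  cintegral m2 setT (fun y => u y * cintegral m1 setT (fun x => k (x, y) * v x)).
Proof.
have := cFubini mF IF; rewrite /F /=.
under eq_cintegral => x _.
  rewrite cintegralZl//; last first.
    by apply: (@cintegrableM_bounded _ _ _ _ _ measurableT _ _ 1) => // y _; rewrite k1.
  rewrite mulrC; over.
move=> ->; apply: eq_cintegral => y _.
under eq_cintegral => x _ do rewrite mulrCA mulrA mulrC.
rewrite cintegralZl//.
by apply: (@cintegrableM_bounded _ _ _ _ _ measurableT _ _ 1) => // x _; rewrite k1.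
Qed.

End multiplication_formula.

End fubini.

(** * Affine changes of variable and densities *)

Section affine_change_of_variable.
Context {R : realType}.
Local Notation mu := (@lebesgue_measure R).

Lemma measurable_affine (a b : R) :
  measurable_fun setT (fun x : measurableTypeR R => a * x + b : measurableTypeR R).
Proof.
by apply: measurable_funD => //; apply: measurable_funM.
Qed.

Lemma lebesgue_measure_affine (a b : R) (A : set R) : a != 0 -> measurable A ->
  pushforward mu (fun x : measurableTypeR R => a * x + b : measurableTypeR R) A =
  (`|a|^-1%:E * mu A)%E.
Proof.
move=> a0 mA.
have na0 : 0 < `|a| by rewrite normr_gt0.
have na := ltW na0.
pose m1 := image_measure mu (measurable_affine a b).
suff E : mu A = mscale (NngNum na) m1 A.
  rewrite E /mscale /= /m1 /image_measure muleA -EFinM mulVf ?gt_eqF// mul1e//.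
apply: lebesgue_measure_unique => //= _ [[u v]] _ <-.
rewrite /mscale /m1 /image_measure /= /pushforward.
have [a_gt0|a_lt0|/eqP] := ltgtP 0 a; last by rewrite eq_sym (negbTE a0).
  rewrite (_ : _ @^-1` _ = `](u - b) / a, (v - b) / a]%classic); last first.
    apply/seteqP; split => x /=; rewrite !in_itv/= ltr_pdivrMr// ler_pdivlMr// => /andP[? ?];
      apply/andP; split; lra.
  rewrite !lebesgue_measure_itv/= !lte_fin ltr_pM2r ?invr_gt0// ltrD2r.
  case: ifP => uv; last by rewrite mule0.
  by rewrite -!EFinD -EFinM gtr0_norm//; congr EFin; field.
rewrite (_ : _ @^-1` _ = `[(v - b) / a, (u - b) / a[%classic); last first.
  apply/seteqP; split => x /=; rewrite !in_itv/= ltr_ndivlMr// ler_ndivrMr// => /andP[? ?];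
      apply/andP; split; lra.
rewrite !lebesgue_measure_itv/= !lte_fin ltr_nM2r ?invr_lt0// ltrD2r.
case: ifP => uv; last by rewrite mule0.
by rewrite -!EFinD -EFinM ltr0_norm//; congr EFin; field.
Qed.

(** The image of Lebesgue measure under an affine map is a multiple of it, since both give
    proportional lengths to intervals. *)
Lemma ge0_integral_affine (a b : R) (f : R -> \bar R) : a != 0 ->
  measurable_fun setT f -> (forall x, 0 <= f x)%E ->
  (\int[mu]_x f (a * x + b)%R = `|a|^-1%:E * \int[mu]_x f x)%E.
Proof.
move=> a0 mf f0.
have na : 0 <= `|a|^-1 by rewrite invr_ge0.
have := ge0_integral_pushforward (measurable_affine a b) mu measurableT mf (fun y _ => f0 y).
rewrite preimage_setT /= => <-.
rewrite -ge0_integralZl//.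
transitivity (\int[mscale (NngNum na) mu]_x f x)%E.
  apply: eq_measure_integral; first exact: measurable_affine.
  by move=> ? A mA _; exact: lebesgue_measure_affine.
by rewrite ge0_integral_mscale//= ge0_integralZl.
Qed.

Lemma ge0_integral_translate (b : R) (f : R -> \bar R) :
  measurable_fun setT f -> (forall x, 0 <= f x)%E ->
  (\int[mu]_x f (x + b)%R = \int[mu]_x f x)%E.
Proof.
move=> mf f0; have := @ge0_integral_affine 1 b f (oner_neq0 _) mf f0.
by rewrite normr1 invr1 mul1e; under eq_integral do rewrite mul1r.
Qed.

Lemma ge0_integral_reflect (b : R) (f : R -> \bar R) :
  measurable_fun setT f -> (forall x, 0 <= f x)%E ->
  (\int[mu]_x f (b - x)%R = \int[mu]_x f x)%E.
Proof.
move=> mf f0.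
have := @ge0_integral_affine (-1) b f _ mf f0; rewrite normrN1 invr1 mul1e => <-.
  by under [RHS]eq_integral do rewrite mulN1r addrC.
by rewrite oppr_eq0 oner_neq0.
Qed.

End affine_change_of_variable.

Section density.
Context d (T : measurableType d) (R : realType) (mu : {measure set T -> \bar R}).

Definition density_measure (g : T -> R) (mg : measurable_fun setT g)
    (g0 : forall x, 0 <= g x) (A : set T) : \bar R :=
  (\int[mu]_(x in A) (g x)%:E)%E.

Variables (g : T -> R) (mg : measurable_fun setT g) (g0 : forall x, 0 <= g x).
Local Notation density := (density_measure mg g0).

Let dens0 : density set0 = 0%E.
Proof. by rewrite /density_measure integral_set0. Qed.

Let dens_ge0 A : (0 <= density A)%E.
Proof. by apply: integral_ge0 => x _; rewrite lee_fin. Qed.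

Let mg' (D : set T) : measurable_fun D (fun x => (g x)%:E).
Proof. by apply/measurable_EFinP; exact: measurable_funTS. Qed.

Let dens_sigma_additive : semi_sigma_additive density.
Proof.
move=> F mF tF mUF; rewrite /density_measure ge0_integral_bigcup//; last first.
  by move=> x _; rewrite lee_fin.
apply: is_cvg_nneseries => n _ _; apply: integral_ge0 => x _.
by rewrite lee_fin.
Qed.

HB.instance Definition _ := isMeasure.Build _ _ _ density
  dens0 dens_ge0 dens_sigma_additive.

Import HBNNSimple.

Let integral_density_nnsfun (f : {nnsfun T >-> R}) :
  (\int[density]_x (f x)%:E = \int[mu]_x ((f x)%:E * (g x)%:E))%E.
Proof.
transitivity (\sum_(k \in range f) k%:E * density (f @^-1` [set k]))%E.
  under eq_integral do rewrite fimfunE -fsumEFin//.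
  rewrite ge0_integral_fsum//; last 2 first.
  - by move=> y; exact/measurable_EFinP/measurable_funM.
  - by move=> y x _; rewrite nnfun_muleindic_ge0.
  by apply: eq_fsbigr => r _; rewrite integralZl_indic_nnsfun// integral_indic// setIT.
transitivity (\int[mu]_x (\sum_(k \in range f) ((k * \1_(f @^-1` [set k]) x) * g x)%:E))%E; last first.
  apply: eq_integral => x _; rewrite -EFinM fsumEFin//; congr EFin.
  rewrite fimfunE !fsbig_finite//= mulr_suml.
  by [].
have fg0 k x : (0 <= ((k * \1_(f @^-1` [set k]) x) * g x)%:E)%E.
  rewrite lee_fin mulr_ge0//; rewrite -lee_fin.
  exact: nnfun_muleindic_ge0.
rewrite ge0_integral_fsum//; last first.
  by move=> k; apply/measurable_EFinP; do 2 apply: measurable_funM => //.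
apply: eq_fsbigr => k kf; have k0 : 0 <= k.
  by move: kf; rewrite inE => -[x _ <-].
rewrite /density_measure integral_mkcond -ge0_integralZl//.
- apply: eq_integral => x _; rewrite patchE indicE.
  by case: ifPn => _ /=; rewrite ?mulr1 ?mulr0 ?mul0r ?mule0// EFinM.
- apply/(measurable_restrictT _ _).1 => //.
- by move=> x _; rewrite erestrict_ge0// => y _; rewrite lee_fin.
Qed.

(** True by definition for indicators, hence for simple functions, hence for monotone
    limits. *)
Lemma integral_density (f : T -> \bar R) : measurable_fun setT f -> (forall x, 0 <= f x)%E ->
  (\int[density]_x f x = \int[mu]_x (f x * (g x)%:E))%E.
Proof.
move=> mf f0; pose f_ := nnsfun_approx measurableT mf.
transitivity (limn (fun n => \int[density]_x (f_ n x)%:E)%E).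
  rewrite -monotone_convergence//.
  - apply: eq_integral => y _; apply/esym/cvg_lim; first exact: ereal_hausdorff.
    by apply: cvg_nnsfun_approx => //.
  - by move=> n; exact/measurable_EFinP/measurable_funP.
  - by move=> n y _; rewrite lee_fin.
  - by move=> y _ m n mn; rewrite lee_fin; exact/lefP/nd_nnsfun_approx.
under eq_fun do rewrite integral_density_nnsfun.
rewrite -monotone_convergence//.
- apply: eq_integral => y _; apply/cvg_lim; first exact: ereal_hausdorff.
  by apply: cvgeZr => //; apply: cvg_nnsfun_approx.
- by move=> n; apply: emeasurable_funM => //; exact/measurable_EFinP/measurable_funP.
- by move=> n y _; rewrite mule_ge0 ?lee_fin.
- by move=> y _ m n mn; rewrite lee_wpmul2r ?lee_fin//; exact/lefP/nd_nnsfun_approx.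
Qed.

End density.

(** * The substitution r = sqrt (t^2 + b^2) *)

Section sqrt_change_of_variable.
Context {R : realType}.
Local Notation mu := (@lebesgue_measure R).
Variables (b : R) (b0 : 0 < b).

Let phi (t : R) : R := Num.sqrt (t ^+ 2 + b ^+ 2).
Let dphi (t : R) : R := if 0 < t then t / phi t else 0.

Let phi_gt0 t : 0 < phi t.
Proof. by rewrite /phi sqrtr_gt0 ltr_wpDl ?sqr_ge0// exprn_gt0. Qed.

Let phi_sqr t : phi t ^+ 2 = t ^+ 2 + b ^+ 2.
Proof. by rewrite sqr_sqrtr// addr_ge0// sqr_ge0. Qed.

Let is_derive_phi t : is_derive (t : R^o) 1 (phi : R^o -> R^o) (t / phi t).
Proof.
have h : 0 < t ^+ 2 + b ^+ 2 by rewrite ltr_wpDl ?sqr_ge0// exprn_gt0.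
rewrite /phi; apply: is_derive_eq.
  exact: (@is_derive1_comp _ Num.sqrt (fun t => t ^+ 2 + b ^+ 2) t _ _ (is_derive1_sqrt h)).
rewrite [X in _ * X](_ : _ = 2 * t); last by rewrite addr0 /= /GRing.scale /=; ring.
have := phi_gt0 t; rewrite /phi => h2; field.
by rewrite gt_eqF.
Qed.

Let continuous_phi : continuous phi.
Proof.
by move=> t; apply: differentiable_continuous; apply/derivable1_diffP; case: (is_derive_phi t).
Qed.

Let measurable_phi : measurable_fun setT (phi : measurableTypeR R -> measurableTypeR R).
Proof. exact: (continuous_measurable_fun continuous_phi). Qed.

Let dphi_ge0 t : 0 <= dphi t.
Proof. by rewrite /dphi; case: ifPn => // t0; rewrite divr_ge0 ?ltW. Qed.

Let measurable_dphi : measurable_fun setT (dphi : measurableTypeR R -> R).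
Proof.
apply: measurable_fun_if => //.
  exact: measurable_fun_ltr.
apply: measurable_funTS; apply: continuous_measurable_fun => t.
apply: cvgM; first exact: cvg_id.
by apply: cvgV; [rewrite gt_eqF|exact: continuous_phi].
Qed.

Let nu := image_measure (density_measure mu measurable_dphi dphi_ge0) measurable_phi.

Let phi_lt s t : 0 <= s -> 0 <= t -> (phi s < phi t) = (s < t).
Proof.
move=> s0 t0; rewrite -(ltr_pXn2r (n := 2))// ?nnegrE ?ltW// !phi_sqr ltrD2r.
by rewrite ltr_pXn2r.
Qed.

Let nuE u v : b <= u -> u <= v -> nu `]u, v] = (v - u)%:E.
Proof.
move=> bu uv.
pose al := Num.sqrt (u ^+ 2 - b ^+ 2); pose be := Num.sqrt (v ^+ 2 - b ^+ 2).
have u0 : 0 < u by exact: lt_le_trans bu.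
have v0 : 0 < v by exact: lt_le_trans uv.
have phial : phi al = u.
  rewrite /phi sqr_sqrtr ?subrK ?sqrtr_sqr ?gtr0_norm//.
  by rewrite subr_ge0 ler_pXn2r ?nnegrE// ltW.
have phibe : phi be = v.
  rewrite /phi sqr_sqrtr ?subrK ?sqrtr_sqr ?gtr0_norm//.
  by rewrite subr_ge0 ler_pXn2r ?nnegrE ?(le_trans bu)// ltW.
have al0 : 0 <= al by exact: sqrtr_ge0.
have be0 : 0 <= be by exact: sqrtr_ge0.
rewrite /nu /image_measure /pushforward /= /density_measure.
rewrite integral_mkcond.
transitivity (\int[mu]_(t in `]al, be]) (t / phi t)%:E)%E.
  rewrite [RHS]integral_mkcond; apply: eq_integral => t _.
  rewrite !patchE /dphi; case: ifPn => [|tn]; last first.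
    case: ifPn => // tal; exfalso; move/negP : tn; apply.
    move: tal; rewrite !inE/= !in_itv/= => /andP[t1 t2].
    have t0 : 0 < t by exact: le_lt_trans t1.
    by rewrite -phial -phibe phi_lt ?(ltW t0)// t1 leNgt phi_lt// ?(ltW t0)// -leNgt.
  rewrite inE/= in_itv/= => /andP[t1 t2].
  case: ltP => t0; last first.
    case: ifPn => //; rewrite inE/= in_itv/= => /andP[t3 _].
    by move: t0; rewrite leNgt (le_lt_trans al0).
  rewrite ifT// inE/= in_itv/=.
  by rewrite -phi_lt ?(ltW t0)// phial t1 /= leNgt -phi_lt ?(ltW t0)// phibe -leNgt.
have [ab|] := ltP al be; last first.
  move=> ab; rewrite set_itv_ge ?bnd_simp -?leNgt// integral_set0.
  suff -> : u = v by rewrite subrr.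
  apply/eqP; rewrite eq_le uv/= -phial -phibe.
  by rewrite leNgt phi_lt// -leNgt.
rewrite integral_itv_obnd_cbnd; last first.
  apply/measurable_EFinP; suff h : measurable_fun setT (fun t : measurableTypeR R => t / phi t).
    exact: measurable_funS h.
  apply: continuous_measurable_fun => t; apply: cvgM; first exact: cvg_id.
  by apply: cvgV; [rewrite gt_eqF|exact: continuous_phi].
rewrite (@continuous_FTC2 _ (fun t => t / phi t) phi)//.
- by rewrite phial phibe EFinB.
- apply: continuous_subspaceT => t.
  apply: cvgM; first exact: cvg_id.
  by apply: cvgV; [rewrite gt_eqF|exact: continuous_phi].
- split.
  + by move=> x _; case: (is_derive_phi x).
  + by apply: cvg_at_right_filter; exact: continuous_phi.
  + by apply: cvg_at_left_filter; exact: continuous_phi.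
- by move=> x _; rewrite derive1E; apply: derive_val.
Qed.

Let nu0 u v : v <= b -> nu `]u, v] = 0%E.
Proof.
move=> vb; rewrite /nu /image_measure /pushforward /= /density_measure.
apply: integral0_eq => t /=; rewrite in_itv/= /dphi => /andP[_ tv].
case: ltP => // t0; have := le_trans tv vb.
rewrite leNgt -(ltr_pXn2r (n := 2))// ?nnegrE ?ltW// phi_sqr ltrDr exprn_gt0//.
Qed.

Let mindic : measurable_fun setT (\1_`]b, +oo[%classic : measurableTypeR R -> R).
Proof. exact: measurable_indic. Qed.

Let indic_ge0 (x : measurableTypeR R) : 0 <= \1_`]b, +oo[%classic x :> R.
Proof. by rewrite indicE. Qed.

Let mub := density_measure mu mindic indic_ge0.

Let mubE (A : set (measurableTypeR R)) : measurable A -> mub A = mu (`]b, +oo[ `&` A).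
Proof. by move=> mA; rewrite /mub /density_measure integral_indic. Qed.

Let nu_restr (A : set (measurableTypeR R)) : measurable A -> mub A = nu A.
Proof.
move: A; apply: (@measure_unique _ R (measurableTypeR R) (@ocitv R)
    (fun k => `]- k%:R, k%:R]%classic) _ _ _ _ mub nu) => //.
- exact: ocitvI.
- by move=> k; exists (- k%:R, k%:R).
- exact: bigcup_itvT.
- move=> _ [[u v]] _ <-; transitivity (mu (`]b, +oo[ `&` `]u, v])).
    by apply: mubE; exact: measurable_itv.
  rewrite -[RHS]/(nu `]u, v]%classic).
  have [uv|vu] := leP u v; last first.
    have E : `]u, v]%classic = set0 by rewrite set_itv_ge// bnd_simp -leNgt ltW.
    by rewrite E setI0 !measure0.
  have -> : `]b, +oo[ `&` `]u, v] = `](Num.max u b), v]%classic.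
    apply/seteqP; split => x /=; rewrite !in_itv/= gt_max.
      by move=> [+ /andP[-> ->]]; rewrite !andbT.
    by rewrite andbT => /andP[/andP[-> ->] ->].
  have [vb|bv] := leP v b.
    by rewrite nu0// set_itv_ge ?measure0// bnd_simp -leNgt le_max vb orbT.
  rewrite lebesgue_measure_itv/= lte_fin gt_max bv andbT.
  have [bu|ub] := leP b u.
    rewrite nuE//; case: ltP => // vu.
    have -> : u = v by apply/eqP; rewrite eq_le uv vu.
    by rewrite subrr.
  rewrite (lt_trans ub bv).
  rewrite (_ : `]u, v]%classic = `]u, b] `|` `]b, v]); last first.
    by rewrite -itv_bndbnd_setU// bnd_simp ltW.
  have -> : nu (`]u, b] `|` `]b, v]) = (nu `]u, b]%classic + nu `]b, v]%classic)%E.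
    rewrite /nu measureU//; apply/seteqP; split => // x [].
    by rewrite /= !in_itv/= => /andP[_ xb] /andP[bx _]; move: xb; rewrite leNgt bx.
  by rewrite nu0// add0e nuE// ltW.
- move=> k; rewrite [X in (X < _)%E](_ : _ = mu (`]b, +oo[ `&` `]- k%:R, k%:R])); last first.
    by apply: mubE; exact: measurable_itv.
  apply: (@le_lt_trans _ _ (mu `]- k%:R, k%:R])).
    by apply: le_measure => //; rewrite inE//; apply: measurableI.
  by rewrite lebesgue_measure_itv/=; case: ifPn; rewrite ltry.
Qed.

(** The image of the measure with density [t / sqrt (t ^+ 2 + b ^+ 2)] on the positive
    half-line under [t |-> sqrt (t ^+ 2 + b ^+ 2)] agrees with Lebesgue measure on half-open
    intervals, by the fundamental theorem of calculus; so they agree as measures on ]b,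
    +oo[. Comparing measures rather than primitives allows [f] to be any measurable
    function. *)
Lemma ge0_integral_sqrt (f : R -> \bar R) : measurable_fun setT f -> (forall x, 0 <= f x)%E ->
  (\int[mu]_(r in `]b, +oo[) f r =
   \int[mu]_(t in `]0%R, +oo[) (f (Num.sqrt (t ^+ 2 + b ^+ 2)) *
                              (t / Num.sqrt (t ^+ 2 + b ^+ 2))%:E))%E.
Proof.
move=> mf f0.
transitivity (\int[nu]_x f x)%E.
  transitivity (\int[mub]_x f x)%E.
    rewrite /mub integral_density// [LHS]integral_mkcond; apply: eq_integral => x _.
    by rewrite patchE indicE; case: ifPn; rewrite ?mule1 ?mule0.
  by apply: eq_measure_integral => A mA _; exact: nu_restr.
rewrite /nu (ge0_integral_pushforward measurable_phi)// preimage_setT.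
rewrite integral_density//=; last exact: (measurableT_comp mf measurable_phi).
rewrite [RHS]integral_mkcond; apply: eq_integral => t _.
rewrite patchE /dphi /=; case: ifPn => t0.
  by rewrite ifT// inE/= in_itv/= t0.
by rewrite mule0 ifF//; apply/negbTE; rewrite notin_setE/= in_itv/= andbT; exact/negP.
Qed.

End sqrt_change_of_variable.

(** * The Laplace weight and the Poisson kernel *)

Section fatou_bound.
Context d (T : measurableType d) (R : realType) (mu : {measure set T -> \bar R}).

Lemma fatou_bound (f_ : nat -> T -> R) (f : T -> R) (C : \bar R) :
  (forall n, measurable_fun setT (f_ n)) -> measurable_fun setT f ->
  (forall n x, 0 <= f_ n x) -> (forall x, 0 <= f x) ->
  {ae mu, forall x, f_ n x @[n --> \oo] --> f x} ->
  (forall n, \int[mu]_x (f_ n x)%:E <= C)%E ->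
  (\int[mu]_x (f x)%:E <= C)%E.
Proof.
move=> mf_ mf f_0 f0 f_f fC.
have m_ n : measurable_fun setT (fun x => (f_ n x)%:E) by exact/measurable_EFinP.
have einfN x : limn_einf (fun n => (f_ n x)%:E) = (- limn_esup (fun n => - (f_ n x)%:E))%E.
  by rewrite -(limn_einfN (fun n => - (f_ n x)%:E)%E); congr limn_einf; apply/funext => n /=; rewrite opprK.
have -> : (\int[mu]_x (f x)%:E = \int[mu]_x limn_einf (fun n => (f_ n x)%:E))%E.
  apply: ge0_ae_eq_integral => //.
  - exact/measurable_EFinP.
  - under eq_fun do rewrite einfN.
    apply: measurableT_comp => //; apply: measurable_fun_limn_esup => n.
    exact: measurableT_comp.
  - by move=> x _; rewrite lee_fin.
  - move=> x _; rewrite limn_einf_lim; apply: lime_ge; first exact: is_cvg_einfs.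
    apply: nearW => n; apply: le_ereal_inf_tmp => _ [m _ <-].
    by rewrite lee_fin.
  - apply: filterS f_f => x fx _; apply/esym.
    have := @cvg_limn_einf_sup _ (fun n => (f_ n x)%:E) (f x)%:E.
    by case => //; apply: cvg_EFin => //; exact: nearW.
apply: (le_trans (fatou mu measurableT m_ _)).
  by move=> n x _; rewrite lee_fin.
rewrite limn_einf_lim; apply: lime_le; first exact: is_cvg_einfs.
apply: nearW => n; apply: le_trans (fC n).
by apply: ereal_inf_lbound; exists n => /=.
Qed.

End fatou_bound.

Section laplace.
Context {R : realType}.
Local Notation mu := (@lebesgue_measure R).
Variables (e : R) (e0 : 0 < e).

Definition laplace (x : R) : R := expR (- (e * `|x|)).

(** The Fourier transform of [laplace] ([cintegral_laplace]): nonnegative, with an integral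
    that does not depend on [e], hence an approximate identity. *)
Definition poisson (a : R) : R := 2 * e / (e ^+ 2 + a ^+ 2).

Lemma laplace_ge0 x : 0 <= laplace x. Proof. exact: expR_ge0. Qed.

Lemma laplace_le1 x : laplace x <= 1.
Proof. by rewrite -expR0 ler_expR oppr_le0 mulr_ge0// ltW. Qed.

Lemma continuous_laplace : continuous laplace.
Proof.
move=> x; apply: continuous_comp; last exact: continuous_expR.
apply: continuousN; apply: cvgM; first exact: cvg_cst.
exact: norm_continuous.
Qed.

Let half_line a : (\int[mu]_(x in `[0%R, +oo[) (laplace x * (1 + cos (a * x)))%:E =
  (e^-1 + e / (e ^+ 2 + a ^+ 2))%:E)%E.
Proof.
pose F x := expR (- (e * x)) * ((a * sin (a * x) - e * cos (a * x)) / (e ^+ 2 + a ^+ 2) - e^-1).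
have D0 : e ^+ 2 + a ^+ 2 != 0 by rewrite gt_eqF// ltr_wpDr ?sqr_ge0// exprn_gt0.
have en0 : e != 0 by rewrite gt_eqF.
pose f x := expR (- (e * x)) * (1 + cos (a * x)).
have dF (x : R) : is_derive x 1 F (f x).
  rewrite /F; apply: is_derive_eq.
  rewrite /GRing.scale /= /f; field.
  by rewrite en0.
have cf : continuous f.
  move=> x; apply: cvgM.
    apply: continuous_comp; last exact: continuous_expR.
    by apply: continuousN; apply: cvgM; [exact: cvg_cst|exact: cvg_id].
  apply: cvgD; first exact: cvg_cst.
  apply: continuous_comp; last exact: continuous_cos.
  by apply: cvgM; [exact: cvg_cst|exact: cvg_id].
have cF : continuous F.
  move=> t; apply: differentiable_continuous; apply/derivable1_diffP.
  by case: (dF t).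
transitivity (\int[mu]_(x in `[0%R, +oo[) (f x)%:E)%E.
  apply: eq_integral => x; rewrite inE/= in_itv/= andbT => x0.
  by rewrite /laplace ger0_norm.
rewrite (@ge0_continuous_FTC2y _ f F 0 0).
- rewrite /F !mulr0 oppr0 expR0 sin0 cos0 -EFinB; congr EFin; field.
  by rewrite D0 en0.
- by move=> x _; rewrite mulr_ge0 ?expR_ge0//; have := cos_geN1 (a * x); lra.
- exact: continuous_subspaceT.
(* K bounds the factor of the exponential in the primitive, which therefore tends to 0. *)
- pose K := (`|a| + e) / (e ^+ 2 + a ^+ 2) + e^-1.
  have K0 : 0 <= K.
    rewrite addr_ge0 ?invr_ge0 ?(ltW e0)// divr_ge0 ?addr_ge0 ?sqr_ge0// ltW//.
  have FK x : `|F x| <= expR (- (e * x)) * K.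
    rewrite /F normrM (ger0_norm (expR_ge0 _)) ler_wpM2l ?expR_ge0//.
    rewrite (le_trans (ler_normB _ _))// lerD//; last by rewrite ger0_norm// invr_ge0 ltW.
    rewrite normrM normfV (ger0_norm (_ : 0 <= e ^+ 2 + a ^+ 2)) ?addr_ge0 ?sqr_ge0//.
    rewrite ler_wpM2r ?invr_ge0 ?addr_ge0 ?sqr_ge0//.
    rewrite (le_trans (ler_normB _ _))// !normrM (gtr0_norm e0) lerD//.
      by rewrite ler_piMr// ler_norml sin_geN1 sin_le1.
    by rewrite ler_piMr ?(ltW e0)// ler_norml cos_geN1 cos_le1.
  have E0 : expR (- (e * x)) * K @[x --> +oo] --> 0.
    rewrite -(mul0r K); apply: cvgM; last exact: cvg_cst.
    have := @cvgr_expR R; apply: cvg_comp.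
    by apply: gt0_cvgMry => //; exact: cvg_id.
  apply/norm_cvg0P; apply: (squeeze_cvgr _ (cvg_cst 0) E0).
  by apply: nearW => x; rewrite normr_ge0 FK.
- by move=> x _; case: (dF x).
- by apply: cvg_at_right_filter; exact: cF.
- by move=> x _; rewrite derive1E; apply: derive_val.
Qed.

(** The summand 1 makes the integrand nonnegative, so that the fundamental theorem of
    calculus applies directly on a half-line. *)
Lemma integral_laplace_cos a : (\int[mu]_x (laplace x * (1 + cos (a * x)))%:E =
  (2 / e + poisson a)%:E)%E.
Proof.
rewrite ge0_symfun_integralT.
- rewrite -set_itvcy half_line -EFinM; congr EFin.
  by rewrite /poisson mulrDr mulrA.
- by move=> x; rewrite mulr_ge0 ?laplace_ge0//; have := cos_geN1 (a * x); lra.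
- move=> x; apply: cvgM; first exact: continuous_laplace.
  apply: cvgD; first exact: cvg_cst.
  apply: continuous_comp; last exact: continuous_cos.
  by apply: cvgM; [exact: cvg_cst|exact: cvg_id].
- by move=> x /=; rewrite /laplace normrN mulrN cosN.
Qed.

Lemma poisson_ge0 a : 0 <= poisson a.
Proof.
by rewrite /poisson divr_ge0 ?addr_ge0 ?sqr_ge0// mulr_ge0// ltW.
Qed.

Lemma measurable_laplace : measurable_fun setT (laplace : measurableTypeR R -> R).
Proof. exact: continuous_measurable_fun continuous_laplace. Qed.

Lemma measurable_laplace_cos a : measurable_fun setT (fun x : measurableTypeR R => laplace x * cos (a * x)).
Proof.
apply: measurable_funM; first exact: measurable_laplace.
apply: measurableT_comp; first exact: continuous_measurable_fun (@continuous_cos R).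
by apply: measurable_funM.
Qed.

Lemma integral_laplace : (\int[mu]_x (laplace x)%:E = (2 / e)%:E)%E.
Proof.
have := integral_laplace_cos 0.
under eq_integral do rewrite mul0r cos0 EFinM muleC.
rewrite ge0_integralZl//; last 2 first.
- by apply/measurable_EFinP; exact: measurable_laplace.
- by move=> x _; rewrite lee_fin laplace_ge0.
have -> : 2 / e + poisson 0 = 2 * (2 / e).
  by rewrite /poisson expr0n/= addr0; field; rewrite gt_eqF.
move=> /(congr1 (fun x => (2^-1)%:E * x)%E).
by rewrite muleA -!EFinM mulVf// mul1e mulKf.
Qed.

Lemma integrable_laplace : mu.-integrable setT (EFin \o laplace).
Proof.
apply: integrable_norm_lty; first exact: measurable_laplace.
under eq_integral do rewrite ger0_norm ?laplace_ge0//.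
by rewrite integral_laplace ltry.
Qed.

Lemma integrable_laplace_cos a : mu.-integrable setT (EFin \o (fun x => laplace x * cos (a * x))).
Proof.
apply: le_integrable integrable_laplace => //.
  by apply/measurable_EFinP; exact: measurable_laplace_cos.
move=> x _ /=; rewrite lee_fin normrM ler_piMr// ler_norml cos_geN1 cos_le1//.
Qed.

Lemma Rintegral_laplace_cos a : Rintegral mu setT (fun x => laplace x * cos (a * x)) = poisson a.
Proof.
have := integral_laplace_cos a.
under eq_integral do rewrite mulrDr mulr1 EFinD.
rewrite (integralD _ integrable_laplace (integrable_laplace_cos a))// integral_laplace.
rewrite /Rintegral; have /fineK <- := integrable_fin_num measurableT (integrable_laplace_cos a).
by rewrite -EFinD => -[/addrI].
Qed.

(** The primitive is an arctangent. *)
Lemma integral_poisson (s : R) : s != 0 ->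
  (\int[mu]_t (poisson (s * t))%:E = (2 * pi / `|s|)%:E)%E.
Proof.
move=> s0.
have en0 : e != 0 by rewrite gt_eqF.
have se0 : s / e != 0 by rewrite mulf_neq0// invr_eq0.
have cP : continuous (fun x : R => (oneDsqr x)^-1).
  exact: continuous_oneDsqrV.
have E : (\int[mu]_x ((oneDsqr x)^-1)%:E = pi%:E)%E.
  rewrite ge0_symfun_integralT//.
  - by rewrite -set_itvcy integral0y_oneDsqr -EFinM; congr EFin; field.
  - by move=> x /=; rewrite /oneDsqr sqrrN.
have mP : measurable_fun setT (fun x : measurableTypeR R => ((oneDsqr x)^-1)%:E).
  by apply/measurable_EFinP; exact: continuous_measurable_fun.
have P0 x : (0 <= ((@oneDsqr R x)^-1)%:E)%E.
  by rewrite lee_fin invr_ge0.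
have := ge0_integral_affine 0 se0 mP P0; rewrite E -EFinM => E2.
transitivity ((2 / e)%:E * (\int[mu]_x ((oneDsqr (s / e * x + 0))^-1)%:E))%E.
  rewrite -ge0_integralZl//.
  - apply: eq_integral => x _; rewrite -EFinM; congr EFin.
    rewrite /poisson /oneDsqr addr0; field.
    by rewrite en0/= gt_eqF// ltr_wpDr ?sqr_ge0// exprn_gt0.
  - by apply: (measurableT_comp mP); exact: measurable_affine.
  - by rewrite lee_fin divr_ge0// ltW.
rewrite E2 -EFinM; congr EFin.
rewrite normrM normfV (gtr0_norm e0); field.
by rewrite en0 normr_eq0 s0.
Qed.

End laplace.

(** * The Fourier transform on the line *)

Section ft1.
Context {R : realType}.
Local Notation mu := (@lebesgue_measure R).
Local Notation T := (measurableTypeR R).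
Implicit Types (u v g : T -> R[i]) (s : R).
Local Notation Re := complex.Re.
Local Notation Im := complex.Im.

Definition ft1 s u (x : T) : R[i] :=
  cintegral mu setT (fun y => expi (s * (x * y)) * u y).

Let cmeasurable_kernel s : cmeasurable setT
  (fun z : T * T => expi (s * (z.1 * z.2))).
Proof. by apply: cmeasurable_expi; apply: measurable_funM => //; apply: measurable_funM. Qed.

Lemma cmeasurable_wave s (x : R) : cmeasurable setT (fun y : measurableTypeR R => expi (s * (x * y))).
Proof. by apply: cmeasurable_expi; apply: measurable_funM => //; apply: measurable_funM. Qed.

Lemma cintegrable_wave s (x : R) u : cintegrable mu setT u ->
  cintegrable mu setT (fun y => expi (s * (x * y)) * u y).
Proof.
move=> Iu; apply: (cintegrableM_bounded measurableT (cmeasurable_wave s x) Iu (M := 1)) => y _.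
by rewrite cabs_expi.
Qed.

Lemma cmeasurable_ft1 s u : cintegrable mu setT u -> cmeasurable setT (ft1 s u : measurableTypeR R -> R[i]).
Proof.
move=> Iu; apply: (cmeasurable_cintegral mu
  (F := fun z : T * T => expi (s * (z.1 * z.2)) * u z.2)).
apply: cmeasurableM => //.
exact: (cmeasurable_comp (cintegrable_measurable Iu) measurable_snd).
Qed.

Lemma cabs_ft1 s u : cintegrable mu setT u ->
  forall x, cabs (ft1 s u x) <= Rintegral mu setT (fun y => cabs (u y)).
Proof.
move=> Iu x; rewrite -lee_fin /Rintegral fineK; last first.
  exact: (integrable_fin_num _ (integrable_cabs measurableT Iu)).
apply: (le_trans (cabs_cintegral measurableT (cintegrable_wave s x Iu))).
rewrite le_eqVlt; apply/orP; left; apply/eqP; apply: eq_integral => y _.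
by rewrite cabsM cabs_expi mul1r.
Qed.

Lemma ft1J s u x : cintegrable mu setT u ->
  (ft1 s u x)^* = ft1 (- s) (fun y => (u y)^*) x.
Proof.
move=> Iu; rewrite /ft1 -cintegralJ//; last exact: cintegrable_wave.
apply: eq_cintegral => y _; rewrite rmorphM/= mulNr expiN//.
Qed.

Lemma ft1_mult s u v : cintegrable mu setT u -> cintegrable mu setT v ->
  cintegral mu setT (fun x => ft1 s u x * v x) = cintegral mu setT (fun y => u y * ft1 s v y).
Proof.
move=> Iu Iv; rewrite /ft1.
have := multiplication_formula (cmeasurable_kernel s) (fun=> cabs_expi _) Iu Iv.
move=> -> /=; apply: eq_cintegral => y _; congr (_ * _).
by apply: eq_cintegral => x _; rewrite (mulrC x).
Qed.

Section laplace_weight.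
Variables (e : R) (e0 : 0 < e).
Local Notation w := (laplace e).
Local Notation P := (poisson e).

Lemma cintegrable_laplace : cintegrable mu setT (fun x => (w x)%:C).
Proof.
apply: le_cintegrable (integrable_laplace e0) _ => //.
  by apply: cmeasurable_real; exact: measurable_laplace.
by move=> x _; rewrite cabs_real ger0_norm// laplace_ge0.
Qed.

Lemma integrable_laplace_sin a : mu.-integrable setT (EFin \o (fun x => w x * sin (a * x))).
Proof.
apply: le_integrable (integrable_laplace e0) => //.
  apply/measurable_EFinP; apply: measurable_funM; first exact: measurable_laplace.
  apply: measurableT_comp; first exact: continuous_measurable_fun (@continuous_sin R).
  by apply: measurable_funM.
move=> x _ /=; rewrite lee_fin normrM ler_piMr// ler_norml sin_geN1 sin_le1//.
Qed.

(** The integrand is odd. The proof adds [laplace e] to it, so that the reflection formula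
    for nonnegative functions applies. *)
Lemma Rintegral_laplace_sin a : Rintegral mu setT (fun x => w x * sin (a * x)) = 0.
Proof.
pose f x := (w x * (1 + sin (a * x)))%:E.
have f0 (x : R) : (0 <= f x)%E.
  by rewrite lee_fin mulr_ge0 ?laplace_ge0//; have := sin_geN1 (a * x); lra.
have mf : measurable_fun setT (f : measurableTypeR R -> \bar R).
  apply/measurable_EFinP; apply: measurable_funM; first exact: measurable_laplace.
  apply: measurable_funD => //.
  apply: measurableT_comp; first exact: continuous_measurable_fun (@continuous_sin R).
  by apply: measurable_funM.
have := ge0_integral_reflect 0 mf f0.
rewrite /f; under eq_integral do rewrite sub0r /laplace normrN mulrN sinN mulrDr mulr1 mulrN -/(w _) EFinB.
under [RHS]eq_integral do rewrite mulrDr mulr1 EFinD.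
have Is := integrable_laplace_sin a; have Iw := integrable_laplace e0.
rewrite integralB// integralD//.
have /fineK <- := integrable_fin_num measurableT Is.
have /fineK <- := integrable_fin_num measurableT Iw.
rewrite -EFinB -EFinD => -[]; rewrite /Rintegral.
set t := fine _; set t' := fine _; lra.
Qed.

Lemma cintegral_laplace a : cintegral mu setT (fun x => expi (a * x) * (w x)%:C) = (P a)%:C.
Proof.
apply: complex_eq.
  rewrite Re_cintegral -(Rintegral_laplace_cos e0); apply: eq_Rintegral => x _.
  by rewrite ?partsE /= mulr0 subr0 mulrC.
rewrite Im_cintegral -[RHS](Rintegral_laplace_sin a); apply: eq_Rintegral => x _.
by rewrite ?partsE /= mulr0 add0r mulrC.
Qed.

Lemma poisson_le a : P a <= 2 / e.
Proof.
rewrite /poisson ler_pdivrMr; last by rewrite ltr_wpDr ?sqr_ge0// exprn_gt0.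
rewrite mulrDr.
have -> : 2 / e * e ^+ 2 = 2 * e by field; rewrite gt_eqF.
by rewrite lerDl mulr_ge0 ?sqr_ge0// divr_ge0// ltW.
Qed.

Lemma measurable_poisson : measurable_fun setT (P : measurableTypeR R -> R).
Proof.
apply: continuous_measurable_fun => x; apply: cvgM; first exact: cvg_cst.
apply: cvgV; first by rewrite gt_eqF// ltr_wpDr ?sqr_ge0// exprn_gt0.
by apply: cvgD; [exact: cvg_cst|exact: exprn_continuous].
Qed.

(** Inverting a transform with the Laplace weight inserted is convolution with the Poisson
    kernel. *)
Lemma laplace_inversion s a z : cintegrable mu setT a ->
  cintegral mu setT (fun x => expi (s * (z * x)) * ((w x)%:C * ft1 (- s) a x)) =
  cintegral mu setT (fun y => a y * (P (s * (z - y)))%:C).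
Proof.
move=> Ia.
have Iv : cintegrable mu setT (fun x => expi (s * (z * x)) * (w x)%:C).
  exact: cintegrable_wave cintegrable_laplace.
have := ft1_mult (- s) Ia Iv.
under eq_cintegral do rewrite mulrC -mulrA.
move=> ->; apply: eq_cintegral => y _; congr (_ * _).
rewrite -cintegral_laplace /ft1; apply: eq_cintegral => x _.
by rewrite mulrA -expiD; congr (expi _ * _); ring.
Qed.

Lemma cintegrable_laplaceM u : cmeasurable setT u -> (exists M, forall x, cabs (u x) <= M) ->
  cintegrable mu setT (fun x => (w x)%:C * u x).
Proof.
move=> mu' [M uM].
have := cintegrableM_bounded measurableT mu' cintegrable_laplace (fun x _ => uM x).
by congr cintegrable; apply/funext => x; rewrite mulrC.
Qed.

(** The weighted square of the transform is, by the multiplication formula, the pairing of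
    [g] with the Poisson average of its conjugate. The kernel has mass 2 pi / |s| in each
    variable, so by |ab| <= (a^2 + b^2) / 2 the pairing is at most that mass times the
    squared norm. *)
Lemma ft1_laplace_le s g : s != 0 -> cintegrable mu setT g ->
  (\int[mu]_x (cabs (ft1 s g x) ^+ 2 * w x)%:E <=
   (2 * pi / `|s|)%:E * \int[mu]_x (cabs (g x) ^+ 2)%:E)%E.
Proof.
move=> s0 Ig; set G := ft1 s g.
have mG : cmeasurable setT G by exact: cmeasurable_ft1.
have mg := cintegrable_measurable Ig.
have bG := cabs_ft1 s Ig.
have IgJ : cintegrable mu setT (fun y => (g y)^*) by exact: cintegrableJ.
pose v x := (w x)%:C * (G x)^*.
have Iv : cintegrable mu setT v.
  apply: cintegrable_laplaceM; first exact: cmeasurableJ.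
  by exists (Rintegral mu setT (fun y => cabs (g y))) => x; rewrite cabsJ.
have E1 x : G x * v x = (cabs (G x) ^+ 2 * w x)%:C.
  by rewrite /v mulrCA [G x * _]mulrC mulJc mulrC -rmorphM.
have IGv : cintegrable mu setT (fun x => G x * v x).
  exact: (cintegrableM_bounded measurableT mG Iv (fun x _ => bG x)).
have Ew : (\int[mu]_x (cabs (G x) ^+ 2 * w x)%:E)%E =
    (Re (cintegral mu setT (fun x => G x * v x)))%:E.
  rewrite Re_cintegral /Rintegral fineK; last first.
    exact: integrable_fin_num IGv.1.
  by apply: eq_integral => x _; rewrite E1.
rewrite Ew ft1_mult//.
have ftv y : ft1 s v y = cintegral mu setT (fun t => (g t)^* * (P (s * (y - t)))%:C).
  rewrite -(laplace_inversion s y IgJ); apply: eq_cintegral => x _.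
  by rewrite /v; congr (_ * (_ * _)); exact: ft1J.
have Pm (y : R) : measurable_fun setT (fun t : measurableTypeR R => P (s * (y - t))).
  apply: (measurableT_comp measurable_poisson); apply: measurable_funM => //.
  exact: measurable_funB.
have bft y : ((cabs (ft1 s v y))%:E <= \int[mu]_t (cabs (g t) * P (s * (y - t)))%:E)%E.
  rewrite ftv; apply: le_trans.
    apply: cabs_cintegral => //.
    have := cintegrableM_bounded measurableT (cmeasurable_real (Pm y)) IgJ (M := 2 / e).
    under eq_fun do rewrite mulrC; apply => x _.
    by rewrite cabs_real ger0_norm ?poisson_ge0// poisson_le.
  rewrite le_eqVlt; apply/orP; left; apply/eqP; apply: eq_integral => t _.
  by rewrite cabsM cabsJ cabs_real ger0_norm// poisson_ge0.
have Igft : cintegrable mu setT (fun y => g y * ft1 s v y).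
  have := cintegrableM_bounded measurableT (cmeasurable_ft1 s Iv) Ig (fun x _ => cabs_ft1 s Iv x).
  by under eq_fun do rewrite mulrC.
apply: (@le_trans _ _ (\int[mu]_y (cabs (g y * ft1 s v y))%:E)%E).
  apply: le_trans (cabs_cintegral measurableT Igft).
  by rewrite lee_fin (le_trans (ler_norm _))// normr_Re.
(* The kernel is symmetric and has the same mass in each variable, so both halves
   of the bound integrate to the same multiple of the L^2 norm of g. *)
pose H (z : T * T) : R :=
  2^-1 * (cabs (g z.1) ^+ 2 * P (s * (z.1 - z.2))) + 2^-1 * (cabs (g z.2) ^+ 2 * P (s * (z.1 - z.2))).
have mc : measurable_fun setT (fun x : measurableTypeR R => cabs (g x)) by exact: cmeasurable_cabs.
have mPd : measurable_fun setT (fun z : T * T => P (s * (z.1 - z.2))).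
  apply: (measurableT_comp measurable_poisson); apply: measurable_funM => //.
  exact: measurable_funB.
have mH1 : measurable_fun setT (fun z : T * T =>
    cabs (g z.1) ^+ 2 * P (s * (z.1 - z.2))).
  apply: measurable_funM => //; apply: measurable_funX.
  exact: (measurableT_comp mc measurable_fst).
have mH2 : measurable_fun setT (fun z : T * T =>
    cabs (g z.2) ^+ 2 * P (s * (z.1 - z.2))).
  apply: measurable_funM => //; apply: measurable_funX.
  exact: (measurableT_comp mc measurable_snd).
have H10 z : 0 <= cabs (g z.1) ^+ 2 * P (s * (z.1 - z.2)) by rewrite mulr_ge0 ?poisson_ge0 ?exprn_ge0 ?cabs_ge0.
have H20 z : 0 <= cabs (g z.2) ^+ 2 * P (s * (z.1 - z.2)) by rewrite mulr_ge0 ?poisson_ge0 ?exprn_ge0 ?cabs_ge0.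
have mH : measurable_fun setT H by apply: measurable_funD; apply: measurable_funM.
have H0 z : (0 <= (H z)%:E)%E by rewrite lee_fin addr_ge0// mulr_ge0 ?invr_ge0.
have mHE : measurable_fun setT (EFin \o H) by exact/measurable_EFinP.
apply: (@le_trans _ _ (\int[mu]_y \int[mu]_t (H (y, t))%:E)%E).
  apply: ge0_le_integral => //.
  - by move=> y _; rewrite lee_fin cabs_ge0.
  - apply/measurable_EFinP/cmeasurable_cabs; exact: cintegrable_measurable Igft.
  - exact: (measurable_fun_fubini_tonelli_F _ mHE H0).
  - move=> y _; rewrite cabsM EFinM.
    apply: (@le_trans _ _ ((cabs (g y))%:E * \int[mu]_t (cabs (g t) * P (s * (y - t)))%:E)%E).
      by rewrite lee_wpmul2l// lee_fin cabs_ge0.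
    rewrite -ge0_integralZl//; last 3 first.
    + apply/measurable_EFinP; exact: measurable_funM.
    + by move=> t _; rewrite lee_fin mulr_ge0 ?cabs_ge0 ?poisson_ge0.
    + by rewrite lee_fin cabs_ge0.
    apply: ge0_le_integral => //.
    + move=> t _; rewrite -EFinM lee_fin; apply: mulr_ge0; first exact: cabs_ge0.
      by apply: mulr_ge0; [exact: cabs_ge0|exact: poisson_ge0].
    + by apply: measurable_funeM; apply/measurable_EFinP; exact: measurable_funM.
    + exact: (measurableT_comp mHE (pair1_measurable _)).
    + move=> t _; rewrite -EFinM lee_fin /H /= -mulrDr -mulrDl mulrA mulrA.
      rewrite ler_wpM2r ?poisson_ge0//.
      have := sqr_ge0 (cabs (g y) - cabs (g t)); lra.
have MP y : (\int[mu]_t (P (s * (y - t)))%:E = (2 * pi / `|s|)%:E)%E.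
  rewrite -(integral_poisson e0 s0).
  apply: (ge0_integral_reflect y (f := fun t => (P (s * t))%:E)).
    apply/measurable_EFinP; apply: (measurableT_comp measurable_poisson).
    exact: measurable_funM.
  by move=> x; rewrite lee_fin poisson_ge0.
have MP2 t : (\int[mu]_y (P (s * (y - t)))%:E = (2 * pi / `|s|)%:E)%E.
  rewrite -(integral_poisson e0 s0).
  apply: (ge0_integral_translate (- t) (f := fun t => (P (s * t))%:E)).
    apply/measurable_EFinP; apply: (measurableT_comp measurable_poisson).
    exact: measurable_funM.
  by move=> x; rewrite lee_fin poisson_ge0.
have mE1 : measurable_fun setT (fun z : T * T =>
    (cabs (g z.1) ^+ 2 * P (s * (z.1 - z.2)))%:E) by exact/measurable_EFinP.
have mE2 : measurable_fun setT (fun z : T * T =>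
    (cabs (g z.2) ^+ 2 * P (s * (z.1 - z.2)))%:E) by exact/measurable_EFinP.
have mg2 : measurable_fun setT (fun x : measurableTypeR R => (cabs (g x) ^+ 2)%:E).
  by apply/measurable_EFinP; exact: measurable_funX.
have g20 x : (0 <= (cabs (g x) ^+ 2)%:E)%E by rewrite lee_fin exprn_ge0// cabs_ge0.
have T1 : (\int[mu]_y \int[mu]_t (cabs (g y) ^+ 2 * P (s * (y - t)))%:E =
    (2 * pi / `|s|)%:E * \int[mu]_x (cabs (g x) ^+ 2)%:E)%E.
  rewrite -ge0_integralZl//; last by rewrite lee_fin divr_ge0// mulr_ge0// pi_ge0.
  apply: eq_integral => y _; rewrite muleC -(MP y) -ge0_integralZl//.
  - exact/measurable_EFinP.
  - by move=> t _; rewrite lee_fin poisson_ge0.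
have T2 : (\int[mu]_y \int[mu]_t (cabs (g t) ^+ 2 * P (s * (y - t)))%:E =
    (2 * pi / `|s|)%:E * \int[mu]_x (cabs (g x) ^+ 2)%:E)%E.
  transitivity (\int[mu]_t \int[mu]_y (cabs (g t) ^+ 2 * P (s * (y - t)))%:E)%E.
    exact: (fubini_tonelli (m1 := mu) (m2 := mu) _ mE2 H20).
  rewrite -ge0_integralZl//; last by rewrite lee_fin divr_ge0// mulr_ge0// pi_ge0.
  apply: eq_integral => y _; rewrite muleC -(MP2 y) -ge0_integralZl//.
  - by apply/measurable_EFinP; exact: (measurableT_comp mPd (pair2_measurable y)).
  - by move=> t _; rewrite lee_fin poisson_ge0.
rewrite le_eqVlt; apply/orP; left; apply/eqP.
transitivity (\int[mu]_y ((2^-1)%:E * (\int[mu]_t (cabs (g y) ^+ 2 * P (s * (y - t)))%:E) +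
   (2^-1)%:E * (\int[mu]_t (cabs (g t) ^+ 2 * P (s * (y - t)))%:E)))%E.
  apply: eq_integral => y _; rewrite /H /=.
  rewrite -!ge0_integralZl//; last 4 first.
  - exact: (measurableT_comp mE2 (pair1_measurable y)).
  - by move=> t _; rewrite lee_fin (H20 (y, t)).
  - exact: (measurableT_comp mE1 (pair1_measurable y)).
  - by move=> t _; rewrite lee_fin (H10 (y, t)).
  rewrite -ge0_integralD//.
  - by move=> t _; rewrite -EFinM lee_fin mulr_ge0 ?invr_ge0// (H10 (y, t)).
  - by apply: measurable_funeM; exact: (measurableT_comp mE1 (pair1_measurable y)).
  - by move=> t _; rewrite -EFinM lee_fin mulr_ge0 ?invr_ge0// (H20 (y, t)).
  - by apply: measurable_funeM; exact: (measurableT_comp mE2 (pair1_measurable y)).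
have mI1 := measurable_fun_fubini_tonelli_F (m2 := mu) _ mE1 (fun z => H10 z).
have mI2 := measurable_fun_fubini_tonelli_F (m2 := mu) _ mE2 (fun z => H20 z).
have I10 y : (0 <= \int[mu]_t (cabs (g y) ^+ 2 * P (s * (y - t)))%:E)%E.
  by apply: integral_ge0 => t _; rewrite lee_fin (H10 (y, t)).
have I20 y : (0 <= \int[mu]_t (cabs (g t) ^+ 2 * P (s * (y - t)))%:E)%E.
  by apply: integral_ge0 => t _; rewrite lee_fin (H20 (y, t)).
rewrite ge0_integralD//; last 4 first.
- by move=> y _; rewrite mule_ge0.
- exact: measurable_funeM.
- by move=> y _; rewrite mule_ge0.
- exact: measurable_funeM.
rewrite !ge0_integralZl// T1 T2.
set A := (_ * \int[mu]_x _)%E.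
have A0 : (0 <= A)%E.
  by rewrite mule_ge0 ?integral_ge0// lee_fin divr_ge0// mulr_ge0// pi_ge0.
rewrite -ge0_muleDl//.
by rewrite -EFinD (_ : 2^-1 + 2^-1 = 1) ?mul1e//; field.
Qed.

End laplace_weight.

End ft1.

(** * The Plancherel identity on the line *)

Lemma eq_cvg_nat (R : realType) (f g : nat -> R) (a b : R) : (forall n, f n = g n) -> a = b ->
  f n @[n --> \oo] --> a -> g n @[n --> \oo] --> b.
Proof. by move=> /funext -> ->. Qed.

Section plancherel1.
Context {R : realType}.
Local Notation mu := (@lebesgue_measure R).
Local Notation T := (measurableTypeR R).
Implicit Types (g : T -> R[i]) (s : R).
Local Notation Re := complex.Re.
Local Notation Im := complex.Im.

Let eps (n : nat) : R := n.+1%:R^-1.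

Let eps_gt0 n : 0 < eps n. Proof. by rewrite invr_gt0 ltr0n. Qed.

Let cvg_eps : eps n @[n --> \oo] --> 0.
Proof. exact: cvg_harmonic. Qed.

Let cvg_laplace x : laplace (eps n) x @[n --> \oo] --> (1 : R).
Proof.
rewrite -[1]expR0; apply: continuous_cvg; first exact: continuous_expR.
rewrite -[X in _ --> X]oppr0; apply: cvgN; rewrite -(mul0r `|x|).
by apply: cvgM => //; exact: cvg_cst.
Qed.

Let M s : R := 2 * pi / `|s|.

Let M_gt0 s : s != 0 -> 0 < M s.
Proof. by move=> s0; rewrite divr_gt0 ?normr_gt0// mulr_gt0// pi_gt0. Qed.

(** Half of Plancherel: let the Laplace weight increase to 1. *)
Lemma ft1_le s g : s != 0 -> cintegrable mu setT g ->
  (\int[mu]_x (cabs (ft1 s g x) ^+ 2)%:E <= (M s)%:E * \int[mu]_x (cabs (g x) ^+ 2)%:E)%E.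
Proof.
move=> s0 Ig.
have mG := cmeasurable_cabs (cmeasurable_ft1 s Ig).
apply: (@fatou_bound _ _ _ _ (fun n x => cabs (ft1 s g x) ^+ 2 * laplace (eps n) x)).
- move=> n; apply: measurable_funM; last exact: measurable_laplace.
  exact: measurable_funX.
- exact: measurable_funX.
- by move=> n x; rewrite mulr_ge0 ?laplace_ge0// exprn_ge0// cabs_ge0.
- by move=> x; rewrite exprn_ge0// cabs_ge0.
- apply: aeW => x; rewrite -[X in _ --> X]mulr1.
  by apply: cvgM; [exact: cvg_cst|exact: cvg_laplace].
- by move=> n; exact: ft1_laplace_le.
Qed.

Section box.
Variables (del : R) (del0 : 0 < del).

Definition box (y : T) : R := \1_`]- del, del[%classic y.

Lemma boxE y : box y = if (- del < y) && (y < del) then 1 else 0.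
Proof.
rewrite /box indicE; case: ifPn => h.
  by rewrite mem_set//= in_itv.
by rewrite memNset//= in_itv/=; exact/negP.
Qed.

Lemma measurable_box : measurable_fun setT box.
Proof. exact: measurable_indic. Qed.

Lemma box_ge0 y : 0 <= box y. Proof. by rewrite boxE; case: ifP. Qed.
Lemma box_le1 y : box y <= 1. Proof. by rewrite boxE; case: ifP. Qed.

Lemma integral_box : (\int[mu]_y (box y)%:E = (2 * del)%:E)%E.
Proof.
transitivity (mu `]- del, del[%classic).
  by rewrite integral_indic ?setIT//; exact: measurable_itv.
rewrite lebesgue_measure_itv/= lte_fin.
rewrite ifT; last by rewrite (lt_trans _ del0)// oppr_lt0.
by rewrite -EFinD opprK mulr_natl mulr2n.
Qed.

Lemma cintegrable_box : cintegrable mu setT (fun y => (box y)%:C).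
Proof.
apply/cintegrableP => //; split; first by apply: cmeasurable_real; exact: measurable_box.
under eq_integral do rewrite cabs_real ger0_norm ?box_ge0//.
by rewrite integral_box ltry.
Qed.

Lemma cabs_ft1_box s x : cabs (ft1 s (fun y => (box y)%:C) x) <= 2 * del.
Proof.
apply: (le_trans (cabs_ft1 s cintegrable_box x)).
rewrite /Rintegral; under eq_integral do rewrite cabs_real ger0_norm ?box_ge0//.
by rewrite integral_box.
Qed.

Definition smoothed_box s e (z : T) : R := Rintegral mu setT (fun y => box y * poisson e (s * (z - y))).

Lemma smoothed_boxE s e z : 0 < e -> smoothed_box s e z =
  Rintegral mu setT (fun u => box (z - e * u) * poisson 1 (s * u)).
Proof.
move=> e0; rewrite /smoothed_box /Rintegral; congr fine.
have en0 : - e != 0 by rewrite oppr_eq0 gt_eqF.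
pose f (y : T) := (box y * poisson e (s * (z - y)))%:E.
have mf : measurable_fun setT f.
  apply/measurable_EFinP; apply: measurable_funM; first exact: measurable_box.
  apply: (measurableT_comp (measurable_poisson e0)); apply: measurable_funM => //.
  exact: measurable_funB.
have f0 y : (0 <= f y)%E by rewrite lee_fin mulr_ge0 ?box_ge0 ?poisson_ge0.
have := ge0_integral_affine z en0 mf f0.
rewrite normrN (gtr0_norm e0) => /(congr1 (fun t => e%:E * t)%E).
rewrite muleA -EFinM mulfV ?gt_eqF// mul1e => <-.
rewrite -ge0_integralZl//.
- apply: eq_integral => u _; rewrite /f -EFinM; congr EFin.
  rewrite mulrCA (_ : - e * u + z = z - e * u); last by ring.
  congr (_ * _); rewrite /poisson.
  rewrite (_ : z - (z - e * u) = e * u); last by ring.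
  rewrite (_ : e ^+ 2 + (s * (e * u)) ^+ 2 = e ^+ 2 * (1 ^+ 2 + (s * u) ^+ 2)); last by ring.
  have h : 1 ^+ 2 + (s * u) ^+ 2 != 0.
    by rewrite gt_eqF// ltr_wpDr ?sqr_ge0// exprn_gt0.
  have en : e != 0 by rewrite gt_eqF.
  by move: h; set D := 1 ^+ 2 + _ => h; field; rewrite h en.
- by apply: (measurableT_comp mf); exact: measurable_affine.
- by rewrite lee_fin ltW.
Qed.

Lemma integrable_poisson s : s != 0 -> mu.-integrable setT (EFin \o (fun u => poisson 1 (s * u))).
Proof.
move=> s0; apply: integrable_norm_lty.
  by apply: (measurableT_comp (measurable_poisson ltr01)); exact: measurable_funM.
under eq_integral do rewrite ger0_norm ?poisson_ge0//.
by rewrite integral_poisson// ltry.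
Qed.

(** An approximate identity applied to the box converges where the box is continuous. *)
Lemma cvg_smoothed_box s z : s != 0 -> `|z| != del ->
  smoothed_box s (eps n) z @[n --> \oo] --> M s * box z.
Proof.
move=> s0 zd.
under eq_fun do rewrite smoothed_boxE//.
have Is := integrable_poisson s0.
have mP : measurable_fun setT (fun u : T => poisson 1 (s * u)).
  by apply: (measurableT_comp (measurable_poisson ltr01)); exact: measurable_funM.
have mb n : measurable_fun setT (fun u : T => box (z - eps n * u) * poisson 1 (s * u)).
  apply: measurable_funM => //; apply: (measurableT_comp measurable_box).
  by apply: measurable_funB => //; exact: measurable_funM.
have bc (u : T) : box (z - eps n * u) @[n --> \oo] --> box z.
  have zu : z - eps n * u @[n --> \oo] --> z.
    rewrite -[X in _ --> X]subr0; apply: cvgB; first exact: cvg_cst.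
    by rewrite -(mul0r u); apply: cvgM => //; exact: cvg_cst.
  apply: cvg_near_cst; rewrite boxE.
  have [h|h] := ltP `|z| del.
    have /andP[z1 z2] : (- del < z) && (z < del) by rewrite -ltr_norml.
    rewrite z1 z2/=; near=> n; rewrite boxE ifT//; apply/andP; split; near: n.
      exact: (cvgr_gt z zu).
    exact: (cvgr_lt z zu).
  have {}h : del < `|z| by rewrite lt_neqAle eq_sym zd.
  have hz : ((- del < z) && (z < del)) = false by rewrite -ltr_norml ltNge (ltW h).
  rewrite hz.
  have [z1|z1] : z < - del \/ del < z.
    by move: h; rewrite ltr_normr => /orP[h|h]; [right|left; lra].
    near=> n; rewrite boxE ifF//; apply/negbTE; rewrite negb_and -!leNgt.
    apply/orP; left; near: n.
    exact: (cvgr_le z zu).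
  near=> n; rewrite boxE ifF//; apply/negbTE; rewrite negb_and -!leNgt.
  apply/orP; right; near: n.
  exact: (cvgr_ge z zu).
have ME : Rintegral mu setT (fun u => box z * poisson 1 (s * u)) = M s * box z.
  rewrite RintegralZl// mulrC; congr (_ * _).
  by rewrite /Rintegral integral_poisson.
rewrite -ME.
have [] := @dominated_convergence _ T R mu setT measurableT
  (fun n u => (box (z - eps n * u) * poisson 1 (s * u))%:E)
  (fun u => (box z * poisson 1 (s * u))%:E) (EFin \o (fun u => poisson 1 (s * u))).
- by move=> n; exact/measurable_EFinP.
- by apply/measurable_EFinP; exact: measurable_funM.
- apply: aeW => u _; apply: cvg_EFin; first exact: nearW.
  by apply: cvgM; [exact: bc|exact: cvg_cst].
- exact: Is.
- apply: aeW => u n _ /=; have P0 := poisson_ge0 ltr01 (s * u).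
  rewrite lee_fin (ger0_norm (mulr_ge0 (box_ge0 _) P0)).
  by apply: ler_piMl; [exact: poisson_ge0|exact: box_le1].
- move=> If _ h; apply: fine_cvg; rewrite fineK//.
  exact: integrable_fin_num If.
Unshelve. all: by end_near. Qed.

Lemma smoothed_box_le s e z : s != 0 -> 0 < e -> 0 <= smoothed_box s e z <= M s.
Proof.
move=> s0 e0; apply/andP; split.
  by apply: Rintegral_ge0 => y _; rewrite mulr_ge0 ?box_ge0 ?poisson_ge0.
rewrite smoothed_boxE// (_ : M s = Rintegral mu setT (fun u => poisson 1 (s * u))); last first.
  by rewrite /Rintegral integral_poisson.
have Is := integrable_poisson s0.
have mb : measurable_fun setT (fun u : T => box (z - e * u) * poisson 1 (s * u)).
  apply: measurable_funM; last by apply/measurable_EFinP; exact: measurable_int Is.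
  apply: (measurableT_comp measurable_box).
  by apply: measurable_funB => //; exact: measurable_funM.
apply: le_Rintegral => //.
  apply: le_integrable Is => //; first exact/measurable_EFinP.
  move=> u _ /=; have P0 := poisson_ge0 ltr01 (s * u); have b0 := box_ge0 (z - e * u).
  rewrite lee_fin (ger0_norm P0) (ger0_norm (mulr_ge0 b0 P0)).
  by apply: ler_piMl; [exact: poisson_ge0|exact: box_le1].
by move=> u _; apply: ler_piMl; [exact: poisson_ge0|exact: box_le1].
Qed.

Lemma measurable_smoothed_box s e : 0 < e -> measurable_fun setT (smoothed_box s e).
Proof.
move=> e0; apply: (measurable_Rintegral mu (f := fun z : T * T => box z.2 * poisson e (s * (z.1 - z.2)))).
apply: measurable_funM; first exact: (measurableT_comp measurable_box).
apply: (measurableT_comp (measurable_poisson e0)); apply: measurable_funM => //.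
exact: measurable_funB.
Qed.

(** The transform of [box] is a bounded multiplier. Inserting it, together with the Laplace
    weight, into the inversion of [g] amounts to convolving [g] with the smoothed box. *)
Lemma ft1_box_inversion s g e (y0 : T) : 0 < e -> cintegrable mu setT g ->
  ft1 (- s) (fun x => (laplace e x)%:C * (ft1 (- s) (fun y => (box y)%:C) x * ft1 s g x)) y0 =
  cintegral mu setT (fun z => g z * (smoothed_box s e (z - y0))%:C).
Proof.
move=> e0 Ig; set B := ft1 (- s) (fun y => (box y)%:C).
have mB : cmeasurable setT B by apply: cmeasurable_ft1; exact: cintegrable_box.
pose v x := expi (- s * (y0 * x)) * ((laplace e x)%:C * B x).
have Iv : cintegrable mu setT v.
  apply: cintegrable_wave; apply: cintegrable_laplaceM => //.
  by exists (2 * del) => x; exact: cabs_ft1_box.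
transitivity (cintegral mu setT (fun x => ft1 s g x * v x)).
  by rewrite [LHS]/ft1; apply: eq_cintegral => x _; rewrite /v; ring.
transitivity (cintegral mu setT (fun z => g z * ft1 s v z)); first exact: ft1_mult.
apply: eq_cintegral => z _; congr (_ * _).
have := laplace_inversion e0 s (z - y0) cintegrable_box.
rewrite -/B => E.
transitivity (cintegral mu setT (fun y => (box y)%:C * (poisson e (s * (z - y0 - y)))%:C)).
  rewrite -E /ft1; apply: eq_cintegral => x _; rewrite /v mulrA -expiD.
  by congr (expi _ * _); ring.
apply: complex_eq.
  by rewrite Re_cintegral; apply: eq_Rintegral => y _; rewrite cReM /= mulr0 subr0.
rewrite Im_cintegral; transitivity (Rintegral mu setT (cst (0 : R))).
  by apply: eq_Rintegral => y _; rewrite cImM /= mulr0 mul0r addr0.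
by rewrite /Rintegral integral0.
Qed.

(** Averages of [g] serve for the lower bound because, unlike [g] itself, they are given by
    an absolutely convergent inversion formula. *)
Definition box_average g (y0 : T) : R[i] := cintegral mu setT (fun z => g z * (box (z - y0))%:C).

Lemma cvg_cabs (f : nat -> R[i]) (l : R[i]) : Re (f n) @[n --> \oo] --> Re l ->
  Im (f n) @[n --> \oo] --> Im l -> cabs (f n) ^+ 2 @[n --> \oo] --> cabs l ^+ 2.
Proof.
move=> rl il; rewrite cabs_sqr; under eq_fun do rewrite cabs_sqr.
by apply: cvgD; apply: cvgM.
Qed.

Lemma cvg_Rintegral_smoothed_box s (f : T -> R) (y0 : T) : s != 0 -> mu.-integrable setT (EFin \o f) ->
  Rintegral mu setT (fun z => f z * smoothed_box s (eps n) (z - y0)) @[n --> \oo] -->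
  Rintegral mu setT (fun z => f z * (M s * box (z - y0))).
Proof.
move=> s0 If.
have mf : measurable_fun setT f by apply/measurable_EFinP; exact: measurable_int If.
have [] := @dominated_convergence _ T R mu setT measurableT
  (fun n z => (f z * smoothed_box s (eps n) (z - y0))%:E)
  (fun z => (f z * (M s * box (z - y0)))%:E) (EFin \o (fun z => M s * `|f z|)).
- move=> n; apply/measurable_EFinP; apply: measurable_funM => //.
  apply: (measurableT_comp (measurable_smoothed_box s (eps_gt0 n))).
  exact: measurable_funB.
- apply/measurable_EFinP; apply: measurable_funM => //.
  apply: measurable_funM => //; apply: (measurableT_comp measurable_box).
  exact: measurable_funB.
(* The box is discontinuous at its two end points only. *)
- exists [set y0 + del; y0 - del]; split.
  + by apply: measurableU; exact: measurable_set1.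
  + by apply: countable_lebesgue_measure0; apply: finite_set_countable; exact: finite_set2.
  + move=> z /= /not_implyP[_]; apply: contra_notP => /= zN.
    apply: cvg_EFin; first exact: nearW.
    apply: cvgM; first exact: cvg_cst.
    apply: cvg_smoothed_box => //; apply/eqP => zd; apply: zN.
    have [h|h] := lerP 0 (z - y0).
      by move: zd; rewrite ger0_norm// => zd; left; lra.
    by move: zd; rewrite ltr0_norm// => zd; right; lra.
- have := integrable_scale measurableT (M s) (f := fun z => `|f z|).
  by apply; exact: (integrable_abse If).
- apply: aeW => z n _ /=; rewrite lee_fin normrM mulrC ler_wpM2r//.
  by have /andP[h1 h2] := smoothed_box_le (z - y0) s0 (eps_gt0 n); rewrite ger0_norm.
- move=> Ig _ h; apply: fine_cvg; rewrite fineK//.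
  exact: integrable_fin_num Ig.
Qed.

Lemma cmeasurable_box_average g : cintegrable mu setT g -> cmeasurable setT (box_average g).
Proof.
move=> Ig; apply: (cmeasurable_cintegral mu
  (F := fun z : T * T => g z.2 * (box (z.2 - z.1))%:C)).
apply: cmeasurableM.
  exact: (cmeasurable_comp (cintegrable_measurable Ig) measurable_snd).
by apply: cmeasurable_real; apply: (measurableT_comp measurable_box); exact: measurable_funB.
Qed.

(** Apply [ft1_le] to the left side of [ft1_box_inversion], where the transform of the box
    is at most [2 * del], and let the Laplace weight tend to 1. *)
Lemma box_average_le s g : s != 0 -> cintegrable mu setT g ->
  (\int[mu]_y (cabs ((M s)%:C * box_average g y) ^+ 2)%:E <=
   (M s * (2 * del) ^+ 2)%:E * \int[mu]_x (cabs (ft1 s g x) ^+ 2)%:E)%E.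
Proof.
move=> s0 Ig.
pose B := ft1 (- s) (fun y => (box y)%:C).
have mB : cmeasurable setT B by apply: cmeasurable_ft1; exact: cintegrable_box.
pose q n x := (laplace (eps n) x)%:C * (B x * ft1 s g x).
have mG := cmeasurable_ft1 s Ig.
have Iq n : cintegrable mu setT (q n).
  apply: cintegrable_laplaceM => //; first exact: cmeasurableM.
  exists (2 * del * Rintegral mu setT (fun y => cabs (g y))) => x.
  rewrite cabsM; apply: ler_pM; [exact: cabs_ge0|exact: cabs_ge0| |].
    exact: cabs_ft1_box.
  exact: cabs_ft1.
have IgM (f : T -> R) (K : R) : measurable_fun setT f -> (forall z, `|f z| <= K) ->
    cintegrable mu setT (fun z => g z * (f z)%:C).
  move=> mf fK; have := cintegrableM_bounded measurableT (cmeasurable_real mf) Ig (M := K).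
  under eq_fun do rewrite mulrC; apply => z _.
  by rewrite cabs_real.
apply: (@fatou_bound _ _ _ _ (fun n y => cabs (ft1 (- s) (q n) y) ^+ 2)).
- by move=> n; apply: measurable_funX; apply: cmeasurable_cabs; exact: cmeasurable_ft1.
- apply: measurable_funX; apply: cmeasurable_cabs; apply: cmeasurableM.
    exact: cmeasurable_cst.
  exact: cmeasurable_box_average.
- by move=> n x; rewrite exprn_ge0// cabs_ge0.
- by move=> x; rewrite exprn_ge0// cabs_ge0.
- apply: aeW => y0; under eq_fun do rewrite ft1_box_inversion//.
  have -> : (M s)%:C * box_average g y0 = cintegral mu setT (fun z => g z * (M s * box (z - y0))%:C).
    rewrite /box_average -cintegralZl//.
      by apply: eq_cintegral => z _; apply: complex_eq; rewrite !(cReM, cImM) /=; ring.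
    apply: (IgM _ 1) => [|z]; last by rewrite ger0_norm ?box_ge0 ?box_le1.
    by apply: (measurableT_comp measurable_box); exact: measurable_funB.
  apply: cvg_cabs.
    apply: eq_cvg_nat (cvg_Rintegral_smoothed_box (f := fun z => Re (g z)) (y0 := y0) s0 Ig.1); last first.
      by rewrite Re_cintegral; apply: eq_Rintegral => z _; rewrite cReM /= mulr0 subr0.
    by move=> n; rewrite Re_cintegral; apply: eq_Rintegral => z _; rewrite cReM /= mulr0 subr0.
  apply: eq_cvg_nat (cvg_Rintegral_smoothed_box (f := fun z => Im (g z)) (y0 := y0) s0 Ig.2); last first.
    by rewrite Im_cintegral; apply: eq_Rintegral => z _; rewrite cImM /= mulr0 add0r.
  by move=> n; rewrite Im_cintegral; apply: eq_Rintegral => z _; rewrite cImM /= mulr0 add0r.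
- move=> n; have sN : - s != 0 by rewrite oppr_eq0.
  apply: (le_trans (ft1_le sN (Iq n))).
  have -> : M (- s) = M s by rewrite /M normrN.
  rewrite (EFinM (M s)) -muleA; apply: lee_wpmul2l; first by rewrite lee_fin ltW// M_gt0.
  rewrite -ge0_integralZl//; last 3 first.
  + exact: measurable_cabs_sqr.
  + by move=> x _; rewrite lee_fin exprn_ge0// cabs_ge0.
  + by rewrite lee_fin exprn_ge0// mulr_ge0// ltW.
  apply: ge0_le_integral => //.
  + by move=> x _; rewrite lee_fin exprn_ge0// cabs_ge0.
  + by apply/measurable_EFinP; apply: measurable_funX; apply: cmeasurable_cabs; exact: cintegrable_measurable (Iq n).
  + by apply: measurable_funeM; apply/measurable_EFinP; apply: measurable_funX; exact: cmeasurable_cabs.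
  + move=> x _; rewrite -EFinM lee_fin -exprMn ler_pXn2r ?nnegrE ?mulr_ge0 ?cabs_ge0 ?(ltW del0)//.
    rewrite /q !cabsM cabs_real ger0_norm ?laplace_ge0// -[leRHS]mul1r.
    rewrite ler_pM ?mulr_ge0 ?cabs_ge0 ?laplace_ge0 ?laplace_le1//.
    by rewrite ler_wpM2r ?cabs_ge0// cabs_ft1_box.
Qed.

End box.

(** The Lebesgue differentiation theorem. *)
Lemma ae_cvg_box_average_real (f : T -> R) : mu.-integrable setT (EFin \o f) ->
  {ae mu, forall x, (2 * eps n)^-1 * Rintegral mu setT (fun z => f z * box (eps n) (z - x))
    @[n --> \oo] --> f x}.
Proof.
move=> If; have mf : measurable_fun setT f by apply/measurable_EFinP; exact: measurable_int If.
have ae := lebesgue_differentiation (open_integrable_locally openT If).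
apply: (ae_imp ae) => x.
rewrite /lebesgue_pt => h0.
have er : eps n @[n --> \oo] --> (0 : R)^'+.
  move=> A /= nA; have h1 : \forall n \near \oo, 0 < eps n -> A (eps n) by exact: (cvg_eps nA).
  change (\forall n \near \oo, A (eps n)).
  by apply: filterS h1 => n h1; exact: (h1 (eps_gt0 n)).
have h : davg f x (eps n) @[n --> \oo] --> 0%E by exact: cvg_comp er h0.
apply/cvgrPdist_lt => e e0.
have /fine_cvgP[_ /cvgrPdist_lt /(_ e e0)] := h.
move=> h2; near=> n.
have en := eps_gt0 n.
have : fine (davg f x (eps n)) < e.
  have : `|0 - fine (davg f x (eps n))| < e by near: n.
  by rewrite sub0r normrN => /(le_lt_trans (ler_norm _)).
apply: le_lt_trans.
have ballE : ball (x : R) (eps n) = `]x - eps n, x + eps n[%classic by exact: ball_itv.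
have mball : measurable (ball (x : R) (eps n) : set T) by rewrite ballE; exact: measurable_itv.
have muball : mu (ball (x : R) (eps n)) = (2 * eps n)%:E.
  by rewrite lebesgue_measure_ball ?ltW// mulr_natl.
have bb z : box (eps n) (z - x) = \1_(ball (x : R) (eps n)) z.
  rewrite /box !indicE ballE !mem_setE/= !in_itv/=; congr (nat_of_bool _)%:R.
  by congr (_ && _); lra.
have ib : (\int[mu]_z (\1_(ball (x : R) (eps n)) z)%:E = (2 * eps n)%:E)%E.
  by rewrite integral_indic// setIT; exact: muball.
have mbx : measurable_fun setT (fun z : T => box (eps n) (z - x)).
  by apply: (measurableT_comp (measurable_box _)); exact: measurable_funB.
have Ib : mu.-integrable setT (EFin \o (fun z => box (eps n) (z - x))).
  apply: integrable_norm_lty => //.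
  under eq_integral do rewrite ger0_norm ?box_ge0// bb.
  by rewrite ib ltry.
have Ifb : mu.-integrable setT (EFin \o (fun z => f z * box (eps n) (z - x))).
  apply: le_integrable If => //; first by apply/measurable_EFinP; exact: measurable_funM.
  by move=> z _ /=; rewrite lee_fin normrM ler_piMr// ger0_norm ?box_ge0// box_le1.
have Ifx : mu.-integrable setT (EFin \o (fun z => f x * box (eps n) (z - x))).
  exact: integrable_scale.
have c0 : 0 < (2 * eps n)^-1 by rewrite invr_gt0 mulr_gt0.
have -> : f x - (2 * eps n)^-1 * Rintegral mu setT (fun z => f z * box (eps n) (z - x)) =
   (2 * eps n)^-1 * Rintegral mu setT (fun z => f x * box (eps n) (z - x) - f z * box (eps n) (z - x)).
  rewrite RintegralB// RintegralZl// mulrBr; congr (_ - _).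
  rewrite mulrCA (_ : Rintegral mu setT (fun z => box (eps n) (z - x)) = 2 * eps n).
    by rewrite mulVf ?mulr1// gt_eqF// mulr_gt0.
  rewrite /Rintegral; under eq_integral do rewrite bb.
  by rewrite ib.
rewrite normrM (gtr0_norm c0).
have Id : mu.-integrable setT (EFin \o (fun z => f x * box (eps n) (z - x) - f z * box (eps n) (z - x))).
  exact: (integrableB _ Ifx Ifb).
apply: (@le_trans _ _ ((2 * eps n)^-1 *
    Rintegral mu setT (fun z => `|f x * box (eps n) (z - x) - f z * box (eps n) (z - x)|))).
  by rewrite ler_wpM2l ?(ltW c0)// le_normr_Rintegral.
rewrite /davg /iavg muball inver gt_eqF ?mulr_gt0//.
rewrite fineM//.
- rewrite ler_wpM2l ?(ltW c0)// /Rintegral le_eqVlt; apply/orP; left; apply/eqP; congr fine.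
  rewrite [RHS]integral_mkcond; apply: eq_integral => z _.
  rewrite bb patchE indicE; case: ifPn => _ /=.
    by rewrite !mulr1 distrC.
  by rewrite !mulr0 subrr normr0.
- rewrite ge0_fin_numE; last by apply: integral_ge0.
  have /integrableP[_] := Id; apply: le_lt_trans.
  rewrite [leLHS]integral_mkcond le_eqVlt; apply/orP; left; apply/eqP; apply: eq_integral => z _.
  rewrite /= bb patchE indicE; case: ifPn => _ /=.
    by rewrite !mulr1 distrC.
  by rewrite !mulr0 subrr normr0.
Unshelve. all: by end_near. Qed.

(** The upper bound is [ft1_le]. For the lower bound, the averages of [g] over small
    intervals have L^2 norm at most that of the transform, by [box_average_le], and they
    converge to [g] almost everywhere; conclude by Fatou. *)
Theorem plancherel1 s g : s != 0 -> cintegrable mu setT g ->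
  (\int[mu]_x (cabs (ft1 s g x) ^+ 2)%:E = (M s)%:E * \int[mu]_x (cabs (g x) ^+ 2)%:E)%E.
Proof.
move=> s0 Ig; apply/eqP; rewrite eq_le; apply/andP; split; first exact: ft1_le.
have mg := cintegrable_measurable Ig.
have M0 := M_gt0 s0.
rewrite -lee_pdivlMl//.
set L := (\int[mu]_x _)%E.
have IgM n y : cintegrable mu setT (fun z => g z * (box (eps n) (z - y))%:C).
  have mb : measurable_fun setT (fun z : T => box (eps n) (z - y)).
    by apply: (measurableT_comp (measurable_box _)); exact: measurable_funB.
  have := cintegrableM_bounded measurableT (cmeasurable_real mb) Ig (M := 1).
  under eq_fun do rewrite mulrC; apply => z _.
  by rewrite cabs_real ger0_norm ?box_ge0 ?box_le1.
apply: (@fatou_bound _ _ _ _ (fun n y => cabs (((2 * eps n)^-1)%:C * box_average (eps n) g y) ^+ 2)).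
- move=> n; apply: measurable_funX; apply: cmeasurable_cabs; apply: cmeasurableM.
    exact: cmeasurable_cst.
  exact: cmeasurable_box_average.
- by apply: measurable_funX; exact: cmeasurable_cabs.
- by move=> n x; rewrite exprn_ge0// cabs_ge0.
- by move=> x; rewrite exprn_ge0// cabs_ge0.
- apply: (ae_imp2 (ae_cvg_box_average_real Ig.1) (ae_cvg_box_average_real Ig.2)) => y cr ci.
  apply: cvg_cabs.
    apply: eq_cvg_nat cr => // n.
    rewrite cReM /= mul0r subr0; congr (_ * _).
    by apply: eq_Rintegral => z _; rewrite cReM /= mulr0 subr0.
  apply: eq_cvg_nat ci => // n.
  rewrite cImM /= mul0r addr0; congr (_ * _).
  by apply: eq_Rintegral => z _; rewrite cImM /= mulr0 add0r.
- move=> n; have en := eps_gt0 n.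
  have := box_average_le en s0 Ig; rewrite -/L => h.
  have c0 : 0 < M s * (2 * eps n) ^+ 2 by rewrite mulr_gt0// exprn_gt0// mulr_gt0.
  have mA : measurable_fun setT (fun y => (cabs (((2 * eps n)^-1)%:C * box_average (eps n) g y) ^+ 2)%:E).
    apply/measurable_EFinP; apply: measurable_funX; apply: cmeasurable_cabs; apply: cmeasurableM.
      exact: cmeasurable_cst.
    exact: cmeasurable_box_average.
  rewrite lee_pdivlMl// -(lee_pmul2l _ (x := (M s * (2 * eps n) ^+ 2)%:E))//.
  apply: le_trans h; rewrite muleA -EFinM.
  rewrite -ge0_integralZl//; last 2 first.
  + by move=> x _; rewrite lee_fin exprn_ge0// cabs_ge0.
  + by rewrite lee_fin; apply: mulr_ge0; apply: ltW.
  rewrite le_eqVlt; apply/orP; left; apply/eqP; apply: eq_integral => y _.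
  rewrite -EFinM; congr EFin; rewrite !cabsM !cabs_real !exprMn !real_normK ?num_real//.
  have e0' : eps n != 0 by rewrite gt_eqF.
  by field.
Qed.

End plancherel1.

(** * Lebesgue integrals over row vectors *)

Section dot_product.
Context {R : realType}.
Implicit Types n : nat.

Lemma dotE n (x y : 'rV[R]_n) : dot x y = (x *m y^T) ord0 ord0.
Proof. by rewrite mxE; apply: eq_bigr => i _; rewrite mxE. Qed.

Lemma dotC n (x y : 'rV[R]_n) : dot x y = dot y x.
Proof. by apply: eq_bigr => i _; rewrite mulrC. Qed.

Lemma dotDl n (x y z : 'rV[R]_n) : dot (x + y) z = dot x z + dot y z.
Proof. by rewrite !dotE mulmxDl mxE. Qed.

Lemma dotDr n (x y z : 'rV[R]_n) : dot z (x + y) = dot z x + dot z y.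
Proof. by rewrite dotC dotDl !(dotC z). Qed.

Lemma dotZl n (a : R) (x z : 'rV[R]_n) : dot (a *: x) z = a * dot x z.
Proof. by rewrite !dotE -scalemxAl mxE. Qed.

Lemma dotZr n (a : R) (x z : 'rV[R]_n) : dot z (a *: x) = a * dot z x.
Proof. by rewrite dotC dotZl dotC. Qed.

Lemma dotNl n (x z : 'rV[R]_n) : dot (- x) z = - dot x z.
Proof. by rewrite -scaleN1r dotZl mulN1r. Qed.

Lemma dotNr n (x z : 'rV[R]_n) : dot z (- x) = - dot z x.
Proof. by rewrite dotC dotNl dotC. Qed.

Lemma dot_ge0 n (x : 'rV[R]_n) : 0 <= dot x x.
Proof. by apply: sumr_ge0 => i _; rewrite -expr2 sqr_ge0. Qed.

Lemma dot_eq0 n (x : 'rV[R]_n) : dot x x = 0 -> x = 0.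
Proof.
move=> /eqP; rewrite psumr_eq0 => [|i _]; last by rewrite -expr2 sqr_ge0.
move=> /allP h; apply/rowP => i; rewrite mxE; apply/eqP.
by have := h i (mem_index_enum _); rewrite /= mulf_eq0 orbb.
Qed.

Lemma enorm_sqr n (x : 'rV[R]_n) : enorm x ^+ 2 = dot x x.
Proof. by rewrite sqr_sqrtr// dot_ge0. Qed.

Lemma enorm_ge0 n (x : 'rV[R]_n) : 0 <= enorm x. Proof. exact: sqrtr_ge0. Qed.

Lemma enormZ n (a : R) (x : 'rV[R]_n) : enorm (a *: x) = `|a| * enorm x.
Proof. by rewrite /enorm dotZl dotZr mulrA -expr2 sqrtrM ?sqr_ge0// sqrtr_sqr. Qed.

Lemma dot_mulmx m n (B : 'M[R]_(m, n)) (x y : 'rV[R]_m) : B *m B^T = 1%:M ->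
  dot (x *m B) (y *m B) = dot x y.
Proof. by move=> BB; rewrite !dotE trmx_mul mulmxA -(mulmxA x) BB mulmx1. Qed.

Lemma enorm_mulmx m n (B : 'M[R]_(m, n)) (x : 'rV[R]_m) : B *m B^T = 1%:M ->
  enorm (x *m B) = enorm x.
Proof. by move=> BB; rewrite /enorm dot_mulmx. Qed.

Lemma rV_cons0 n (p : measurableTypeR R * 'rV[R]_n) : rV_cons p ord0 ord0 = p.1.
Proof.
rewrite /rV_cons (_ : ord0 = lshift n ord0 :> 'I_(1 + n)); last exact/val_inj.
by apply: etrans (row_mxEl _ _ _ _) _; rewrite mxE eqxx mulr1n.
Qed.

Lemma rV_consS n (p : measurableTypeR R * 'rV[R]_n) j : rV_cons p ord0 (lift ord0 j) = p.2 ord0 j.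
Proof.
rewrite /rV_cons (_ : lift ord0 j = rshift 1 j :> 'I_(1 + n)); last exact/val_inj.
exact: row_mxEr.
Qed.

Lemma rV_cons_eq n (x y : 'rV[R]_n.+1) : x ord0 ord0 = y ord0 ord0 ->
  (forall j, x ord0 (lift ord0 j) = y ord0 (lift ord0 j)) -> x = y.
Proof. by move=> h0 hS; apply/rowP => i; case: (unliftP ord0 i) => [j|] ->. Qed.

Lemma dot_cons n (p q : measurableTypeR R * 'rV[R]_n) :
  dot (rV_cons p) (rV_cons q) = p.1 * q.1 + dot p.2 q.2.
Proof.
rewrite /dot big_ord_recl !rV_cons0; congr (_ + _).
by apply: eq_bigr => j _; rewrite !rV_consS.
Qed.

Lemma rV_consD n (p q : measurableTypeR R * 'rV[R]_n) :
  rV_cons p + rV_cons q = rV_cons (p.1 + q.1, p.2 + q.2).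
Proof.
by apply: rV_cons_eq => [|j]; rewrite mxE ?(rV_cons0, rV_consS)//= mxE.
Qed.

Lemma rV_consZ n (a : R) (p : measurableTypeR R * 'rV[R]_n) :
  a *: rV_cons p = rV_cons (a * p.1, a *: p.2).
Proof.
by apply: rV_cons_eq => [|j]; rewrite mxE ?(rV_cons0, rV_consS)//= mxE.
Qed.

Definition rV_uncons n (x : 'rV[R]_n.+1) : measurableTypeR R * 'rV[R]_n :=
  (x ord0 ord0, \row_j x ord0 (lift ord0 j)).

Lemma rV_unconsK n : cancel (@rV_uncons n) (@rV_cons R n).
Proof.
by move=> x; apply: rV_cons_eq => [|j]; rewrite ?(rV_cons0, rV_consS)//= mxE.
Qed.

End dot_product.

Section lebesgue_rV_integral.
Context {R : realType}.
Local Notation mu := (@lebesgue_measure R).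
Local Notation T := (measurableTypeR R).
Implicit Types n : nat.
Local Notation L n := (@lebesgue_rV R n).

Lemma ge0_integral_rV0 (f : 'rV[R]_0 -> \bar R) : measurable_fun setT f ->
  (\int[L 0]_x f x = f 0%R)%E.
Proof. by move=> mf; rewrite integral_dirac// diracT mul1e. Qed.

Lemma ge0_integral_rVS n (f : 'rV[R]_n.+1 -> \bar R) : measurable_fun setT f ->
  (forall x, 0 <= f x)%E ->
  (\int[L n.+1]_x f x = \int[mu]_t \int[L n]_y f (rV_cons (t, y)))%E.
Proof.
move=> mf f0; have mfc := measurableT_comp mf (@measurable_rV_cons R n).
have := ge0_integral_pushforward (@measurable_rV_cons R n) (mu \x L n)%E measurableT mf (fun y _ => f0 y).
rewrite preimage_setT => E.
transitivity (\int[(mu \x L n)%E]_x (f \o (@rV_cons R n)) x)%E; first exact: E.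
by apply: (fubini_tonelli1 _ mfc) => x; exact: f0.
Qed.

Lemma measurable_rV_affine n (c : R) (a : 'rV[R]_n) : measurable_fun setT (fun x : 'rV[R]_n => c *: x + a).
Proof.
apply: measurable_fun_rVP => i; under eq_fun do rewrite !mxE.
apply: measurable_funD => //; apply: measurable_funM => //.
exact: measurable_rV_coord.
Qed.

(** One coordinate at a time. *)
Lemma ge0_integral_rV_affine n (c : R) (a : 'rV[R]_n) (f : 'rV[R]_n -> \bar R) : c != 0 ->
  measurable_fun setT f -> (forall x, 0 <= f x)%E ->
  (\int[L n]_x f (c *: x + a)%R = (`|c| ^- n)%:E * \int[L n]_x f x)%E.
Proof.
move=> c0; elim: n a f => [|n IHn] a f mf f0.
  rewrite !ge0_integral_rV0//; last exact: (measurableT_comp mf (measurable_rV_affine c a)).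
  rewrite expr0 invr1 mul1e; congr f; apply/rowP => -[]//.
have mfc := measurableT_comp mf (@measurable_rV_cons R n).
rewrite ge0_integral_rVS//; last exact: (measurableT_comp mf (measurable_rV_affine c a)).
rewrite ge0_integral_rVS//.
rewrite -[a]rV_unconsK; case: (rV_uncons a) => a1 a'.
pose F t := (\int[L n]_y f (rV_cons (t, y)))%E.
have mF : measurable_fun setT (F : T -> \bar R).
  exact: (measurable_fun_fubini_tonelli_F _ mfc (fun z => f0 _)).
have F0 t : (0 <= F t)%E by apply: integral_ge0.
transitivity (\int[mu]_t ((`|c| ^- n)%:E * F (c * t + a1)%R))%E.
  apply: eq_integral => t _.
  under eq_integral => y _ do rewrite rV_consZ rV_consD /=.
  rewrite (IHn a' (fun y => f (rV_cons (c * t + a1, y))))//.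
  exact: (measurableT_comp mfc (pair1_measurable _)).
rewrite ge0_integralZl; [|exact: measurableT| |by move=> t _; exact: F0|]; last 2 first.
- exact: (measurableT_comp mF (measurable_affine c a1)).
- by rewrite lee_fin invr_ge0 exprn_ge0.
rewrite ge0_integral_affine// muleA -EFinM; congr (_%:E * _)%E.
by rewrite exprS invfM mulrC.
Qed.

Lemma ge0_integral_rV_translate n (a : 'rV[R]_n) (f : 'rV[R]_n -> \bar R) :
  measurable_fun setT f -> (forall x, 0 <= f x)%E ->
  (\int[L n]_x f (x + a)%R = \int[L n]_x f x)%E.
Proof.
move=> mf f0; have := ge0_integral_rV_affine a (oner_neq0 R) mf f0.
rewrite normr1 expr1n invr1 mul1e => <-.
by apply: eq_integral => x _; rewrite scale1r.
Qed.

Definition gaussian n (x : 'rV[R]_n) : R := expR (- dot x x).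

Lemma gaussian_ge0 n (x : 'rV[R]_n) : 0 <= gaussian x. Proof. exact: expR_ge0. Qed.

Lemma measurable_gaussian n : measurable_fun setT (@gaussian n).
Proof. by apply: measurableT_comp => //; apply: measurableT_comp => //; exact: measurable_dot. Qed.

Lemma integral_gaussian n : (\int[L n]_x (gaussian x)%:E = (Num.sqrt pi ^+ n)%:E)%E.
Proof.
elim: n => [|n IHn].
  rewrite ge0_integral_rV0; last by apply/measurable_EFinP; exact: measurable_gaussian.
  by rewrite /gaussian /dot big_ord0 oppr0 expR0.
rewrite ge0_integral_rVS; last 2 first.
- by apply/measurable_EFinP; exact: measurable_gaussian.
- by move=> x; rewrite lee_fin gaussian_ge0.
transitivity (\int[mu]_t ((Num.sqrt pi ^+ n)%:E * (gauss_fun t)%:E))%E.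
  apply: eq_integral => t _.
  rewrite -IHn muleC -ge0_integralZl//.
  - by apply: eq_integral => y _; rewrite -EFinM /gaussian dot_cons /= opprD expRD -expr2.
  - by apply/measurable_EFinP; exact: measurable_gaussian.
  - by move=> x _; rewrite lee_fin gaussian_ge0.
  - by rewrite lee_fin gauss_fun_ge0.
rewrite ge0_integralZl//.
- by rewrite integralT_gauss -EFinM exprSr.
- by apply/measurable_EFinP; exact: measurable_gauss_fun.
- by move=> x _; rewrite lee_fin gauss_fun_ge0.
Qed.

Lemma measurable_rVD d (X : measurableType d) n (f g : X -> 'rV[R]_n) :
  measurable_fun setT f -> measurable_fun setT g -> measurable_fun setT (fun x => f x + g x).
Proof.
move=> mf mg; apply: measurable_fun_rVP => i; under eq_fun do rewrite mxE.
by apply: measurable_funD; exact: (measurableT_comp (measurable_rV_coord i)).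
Qed.

Lemma measurable_rVZ d (X : measurableType d) n (a : X -> R) (f : X -> 'rV[R]_n) :
  measurable_fun setT a -> measurable_fun setT f -> measurable_fun setT (fun x => a x *: f x).
Proof.
move=> ma mf; apply: measurable_fun_rVP => i; under eq_fun do rewrite mxE.
by apply: measurable_funM => //; exact: (measurableT_comp (measurable_rV_coord i)).
Qed.

Lemma measurable_rVN d (X : measurableType d) n (f : X -> 'rV[R]_n) :
  measurable_fun setT f -> measurable_fun setT (fun x => - f x).
Proof.
move=> mf; apply: measurable_fun_rVP => i; under eq_fun do rewrite mxE.
by apply: measurableT_comp => //; exact: (measurableT_comp (measurable_rV_coord i)).
Qed.

(** Average [f (x *m O + y)] over all [x] with Lebesgue measure and over [y] with a
    Gaussian. Translation invariance in [x] removes [y]; exchanging the integrals,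
    translation invariance in [y] moves [x *m O] into the Gaussian, where the rotation
    invariance of the Gaussian removes [O]. This avoids determinants and a decomposition of
    [O] into elementary matrices. *)
Lemma ge0_integral_rV_orthogonal n (O : 'M[R]_n) (f : 'rV[R]_n -> \bar R) :
  O *m O^T = 1%:M -> measurable_fun setT f -> (forall x, 0 <= f x)%E ->
  (\int[L n]_x f (x *m O)%R = \int[L n]_x f x)%E.
Proof.
move=> OO mf f0; have OO' : O^T *m O = 1%:M by exact: mulmx1C.
have mO : measurable_fun setT (fun x : 'rV[R]_n => x *m O) by exact: measurable_mulmxr.
pose a (y : 'rV[R]_n) := (gaussian y)%:E.
have a0 y : (0 <= a y)%E by rewrite lee_fin gaussian_ge0.
have ma : measurable_fun setT a by apply/measurable_EFinP; exact: measurable_gaussian.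
pose I := (\int[L n]_y a y)%E.
have IE : I = (Num.sqrt pi ^+ n)%:E by exact: integral_gaussian.
have I0 : 0 < Num.sqrt pi ^+ n :> R by rewrite exprn_gt0// sqrtr_gt0 pi_gt0.
suff E : (I * \int[L n]_x f (x *m O)%R = I * \int[L n]_x f x)%E.
  move/(congr1 (fun z => ((Num.sqrt pi ^+ n)^-1)%:E * z)%E) : E.
  by rewrite !muleA IE -EFinM mulVf ?gt_eqF// !mul1e.
have mfO := measurableT_comp mf mO.
transitivity (\int[L n]_y \int[L n]_x (a y * f (x *m O)))%E.
  rewrite muleC -ge0_integralZl//; last exact: integral_ge0.
  apply: eq_integral => y _; rewrite muleC -ge0_integralZl//.
transitivity (\int[L n]_y \int[L n]_x (a y * f (x *m O + y)%R))%E.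
  apply: eq_integral => y _.
  rewrite -(ge0_integral_rV_translate (y *m O^T) (f := fun x => a y * f (x *m O))%E)//.
  - by apply: eq_integral => x _; rewrite mulmxDl -mulmxA OO' mulmx1.
  - exact: measurable_funeM.
  - by move=> x; rewrite mule_ge0.
have m1 : measurable_fun setT (fun z : 'rV[R]_n * 'rV[R]_n => a z.1 * f (z.2 *m O + z.1)%R)%E.
  apply: emeasurable_funM; first exact: (measurableT_comp ma).
  apply: (measurableT_comp mf); apply: measurable_rVD => //.
  exact: (measurableT_comp mO).
rewrite (fubini_tonelli (m1 := L n) (m2 := L n) _ m1)//=; last by move=> z; rewrite mule_ge0.
transitivity (\int[L n]_x \int[L n]_y (a (y - x *m O)%R * f y))%E.
  apply: eq_integral => x _.
  rewrite -(ge0_integral_rV_translate (x *m O) (f := fun y => a (y - x *m O)%R * f y)%E).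
  - by apply: eq_integral => y _; rewrite addrK addrC.
  - apply: emeasurable_funM => //; apply: (measurableT_comp ma).
    by apply: measurable_rVD.
  - by move=> y; rewrite mule_ge0.
have m2 : measurable_fun setT (fun z : 'rV[R]_n * 'rV[R]_n => a (z.2 - z.1 *m O)%R * f z.2)%E.
  apply: emeasurable_funM; last exact: (measurableT_comp mf).
  apply: (measurableT_comp ma); apply: measurable_rVD => //; apply: measurable_rVN.
  exact: (measurableT_comp mO).
rewrite (fubini_tonelli (m1 := L n) (m2 := L n) _ m2)//=; last by move=> z; rewrite mule_ge0.
rewrite -ge0_integralZl//; last exact: integral_ge0.
apply: eq_integral => y _; under eq_integral do rewrite muleC.
rewrite ge0_integralZl//; last first.
  apply: (measurableT_comp ma); apply: measurable_rVD => //.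
  exact: measurable_rVN.
rewrite muleC; congr (_ * _)%E.
rewrite /I -(ge0_integral_rV_translate (- (y *m O^T)) ma a0).
apply: eq_integral => x _; rewrite /a /gaussian; congr (expR (- _))%:E.
rewrite -(dot_mulmx (x - y *m O^T) _ OO) mulmxBl -mulmxA OO' mulmx1.
by rewrite -[in RHS]opprB dotNl dotNr opprK.
Qed.

End lebesgue_rV_integral.

(** * The Plancherel identity and inversion in L^2, in several variables *)

Section plancherel.
Context {R : realType}.
Local Notation mu := (@lebesgue_measure R).
Local Notation T := (measurableTypeR R).
Local Notation Re := complex.Re.
Local Notation Im := complex.Im.
Local Notation L n := (@lebesgue_rV R n).
Implicit Types (n : nat) (s : R).

(** The scale [s] is free: the coefficient is a transform at scale 1/h, and its inversion
    one at scale -1/h. *)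
Definition ft n s (g : 'rV[R]_n -> R[i]) (x : 'rV[R]_n) : R[i] :=
  cintegral (L n) setT (fun y => expi (s * dot x y) * g y).

Lemma cmeasurable_rV_kernel n s : cmeasurable setT (fun z : 'rV[R]_n * 'rV[R]_n => expi (s * dot z.1 z.2)).
Proof. by apply: cmeasurable_expi; apply: measurable_funM => //; exact: measurable_dot. Qed.

Lemma cmeasurable_rV_wave n s (x : 'rV[R]_n) : cmeasurable setT (fun y : 'rV[R]_n => expi (s * dot x y)).
Proof. by apply: cmeasurable_expi; apply: measurable_funM => //; exact: measurable_dot. Qed.

Lemma cintegrable_rV_wave n s (x : 'rV[R]_n) g : cintegrable (L n) setT g ->
  cintegrable (L n) setT (fun y => expi (s * dot x y) * g y).
Proof.
move=> Ig; apply: (cintegrableM_bounded measurableT (cmeasurable_rV_wave s x) Ig (M := 1)) => y _.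
by rewrite cabs_expi.
Qed.

Lemma cmeasurable_ft n s (g : 'rV[R]_n -> R[i]) : cintegrable (L n) setT g -> cmeasurable setT (ft s g).
Proof.
move=> Ig; apply: (cmeasurable_cintegral (L n)
  (F := fun z : 'rV[R]_n * 'rV[R]_n => expi (s * dot z.1 z.2) * g z.2)).
apply: cmeasurableM; first exact: cmeasurable_rV_kernel.
exact: (cmeasurable_comp (cintegrable_measurable Ig) measurable_snd).
Qed.

Lemma cabs_ft n s (g : 'rV[R]_n -> R[i]) : cintegrable (L n) setT g ->
  forall x, cabs (ft s g x) <= Rintegral (L n) setT (fun y => cabs (g y)).
Proof.
move=> Ig x; rewrite -lee_fin /Rintegral fineK; last first.
  exact: (integrable_fin_num _ (integrable_cabs measurableT Ig)).
apply: (le_trans (cabs_cintegral measurableT (cintegrable_rV_wave s x Ig))).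
rewrite le_eqVlt; apply/orP; left; apply/eqP; apply: eq_integral => y _.
by rewrite cabsM cabs_expi mul1r.
Qed.

Lemma ftJ n s (g : 'rV[R]_n -> R[i]) x : cintegrable (L n) setT g ->
  (ft s g x)^* = ft (- s) (fun y => (g y)^*) x.
Proof.
move=> Ig; rewrite /ft -cintegralJ//; last exact: cintegrable_rV_wave.
by apply: eq_cintegral => y _; rewrite rmorphM/= mulNr expiN.
Qed.

Lemma ft_mult n s (u v : 'rV[R]_n -> R[i]) : cintegrable (L n) setT u -> cintegrable (L n) setT v ->
  cintegral (L n) setT (fun x => ft s u x * v x) = cintegral (L n) setT (fun y => u y * ft s v y).
Proof.
move=> Iu Iv; rewrite /ft.
have := multiplication_formula (cmeasurable_rV_kernel n s) (fun=> cabs_expi _) Iu Iv.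
move=> -> /=; apply: eq_cintegral => y _; congr (_ * _).
by apply: eq_cintegral => x _; rewrite dotC.
Qed.

Lemma cintegrable_cons n (g : 'rV[R]_n.+1 -> R[i]) : cintegrable (L n.+1) setT g ->
  cintegrable (mu \x L n)%E setT (fun z => g (rV_cons z)).
Proof.
move=> Ig; have [mg gi] := (cintegrableP _ measurableT _).1 Ig.
apply: cintegrable_prod; first exact: (cmeasurable_comp mg (@measurable_rV_cons R n)).
move: gi; rewrite ge0_integral_rVS//.
- exact/measurable_EFinP/cmeasurable_cabs.
- by move=> x; rewrite lee_fin cabs_ge0.
Qed.

Lemma Rintegral_cons n (f : 'rV[R]_n.+1 -> R) : measurable_fun setT f ->
  (mu \x L n)%E.-integrable setT (fun z => (f (rV_cons z))%:E) ->
  Rintegral (L n.+1) setT f = Rintegral mu setT (fun t => Rintegral (L n) setT (fun y => f (rV_cons (t, y)))).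
Proof.
move=> mf If; rewrite /Rintegral; congr fine.
have IF := integrable_fubini_F If.
rewrite (integral_fine IF) (integral12_prod_meas1 If).
have mfE : measurable_fun setT (EFin \o f) by exact/measurable_EFinP.
have := integral_pushforward (@measurable_rV_cons R n) (mu := (mu \x L n)%E) (D := setT) mfE.
rewrite preimage_setT => h; exact: (h If measurableT).
Qed.

Lemma cintegral_cons n (g : 'rV[R]_n.+1 -> R[i]) : cintegrable (L n.+1) setT g ->
  cintegral (L n.+1) setT g =
  cintegral mu setT (fun t => cintegral (L n) setT (fun y => g (rV_cons (t, y)))).
Proof.
move=> Ig; have [Ir Ii] := cintegrable_cons Ig; have [mr mi] := cintegrable_measurable Ig.
by congr Complex; [exact: (Rintegral_cons mr Ir)|exact: (Rintegral_cons mi Ii)].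
Qed.

Let cabs_sqr_ge0 (z : R[i]) : (0 <= (cabs z ^+ 2)%:E)%E.
Proof. by rewrite lee_fin exprn_ge0// cabs_ge0. Qed.

Lemma ae_lty d (X : measurableType d) (m : {measure set X -> \bar R}) (f : X -> \bar R) :
  measurable_fun setT f -> (forall x, 0 <= f x)%E -> (\int[m]_x f x < +oo)%E ->
  {ae m, forall x, (f x < +oo)%E}.
Proof.
move=> mf f0 fi; have If : m.-integrable setT f.
  apply/integrableP; split => //.
  by under eq_integral do rewrite gee0_abs//.
apply: (ae_imp (integrable_ae measurableT If)) => x /(_ I) ffin.
by rewrite -ge0_fin_numE.
Qed.

(** Transform in the last coordinates and then in the first one ([ft1]); each step
    multiplies the squared norm by 2 pi / |s|. For an integrable function the partial
    transform is a convergent integral for almost every value of the first coordinate, which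
    is enough. *)
Theorem plancherel n s (g : 'rV[R]_n -> R[i]) : s != 0 -> cintegrable (L n) setT g ->
  (\int[L n]_x (cabs (ft s g x) ^+ 2)%:E =
   ((2 * pi / `|s|) ^+ n)%:E * \int[L n]_x (cabs (g x) ^+ 2)%:E)%E.
Proof.
move=> s0; set M := 2 * pi / `|s|.
have M0 : 0 <= M by rewrite divr_ge0// mulr_ge0// pi_ge0.
elim: n g => [|n IHn] g Ig.
  have mg := cintegrable_measurable Ig.
  rewrite expr0 mul1e; apply: eq_integral => x _; congr (cabs _ ^+ 2)%:E.
  have x0 (y : 'rV[R]_0) : y = 0 by apply/rowP => -[].
  rewrite /ft (x0 x); apply: complex_eq.
    rewrite Re_cintegral /Rintegral integral_dirac//.
      by rewrite diracT mul1e /= dotE mul0mx mxE mulr0 expi0 mul1r.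
    apply/measurable_EFinP; exact: (cintegrable_measurable (cintegrable_rV_wave s _ Ig)).1.
  rewrite Im_cintegral /Rintegral integral_dirac//.
    by rewrite diracT mul1e /= dotE mul0mx mxE mulr0 expi0 mul1r.
  apply/measurable_EFinP; exact: (cintegrable_measurable (cintegrable_rV_wave s _ Ig)).2.
have mg := cintegrable_measurable Ig.
have mgc : cmeasurable setT (fun z : T * 'rV[R]_n => g (rV_cons z)).
  exact: (cmeasurable_comp mg (@measurable_rV_cons R n)).
have Igc : (\int[mu]_t \int[L n]_y (cabs (g (rV_cons (t, y))))%:E < +oo)%E.
  have [_] := (cintegrableP _ measurableT _).1 Ig; rewrite ge0_integral_rVS//.
  - exact/measurable_EFinP/cmeasurable_cabs.
  - by move=> x; rewrite lee_fin cabs_ge0.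
pose G t y := g (rV_cons (t, y)).
pose H (z : 'rV[R]_n * T) := ft s (G z.2) z.1.
have mH : cmeasurable setT H.
  apply: (cmeasurable_cintegral (L n)
    (F := fun w : ('rV[R]_n * T) * 'rV[R]_n => expi (s * dot w.1.1 w.2) * g (rV_cons (w.1.2, w.2)))).
  apply: cmeasurableM.
    apply: cmeasurable_expi; apply: measurable_funM => //; apply: measurable_dot => //.
    exact: (measurableT_comp measurable_fst measurable_fst).
  apply: (cmeasurable_comp mgc); apply: measurable_fun_pair => //.
  exact: (measurableT_comp measurable_snd measurable_fst).
have IH x' : cintegrable mu setT (fun t => H (x', t)).
  apply: (cintegrable_fubini (m1 := mu) (m2 := L n)
     (F := fun z => expi (s * dot x' z.2) * g (rV_cons z))).
    apply: cmeasurableM => //; apply: cmeasurable_expi; apply: measurable_funM => //.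
    exact: measurable_dot.
  rewrite (_ : (\int[mu]_t _)%E = (\int[mu]_t \int[L n]_y (cabs (g (rV_cons (t, y))))%:E)%E)//.
  apply: eq_integral => t _; apply: eq_integral => y _.
  by rewrite cabsM cabs_expi mul1r.
have mc : measurable_fun setT (fun z : T * 'rV[R]_n => (cabs (g (rV_cons z)))%:E).
  exact/measurable_EFinP/cmeasurable_cabs.
have aeG : {ae mu, forall t, cintegrable (L n) setT (G t)}.
  have mF : measurable_fun setT (fun t => \int[L n]_y (cabs (g (rV_cons (t, y))))%:E)%E.
    by apply: (measurable_fun_fubini_tonelli_F (m2 := L n) _ mc) => z; rewrite lee_fin cabs_ge0.
  have F0 t : (0 <= \int[L n]_y (cabs (g (rV_cons (t, y))))%:E)%E.
    by apply: integral_ge0 => y _; rewrite lee_fin cabs_ge0.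
  apply: (ae_imp (ae_lty mF F0 Igc)) => t Gt; apply/cintegrableP => //; split => //.
  exact: (cmeasurable_comp mgc (pair1_measurable t)).
have ftE x1 x' : ft s g (rV_cons (x1, x')) = ft1 s (fun t => H (x', t)) x1.
  rewrite {1}/ft cintegral_cons; last exact: cintegrable_rV_wave.
  apply: ae_cintegral => //.
  - apply: (cmeasurable_cintegral (L n)
      (F := fun z : T * 'rV[R]_n => expi (s * dot (rV_cons (x1, x')) (rV_cons z)) * g (rV_cons z))).
    apply: cmeasurableM => //.
    exact: (cmeasurable_comp (cmeasurable_rV_wave s _) (@measurable_rV_cons R n)).
  - exact: (cintegrable_measurable (cintegrable_wave s x1 (IH x'))).
  - apply: (ae_imp aeG) => t IGt _; rewrite /H /ft /=.
    rewrite -cintegralZl//; last exact: cintegrable_rV_wave.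
    by apply: eq_cintegral => y _; rewrite dot_cons /= mulrDr expiD -mulrA.
have mft : cmeasurable setT (fun z : T * 'rV[R]_n => ft s g (rV_cons z)).
  exact: (cmeasurable_comp (cmeasurable_ft s Ig) (@measurable_rV_cons R n)).
rewrite ge0_integral_rVS//; last exact: measurable_cabs_sqr (cmeasurable_ft s Ig).
transitivity (\int[L n]_x' \int[mu]_x1 (cabs (ft s g (rV_cons (x1, x'))) ^+ 2)%:E)%E.
  exact: (fubini_tonelli (m1 := mu) (m2 := L n) _ (measurable_cabs_sqr mft)).
transitivity (\int[L n]_x' (M%:E * \int[mu]_t (cabs (H (x', t)) ^+ 2)%:E))%E.
  apply: eq_integral => x' _; rewrite -plancherel1//.
  by apply: eq_integral => x1 _; rewrite ftE.
have mH2 := measurable_cabs_sqr mH.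
have mHF : measurable_fun setT (fun x' => \int[mu]_t (cabs (H (x', t)) ^+ 2)%:E)%E.
  exact: (measurable_fun_fubini_tonelli_F (m2 := mu) _ mH2).
have mHG : measurable_fun setT (fun t => \int[L n]_x' (cabs (H (x', t)) ^+ 2)%:E)%E.
  exact: (measurable_fun_fubini_tonelli_G (m1 := L n) _ mH2).
have mg2 : measurable_fun setT (fun t => \int[L n]_y (cabs (g (rV_cons (t, y))) ^+ 2)%:E)%E.
  exact: (measurable_fun_fubini_tonelli_F (m2 := L n) _ (measurable_cabs_sqr mgc)).
rewrite ge0_integralZl//; last by move=> x' _; exact: integral_cabs_sqr_ge0.
rewrite ge0_integral_rVS//; last exact: measurable_cabs_sqr.
rewrite exprS (EFinM M) -muleA; congr (_ * _)%E.
transitivity (\int[mu]_t \int[L n]_x' (cabs (H (x', t)) ^+ 2)%:E)%E.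
  exact: (fubini_tonelli (m1 := L n) (m2 := mu) _ mH2).
rewrite -ge0_integralZl//; last 2 first.
- by move=> t _; exact: integral_cabs_sqr_ge0.
- by rewrite lee_fin exprn_ge0.
apply: ge0_ae_eq_integral => //.
- exact: measurable_funeM.
- by move=> t _; exact: integral_cabs_sqr_ge0.
- by move=> t _; rewrite mule_ge0 ?lee_fin ?exprn_ge0//; exact: integral_cabs_sqr_ge0.
- by apply: (ae_imp aeG) => t IGt _; rewrite -IHn.
Qed.

Section inversion.
Variables (n : nat) (s : R) (s0 : s != 0) (g : 'rV[R]_n -> R[i]).
Hypothesis Ig : cintegrable (L n) setT g.
Hypothesis g2 : (\int[L n]_x (cabs (g x) ^+ 2)%:E < +oo)%E.

Let C : R := (2 * pi / `|s|) ^+ n.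

Let C_gt0 : 0 < C.
Proof. by rewrite exprn_gt0// divr_gt0 ?normr_gt0// mulr_gt0// pi_gt0. Qed.

Definition truncate (A : set 'rV[R]_n) (f : 'rV[R]_n -> R[i]) x : R[i] := (\1_A x)%:C * f x.

Lemma cmeasurable_truncate A f : measurable A -> cmeasurable setT f -> cmeasurable setT (truncate A f).
Proof.
by move=> mA mf; apply: cmeasurableM => //; apply: cmeasurable_real; exact: measurable_indic.
Qed.

Lemma cabs_truncate A f x : cabs (truncate A f x) = \1_A x * cabs (f x).
Proof. by rewrite cabsM cabs_real ger0_norm. Qed.

Section error.
Variables (A : set 'rV[R]_n) (mA : measurable A) (Afin : (L n A < +oo)%E).

Let G := ft s g.
Let GA := truncate A G.
Let V := ft (- s) GA.

Let mG : cmeasurable setT G. Proof. exact: cmeasurable_ft. Qed.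

Lemma cintegrable_truncate_ft : cintegrable (L n) setT (truncate A (ft s g)).
Proof.
pose N := Rintegral (L n) setT (fun y => cabs (g y)).
apply: (@le_cintegrable _ _ _ _ _ measurableT _ (fun x => N * \1_A x)).
- exact: cmeasurable_truncate.
- apply: integrable_scale => //; apply: integrable_norm_lty; first exact: measurable_indic.
  under eq_integral do rewrite ger0_norm//.
  by rewrite integral_indic// setIT.
- by move=> x _; rewrite cabs_truncate mulrC ler_wpM2r// cabs_ft.
Qed.

Let IGA : cintegrable (L n) setT GA. Proof. exact: cintegrable_truncate_ft. Qed.

Let mV : cmeasurable setT V. Proof. exact: cmeasurable_ft. Qed.

Let integrable_sqr (f : 'rV[R]_n -> R[i]) : cmeasurable setT f ->
  (\int[L n]_x (cabs (f x) ^+ 2)%:E < +oo)%E -> (L n).-integrable setT (EFin \o (fun x => cabs (f x) ^+ 2)).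
Proof.
move=> mf fi; apply: integrable_norm_lty; first by apply: measurable_funX; exact: cmeasurable_cabs.
by under eq_integral do rewrite ger0_norm ?exprn_ge0 ?cabs_ge0//.
Qed.

Let G2E : (\int[L n]_x (cabs (G x) ^+ 2)%:E = C%:E * \int[L n]_x (cabs (g x) ^+ 2)%:E)%E.
Proof. exact: plancherel. Qed.

Let G2fin : (\int[L n]_x (cabs (G x) ^+ 2)%:E < +oo)%E.
Proof.
rewrite G2E lte_mul_pinfty ?lee_fin ?(ltW C_gt0)//.
Qed.

Let GA2le x : cabs (GA x) ^+ 2 = \1_A x * cabs (G x) ^+ 2.
Proof.
by rewrite cabs_truncate exprMn indicE; case: (_ \in _); rewrite ?expr1n ?expr0n.
Qed.

Let GA2fin : (\int[L n]_x (cabs (GA x) ^+ 2)%:E < +oo)%E.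
Proof.
apply: le_lt_trans G2fin; apply: ge0_le_integral => //.
- exact: measurable_cabs_sqr (cintegrable_measurable IGA).
- exact: measurable_cabs_sqr.
- by move=> x _; rewrite lee_fin GA2le ler_piMl ?exprn_ge0 ?cabs_ge0.
Qed.

Let V2E : (\int[L n]_x (cabs (V x) ^+ 2)%:E = C%:E * \int[L n]_x (cabs (GA x) ^+ 2)%:E)%E.
Proof.
by rewrite /V plancherel ?oppr_eq0// normrN.
Qed.

Let V2fin : (\int[L n]_x (cabs (V x) ^+ 2)%:E < +oo)%E.
Proof. by rewrite V2E lte_mul_pinfty ?lee_fin ?(ltW C_gt0)//. Qed.

Let mg := cintegrable_measurable Ig.

Let IVg : cintegrable (L n) setT (fun y => V y * (g y)^*).
Proof.
by apply: (cintegrableM_bounded measurableT mV (cintegrableJ measurableT Ig)) => x _; exact: cabs_ft.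
Qed.

Let cross : Rintegral (L n) setT (fun y => Re (V y * (g y)^*)) =
  Rintegral (L n) setT (fun x => cabs (GA x) ^+ 2).
Proof.
rewrite -Re_cintegral /V ft_mult//; last exact: cintegrableJ.
rewrite Re_cintegral; apply: eq_Rintegral => x _.
rewrite -ftJ// -/G GA2le /GA /truncate -mulrA [G x * _]mulrC.
have -> : (G x)^* * G x = (cabs (G x) ^+ 2)%:C := mulJc (G x).
by rewrite cReM /= mulr0 subr0.
Qed.

(** Expand the square. By [plancherel], the squares of [g] and of the truncated inverse are
    multiples of the squares of the full and of the truncated transform; by the
    multiplication formula so is the cross term. *)
Lemma inversion_error :
  (\int[L n]_y (cabs (C%:C * g y - V y) ^+ 2)%:E =
   C%:E * \int[L n]_x ((1 - \1_A x) * cabs (G x) ^+ 2)%:E)%E.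
Proof.
have I1 := integrable_sqr mg g2.
have I2 := integrable_sqr mV V2fin.
have I3 := integrable_sqr mG G2fin.
have I4 := integrable_sqr (cintegrable_measurable IGA) GA2fin.
have I5 : (L n).-integrable setT (EFin \o (fun y => Re (V y * (g y)^*))) := IVg.1.
have fineR f : (L n).-integrable setT (EFin \o f) ->
    (\int[L n]_x (f x)%:E)%E = (Rintegral (L n) setT f)%:E.
  by move=> If; rewrite /Rintegral fineK//; exact: integrable_fin_num If.
have J1 := integrable_scale measurableT (C ^+ 2) I1.
have J2 := integrable_scale measurableT (2 * C) I5.
have J3 : (L n).-integrable setT (EFin \o (fun y => cabs (V y) ^+ 2 - 2 * C * Re (V y * (g y)^*))).
  exact: (integrableB _ I2 J2).
have E y : cabs (C%:C * g y - V y) ^+ 2 =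
    C ^+ 2 * cabs (g y) ^+ 2 + (cabs (V y) ^+ 2 - 2 * C * Re (V y * (g y)^*)).
  by rewrite !cabs_sqr !(cReD, cImD, cReN, cImN, cReM, cImM, cReJ, cImJ) /=; ring.
under eq_integral do rewrite E.
rewrite (fineR _ (integrableD measurableT J1 J3)).
have E' x : (1 - \1_A x) * cabs (G x) ^+ 2 = cabs (G x) ^+ 2 - cabs (GA x) ^+ 2.
  by rewrite GA2le mulrBl mul1r.
under [in RHS]eq_integral do rewrite E'.
rewrite (fineR _ (integrableB measurableT I3 I4)) -EFinM; congr EFin.
rewrite RintegralD// RintegralB// RintegralB// !RintegralZl// cross.
have -> : Rintegral (L n) setT (fun x => cabs (V x) ^+ 2) =
    C * Rintegral (L n) setT (fun x => cabs (GA x) ^+ 2).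
  by apply: EFin_inj; rewrite EFinM -!fineR// V2E.
have -> : Rintegral (L n) setT (fun x => cabs (G x) ^+ 2) =
    C * Rintegral (L n) setT (fun x => cabs (g x) ^+ 2).
  by apply: EFin_inj; rewrite EFinM -!fineR// G2E.
ring.
Qed.

End error.

Definition eball (r : R) : set 'rV[R]_n := [set x | enorm x <= r].

Lemma measurable_eball r : measurable (eball r).
Proof.
rewrite -[X in measurable X]setTI (_ : eball r = @enorm R n @^-1` `]-oo, r]).
  by apply: measurable_enorm.
by apply/seteqP; split => x /=; rewrite /eball/= in_itv.
Qed.

Lemma lebesgue_eball_fin r : (L n (eball r) < +oo)%E.
Proof.
rewrite -[X in L n X]setIT -integral_indic//; last exact: measurable_eball.
apply: (@le_lt_trans _ _ (\int[L n]_x ((expR (r ^+ 2))%:E * (gaussian x)%:E))%E); last first.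
  rewrite ge0_integralZl//.
  - by rewrite integral_gaussian -EFinM ltry.
  - by apply/measurable_EFinP; exact: measurable_gaussian.
  - by move=> x _; rewrite lee_fin gaussian_ge0.
apply: ge0_le_integral => //.
- by apply/measurable_EFinP; apply: measurable_indic; exact: measurable_eball.
- by apply: measurable_funeM; apply/measurable_EFinP; exact: measurable_gaussian.
- move=> x _; rewrite -EFinM lee_fin indicE /gaussian -expRD.
  have [xr|xr] := boolP (x \in eball r); last exact: expR_ge0.
  rewrite -[leLHS]expR0 ler_expR subr_ge0 -enorm_sqr.
  by move: xr; rewrite inE /eball /= => xr; rewrite ler_pXn2r ?nnegrE ?enorm_ge0// (le_trans (enorm_ge0 x)).
Qed.

(** By [inversion_error] the error is the mass of the transform outside the ball of radius
    [r]; it decreases to 0 by dominated convergence. *)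
Theorem fourier_inversion_L2 :
  (\int[L n]_y (cabs (C%:C * g y - ft (- s) (truncate (eball r) (ft s g)) y) ^+ 2)%:E)%E
    @[r --> +oo] --> 0%E.
Proof.
have mG := cmeasurable_ft s Ig.
pose e r := (\int[L n]_x ((1 - \1_(eball r) x) * cabs (ft s g x) ^+ 2)%:E)%E.
under eq_fun do rewrite (inversion_error (measurable_eball _) (lebesgue_eball_fin _)) -/(e _).
suff : (C%:E * e r)%E @[r --> +oo] --> (C%:E * 0)%E by rewrite mule0.
apply: cvgeZl => //.
have mi r : measurable_fun setT (fun x => (1 - \1_(eball r) x) * cabs (ft s g x) ^+ 2).
  apply: measurable_funM; last by apply: measurable_funX; exact: cmeasurable_cabs.
  by apply: measurable_funB => //; apply: measurable_indic; exact: measurable_eball.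
have i0 r x : 0 <= 1 - \1_(eball r) x :> R by rewrite subr_ge0 indicE; case: (_ \in _).
have i1 r x : 1 - \1_(eball r) x <= 1 :> R by rewrite gerBl indicE.
have f0 r x : 0 <= (1 - \1_(eball r) x) * cabs (ft s g x) ^+ 2.
  by rewrite mulr_ge0// exprn_ge0// cabs_ge0.
have e0 r : (0 <= e r)%E by apply: integral_ge0 => x _; rewrite lee_fin.
have mono r r' : r <= r' -> (e r' <= e r)%E.
  move=> rr; apply: ge0_le_integral => //.
  - by move=> x _; rewrite lee_fin.
  - exact/measurable_EFinP.
  - exact/measurable_EFinP.
  - move=> x _; rewrite lee_fin ler_wpM2r ?exprn_ge0 ?cabs_ge0// lerD2l lerN2 !indicE.
    have [xr|//] := boolP (x \in eball r); rewrite mem_set//.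
    by move: xr; rewrite inE /eball/= => xr; exact: le_trans rr.
have G2fin : (\int[L n]_x (cabs (ft s g x) ^+ 2)%:E < +oo)%E.
  by rewrite plancherel// lte_mul_pinfty ?lee_fin ?(ltW C_gt0).
have en : e k%:R @[k --> \oo] --> 0%E.
  have [] := @dominated_convergence _ _ R (L n) setT measurableT
    (fun k x => ((1 - \1_(eball k%:R) x) * cabs (ft s g x) ^+ 2)%:E)
    (cst 0%E) (fun x => (cabs (ft s g x) ^+ 2)%:E).
  - by move=> k; exact/measurable_EFinP.
  - exact: measurable_cst.
  - apply: aeW => x _; apply: cvg_near_cst; near=> k.
    rewrite indicE mem_set ?subrr ?mul0r// /eball /=; near: k.
    exact: nbhs_infty_ger.
  - apply: integrable_norm_lty; first by apply: measurable_funX; exact: cmeasurable_cabs.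
    by under eq_integral do rewrite ger0_norm ?exprn_ge0 ?cabs_ge0//.
  - apply: aeW => x k _; rewrite /= lee_fin ger0_norm//.
    by rewrite ler_piMl ?exprn_ge0 ?cabs_ge0.
  - by move=> _ _; rewrite integral0.
have efin r : e r \is a fin_num.
  rewrite ge0_fin_numE//; apply: le_lt_trans G2fin; apply: ge0_le_integral => //.
  - by move=> x _; rewrite lee_fin.
  - exact/measurable_EFinP.
  - exact: measurable_cabs_sqr.
  - by move=> x _; rewrite lee_fin ler_piMl ?exprn_ge0 ?cabs_ge0.
apply/fine_cvgP; split; first exact: nearW.
apply/cvgrPdist_lt => eps eps0.
have /fine_cvgP[_ /cvgrPdist_lt /(_ eps eps0) [k _ /(_ k (leqnn k))]] := en.
rewrite /= !sub0r !normrN !ger0_norm ?fine_ge0// => ek.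
near=> r; rewrite sub0r normrN ger0_norm ?fine_ge0//.
apply: le_lt_trans ek; apply: fine_le => //; apply: mono; near: r.
exact: nbhs_pinfty_ge.
Unshelve. all: by end_near. Qed.

End inversion.

End plancherel.

(** * Surface measure in graph coordinates *)

Lemma measurable_fun_inv d (X : measurableType d) (R : realType) (f : X -> R) :
  measurable_fun setT f -> measurable_fun setT (fun x => (f x)^-1).
Proof.
move=> mf; rewrite (_ : (fun _ => _) = fun x => f x * (f x ^+ 2) `^ (-1)).
  apply: measurable_funM => //.
  by apply: (measurableT_comp (measurable_powR (-1))); exact: measurable_funX.
apply/funext => x; rewrite powR_inv1 ?sqr_ge0//.
by have [->|fx0] := eqVneq (f x) 0; [rewrite invr0 mul0r|field].
Qed.

Lemma measurable_fun_sqrt d (X : measurableType d) (R : realType) (f : X -> R) :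
  measurable_fun setT f -> measurable_fun setT (fun x => Num.sqrt (f x)).
Proof.
move=> mf; apply: (@measurableT_comp _ _ _ _ _ _ (@Num.sqrt R)) => //.
exact: (continuous_measurable_fun (@sqrt_continuous R)).
Qed.

Section frames.
Context {R : realType}.
Variable n : nat.
Implicit Types xi : 'rV[R]_n.+1.

Lemma sphere_dot xi : sphere xi -> dot xi xi = 1.
Proof. by rewrite /sphere /= => h; rewrite -enorm_sqr h expr1n. Qed.

Lemma frame_of_orthogonal (O : 'M[R]_n.+1) : O *m O^T = 1%:M ->
  orth_frames (row ord0 O) (row' ord0 O).
Proof.
move=> OO.
have OE i j : \sum_k O i k * O j k = (i == j)%:R.
  have := congr1 (fun M : 'M[R]_n.+1 => M i j) OO; rewrite !mxE => <-.
  by apply: eq_bigr => k _; rewrite !mxE.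
split; apply/matrixP => i j; rewrite !mxE.
  rewrite -(inj_eq (@lift_inj _ ord0)) -OE.
  by apply: eq_bigr => k _; rewrite !mxE.
transitivity ((lift ord0 i == ord0)%:R : R); last by [].
rewrite -OE.
by apply: eq_bigr => k _; rewrite !mxE.
Qed.

(** The Householder reflection that exchanges [xi] and the first basis vector. *)
Lemma orthogonal_with_row xi : sphere xi ->
  exists2 O : 'M[R]_n.+1, O *m O^T = 1%:M & row ord0 O = xi.
Proof.
move=> /sphere_dot xi1.
pose e0 : 'rV[R]_n.+1 := delta_mx ord0 ord0.
have dote0 (x : 'rV[R]_n.+1) : dot e0 x = x ord0 ord0.
  rewrite /dot (bigD1 ord0)//= big1 => [|i i0]; last by rewrite mxE (negbTE i0) mul0r.
  by rewrite mxE !eqxx mul1r addr0.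
pose v := e0 - xi.
have vv : dot v v = 2 * (1 - xi ord0 ord0).
  rewrite /v dotDl !dotDr !dotNl !dotNr xi1 (dotC xi e0) !dote0 mxE !eqxx.
  by rewrite /=; ring.
have v0 : v ord0 ord0 = 1 - xi ord0 ord0 by rewrite !mxE !eqxx.
have [vv0|vvn0] := eqVneq (dot v v) 0.
  have /subr0_eq exi : v = 0 by exact: dot_eq0.
  exists 1%:M; first by rewrite trmx1 mulmx1.
  by rewrite row1 -exi.
pose H : 'M[R]_n.+1 := 1%:M - (2 / dot v v) *: (v^T *m v).
have HT : H^T = H by rewrite /H linearB/= trmx1 linearZ/= trmx_mul trmxK.
exists H.
  rewrite HT.
  have : (v^T *m v) *m (v^T *m v) = dot v v *: (v^T *m v).
    rewrite mulmxA -(mulmxA v^T) (_ : v *m v^T = (dot v v)%:M); last first.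
      by apply/matrixP => i j; rewrite !ord1 dotE [RHS]mxE eqxx mulr1n.
    by rewrite mul_mx_scalar -scalemxAl.
  rewrite /H; move: (v^T *m v) (dot v v) vvn0 => W q q0 WW.
  rewrite mulmxBl mul1mx mulmxBr mulmx1 -scalemxAl -scalemxAr WW.
  by rewrite !scalerA; apply/matrixP => i j; rewrite !mxE; field.
apply/rowP => j; rewrite !mxE big_ord_recl big_ord0 addr0 !mxE.
have := v0; have := vv; rewrite /v !mxE !eqxx /= => E1 E2.
have x0 : 1 - xi ord0 ord0 != 0.
  by apply: contraNneq vvn0 => E; rewrite vv E mulr0.
rewrite E1 (eq_sym j); have [<-|j0] := eqVneq ord0 j => /=; field => //.
Qed.

(** The other rows of an orthogonal matrix with first row [xi] form a frame. *)
Lemma orth_frameP xi : sphere xi -> orth_frames xi (orth_frame xi).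
Proof.
move=> /orthogonal_with_row[M MM <-].
exact: (getPex (ex_intro _ _ (frame_of_orthogonal MM))).
Qed.

End frames.

Lemma ge0_integral_mrestr d (T : measurableType d) (R : realType)
    (m : {measure set T -> \bar R}) (D : set T) (mD : measurable D) (f : T -> \bar R) :
  measurable_fun setT f -> (forall x, 0 <= f x)%E ->
  (\int[mrestr m mD]_x f x = \int[m]_x ((\1_D x)%:E * f x))%E.
Proof.
move=> mf f0; have mi : measurable_fun setT (\1_D : T -> R) by exact: measurable_indic.
have i0 x : 0 <= \1_D x :> R by rewrite indicE.
transitivity (\int[density_measure m mi i0]_x f x)%E.
  apply: eq_measure_integral => A mA _.
  transitivity (m (A `&` D)); first by [].
  transitivity (\int[m]_(x in A) (\1_D x)%:E)%E; last by [].
  by rewrite (integral_indic _ mA mD) setIC.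
rewrite integral_density//.
by apply: eq_integral => x _; rewrite muleC.
Qed.

Section sphere_integral.
Context {R : realType}.
Variable n : nat.
Local Notation mu := (@lebesgue_measure R).
Local Notation T := (measurableTypeR R).
Local Notation L := (@lebesgue_rV R n).
Local Notation S := (@sphere R n.+1).
Local Notation sigma := (@sphere_measure R n.+1).
Local Notation V := ('rV[R]_n.+1).

Lemma measurable_sphere : measurable S.
Proof.
rewrite -[X in measurable X]setTI (_ : S = @enorm R n.+1 @^-1` [set 1]) //.
by apply: measurable_enorm => //.
Qed.

Local Notation ball1 := [set x : V | enorm x <= 1].

Lemma ge0_integral_sphereT (F : V -> \bar R) : measurable_fun setT F -> (forall w, 0 <= F w)%E ->
  (\int[sigma]_w F w =
   n.+1%:R%:E * \int[@lebesgue_rV R n.+1]_x ((\1_ball1 x)%:E * F (normalize x)))%E.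
Proof.
move=> mF F0.
pose m1 := image_measure (mrestr (lebesgue_rV n.+1) (@measurable_unit_ball R n.+1))
  (@measurable_normalize R n.+1).
transitivity (n.+1%:R%:E * \int[m1]_w F w)%E.
  exact: (@ge0_integral_mscale _ _ R m1 setT measurableT (n.+1%:R%:nng) F mF (fun x _ => F0 x)).
congr (_ * _)%E.
have := ge0_integral_pushforward (@measurable_normalize R n.+1)
  (mrestr (lebesgue_rV n.+1) (@measurable_unit_ball R n.+1)) measurableT mF (fun y _ => F0 y).
rewrite preimage_setT => E.
transitivity (\int[mrestr (lebesgue_rV n.+1) (@measurable_unit_ball R n.+1)]_x (F \o @normalize R n.+1) x)%E.
  exact: E.
exact (@ge0_integral_mrestr _ _ R (@lebesgue_rV R n.+1) ball1 (@measurable_unit_ball R n.+1)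
  (F \o @normalize R n.+1) (measurableT_comp mF (@measurable_normalize R n.+1)) (fun x => F0 _)).
Qed.

Section graph.
Variables (xi : V) (B : 'M[R]_(n, n.+1)).
Hypotheses (Sxi : sphere xi) (frB : orth_frames xi B).

Let xi1 : dot xi xi = 1. Proof. exact: sphere_dot. Qed.

Let dot_xi y : dot (y *m B) xi = 0.
Proof. by rewrite dotE -mulmxA frB.2 mulmx0 mxE. Qed.

Let dot_B y z : dot (y *m B) (z *m B) = dot y z.
Proof. exact: dot_mulmx frB.1. Qed.

Let dot_split t y : dot (t *: xi + y *m B) (t *: xi + y *m B) = t ^+ 2 + dot y y.
Proof.
rewrite dotDl !dotDr !dotZl !dotZr xi1 dot_B dot_xi (dotC xi) dot_xi.
by rewrite !mulr0 addr0 add0r mulr1 expr2.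
Qed.

Let O : 'M[R]_n.+1 := col_mx xi B.

Let OO : O *m O^T = 1%:M.
Proof.
rewrite /O; apply: etrans (_ : col_mx xi B *m (col_mx xi B)^T = 1%:M) => //.
rewrite tr_col_mx mul_col_row frB.1 frB.2.
have -> : xi *m B^T = 0 by rewrite -[LHS]trmxK trmx_mul trmxK frB.2 trmx0.
have -> : xi *m xi^T = 1%:M by apply/matrixP => i j; rewrite !ord1 -dotE xi1 mxE eqxx.
by rewrite -scalar_mx_block.
Qed.

Let consO (t : T) y : rV_cons (t, y) *m O = t *: xi + y *m B.
Proof. rewrite /rV_cons /O; transitivity ((t : R)%:M *m xi + y *m B); last by rewrite mul_scalar_mx.
exact: (@mul_row_col R 1 1 n n.+1 (t : R)%:M y xi B). Qed.

Definition height (y : 'rV[R]_n) : R := Num.sqrt (1 - dot y y).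

Definition graph_point (y : 'rV[R]_n) : V := height y *: xi + y *m B.

Variable F : V -> \bar R.
Hypotheses (mF : measurable_fun setT F) (F0 : forall w, (0 <= F w)%E).
Hypothesis Fxi : forall w, dot w xi <= 0 -> F w = 0%E.

(* The integrand in the variables (radius, y). *)
Let k (z : T * 'rV[R]_n) : \bar R :=
  ((\1_`]0, 1]%classic z.1 * (z.1 / Num.sqrt (z.1 ^+ 2 - dot z.2 z.2)))%:E *
   F (z.1^-1 *: (Num.sqrt (z.1 ^+ 2 - dot z.2 z.2) *: xi + z.2 *m B)%R))%E.

Let k0 z : (0 <= k z)%E.
Proof.
rewrite /k mule_ge0// lee_fin; have [h|h] := boolP (z.1 \in `]0, 1]%classic).
  by rewrite mulr_ge0 ?divr_ge0 ?sqrtr_ge0//; move: h; rewrite inE/= in_itv/= => /andP[/ltW].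
by rewrite indicE (negbTE h) mul0r.
Qed.

Let mk : measurable_fun setT k.
Proof.
have ms : measurable_fun setT (fun z : T * 'rV[R]_n => Num.sqrt (z.1 ^+ 2 - dot z.2 z.2)).
  apply: measurable_fun_sqrt; apply: measurable_funB; first exact: measurable_funX.
  exact: measurable_dot.
apply: emeasurable_funM.
  apply/measurable_EFinP; apply: measurable_funM.
    by apply: (@measurableT_comp _ _ _ _ _ _ (\1_`]0, 1]%classic : T -> R)) => //; exact: measurable_indic.
  by apply: measurable_funM => //; exact: measurable_fun_inv.
apply: (measurableT_comp mF); apply: measurable_rVZ; first exact: measurable_fun_inv.
apply: measurable_rVD; first by apply: measurable_rVZ.
by apply: (measurableT_comp (measurable_mulmxr B)).
Qed.

Let Phi (x : V) : \bar R := ((\1_ball1 x)%:E * F (normalize x))%E.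

Let line y : (\int[mu]_t Phi (t *: xi + y *m B)%R = \int[mu]_r k (r, y))%E.
Proof.
have PhiE t : 0 < t -> Phi (t *: xi + y *m B) =
    ((if Num.sqrt (t ^+ 2 + dot y y) <= 1 then 1 else 0)%:E *
     F ((Num.sqrt (t ^+ 2 + dot y y))^-1 *: (t *: xi + y *m B)))%E.
  move=> t0; rewrite /Phi /normalize {2}/enorm dot_split; congr (_%:E * _)%E.
  rewrite indicE; have -> : (t *: xi + y *m B \in ball1) = (Num.sqrt (t ^+ 2 + dot y y) <= 1).
    by apply/idP/idP; rewrite inE /= /enorm dot_split.
  by case: ifP.
have PhiN t : t <= 0 -> Phi (t *: xi + y *m B) = 0%E.
  move=> t0; rewrite /Phi Fxi ?mule0// /normalize dotZl dotDl dotZl dot_xi xi1 addr0 mulr1.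
  by rewrite mulr_ge0_le0// invr_ge0 enorm_ge0.
have kE r : 0 < r -> k (r, y) = ((if r <= 1 then r / Num.sqrt (r ^+ 2 - dot y y) else 0)%:E *
    F (r^-1 *: (Num.sqrt (r ^+ 2 - dot y y) *: xi + y *m B)))%E.
  move=> r0; rewrite /k /= indicE mem_setE/= in_itv/= r0 /=.
  by case: ifP; rewrite ?mul1r ?mul0r.
have kN r : r <= 0 -> k (r, y) = 0%E.
  move=> r0; rewrite /k /= indicE mem_setE/= in_itv/= ltNge r0 /=.
  by rewrite mul0r mul0e.
have [y0|yn0] := eqVneq (dot y y) 0.
  apply: eq_integral => t _; have [t0|t0] := leP t 0; first by rewrite PhiN// kN.
  rewrite PhiE// kE// y0 addr0 subr0 sqrtr_sqr gtr0_norm// divff// gt_eqF//.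
have b0 : 0 < enorm y by rewrite sqrtr_gt0 lt_neqAle eq_sym yn0 dot_ge0.
have mky : measurable_fun setT (fun r : T => k (r, y)) by exact: (measurableT_comp mk (pair2_measurable y)).
transitivity (\int[mu]_(r in `]enorm y, +oo[) k (r, y))%E; last first.
  rewrite integral_mkcond; apply: eq_integral => r _; rewrite patchE; case: ifPn => //.
  rewrite notin_setE /= in_itv/= andbT => /negP; rewrite -leNgt => ry.
  have [r0|r0] := leP r 0; first by rewrite kN.
  rewrite kE// ler0_sqrtr ?invr0 ?mulr0; last first.
    by rewrite subr_le0 -enorm_sqr ler_pXn2r ?nnegrE ?enorm_ge0// ltW.
  by case: ifP => _; rewrite mul0e.
rewrite (ge0_integral_sqrt b0 mky (fun r => k0 _)) integral_mkcond [RHS]integral_mkcond.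
apply: eq_integral => t _; rewrite !patchE.
rewrite mem_setT; case: ifPn; last first.
  by rewrite notin_setE /= in_itv/= andbT => /negP; rewrite -leNgt => /PhiN.
rewrite inE/= in_itv/= andbT => t0.
rewrite PhiE// enorm_sqr; set r := Num.sqrt _.
have r2 : 0 < t ^+ 2 + dot y y by rewrite ltr_pwDl ?exprn_gt0// dot_ge0.
have r0 : 0 < r by rewrite sqrtr_gt0.
rewrite kE// sqr_sqrtr ?(ltW r2)// addrK sqrtr_sqr gtr0_norm//.
rewrite muleAC -EFinM; congr (_%:E * _)%E; case: ifP => _; rewrite ?mul0r//.
by field; rewrite !gt_eqF.
Qed.

Let slice (r : T) : (\int[L]_y k (r, y) = (\1_`]0%R, 1%R]%classic r * r ^+ n)%:E *
  \int[L]_y (((height y)^-1)%:E * F (graph_point y)))%E.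
Proof.
have [h|h] := boolP (r \in `]0, 1]%classic); last first.
  rewrite indicE (negbTE h) mul0r mul0e integral0_eq// => y _.
  by rewrite /k /= indicE (negbTE h) mul0r mul0e.
have r0 : 0 < r by move: h; rewrite inE/= in_itv/= => /andP[].
have mkr : measurable_fun setT (fun y => k (r, y)) by exact: (measurableT_comp mk (pair1_measurable r)).
have := ge0_integral_rV_affine 0 (lt0r_neq0 r0) mkr (fun y => k0 _).
rewrite gtr0_norm// => /(congr1 (fun t => (r ^+ n)%:E * t)%E).
rewrite muleA -EFinM divff ?expf_neq0 ?gt_eqF// mul1e => <-.
rewrite indicE h mul1r; congr (_ * _)%E; apply: eq_integral => y _.
rewrite addr0 /k /= indicE h mul1r dotZl dotZr.
have -> : r ^+ 2 - r * (r * dot y y) = r ^+ 2 * (1 - dot y y) by ring.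
rewrite sqrtrM ?sqr_ge0// sqrtr_sqr gtr0_norm// -/(height y); congr (_%:E * F _)%E.
  by rewrite invfM mulrA divff ?mul1r// gt_eqF.
rewrite -scalemxAl -scalerA -scalerDr scalerA mulVf ?scale1r// gt_eqF//.
Qed.

(** Integrate over the cone that defines surface measure. On the line over [y] parallel to
    [xi] substitute the radius r = sqrt (t^2 + |y|^2) for t, exchange the integrals, and
    scale y by r in the slice of radius r: every slice gives the same integral over the
    graph, and the remaining radial factor integrates to 1. *)
Lemma ge0_integral_graph :
  (\int[sigma]_w F w = \int[L]_y (((height y)^-1)%:E * F (graph_point y)))%E.
Proof.
rewrite ge0_integral_sphereT//.
have mPhi : measurable_fun setT Phi.
  apply: emeasurable_funM; last exact: (measurableT_comp mF (@measurable_normalize R n.+1)).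
  by apply/measurable_EFinP; apply: measurable_indic; exact: measurable_unit_ball.
have Phi0 x : (0 <= Phi x)%E by rewrite mule_ge0// lee_fin.
rewrite -/(\int[lebesgue_rV n.+1]_x Phi x)%E -(ge0_integral_rV_orthogonal OO mPhi Phi0).
have mPhiO : measurable_fun setT (fun x => Phi (x *m O)) by exact: (measurableT_comp mPhi (measurable_mulmxr O)).
rewrite ge0_integral_rVS//.
have mPc := measurableT_comp mPhiO (@measurable_rV_cons R n).
transitivity (n.+1%:R%:E * \int[L]_y \int[mu]_t Phi (rV_cons (t, y) *m O)%R)%E.
  congr (_ * _)%E; exact: (fubini_tonelli (m1 := mu) (m2 := L) _ mPc (fun z => Phi0 _)).
under eq_integral => y _ do (under eq_integral => t _ do rewrite consO; rewrite line).
rewrite -(fubini_tonelli (m1 := mu) (m2 := L) _ mk k0).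
under eq_integral do rewrite slice.
set J := (\int[L]_y _)%E.
have J0 : (0 <= J)%E.
  by apply: integral_ge0 => y _; rewrite mule_ge0// lee_fin invr_ge0 sqrtr_ge0.
rewrite ge0_integralZr//; last 2 first.
- apply/measurable_EFinP; apply: measurable_funM; last exact: measurable_funX.
  exact: measurable_indic.
- move=> r _; rewrite lee_fin; have [h|h] := boolP (r \in `]0, 1]%classic).
    by rewrite mulr_ge0// exprn_ge0//; move: h; rewrite inE/= in_itv/= => /andP[/ltW].
  by rewrite indicE (negbTE h) mul0r.
rewrite muleA; suff -> : (n.+1%:R%:E * \int[mu]_x (\1_(`]0%R, 1%R]%classic : set T) x * x ^+ n)%:E = 1)%E by rewrite mul1e.
transitivity (n.+1%:R%:E * \int[mu]_(r in `[0%R, 1%R]) (r ^+ n)%:E)%E.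
  congr (_ * _)%E; rewrite -integral_itv_obnd_cbnd; last first.
    by apply/measurable_EFinP; apply: measurable_funTS; exact: measurable_funX.
  rewrite [RHS]integral_mkcond; apply: eq_integral => r _; rewrite patchE indicE.
  by case: ifP; rewrite ?mul1r ?mul0r.
rewrite (@continuous_FTC2 _ (fun r => r ^+ n) (fun r => r ^+ n.+1 / n.+1%:R) 0 1)//.
- rewrite expr1n expr0n /= mul0r sube0 -EFinM mul1r divff//.
- by apply: continuous_subspaceT => x; exact: exprn_continuous.
- split.
  + by move=> x _; apply: derivableM; [exact: exprn_derivable|exact: derivable_cst].
  + by apply: cvg_at_right_filter; apply: cvgM; [exact: exprn_continuous|exact: cvg_cst].
  + by apply: cvg_at_left_filter; apply: cvgM; [exact: exprn_continuous|exact: cvg_cst].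
- move=> x _; rewrite (_ : (fun r : R => _) = (n.+1%:R)^-1 \*: (fun r : R => r ^+ n.+1)); last first.
    by apply/funext => r /=; rewrite mulrC.
  rewrite derive1E deriveZ/=; last exact: exprn_derivable.
  by rewrite exp_derive /GRing.scale /=; field; rewrite addrC natr1 pnatr_eq0.
Qed.

End graph.

End sphere_integral.

(** * The normalizing integral *)

Section profile.
Context {R : realType}.
Variables (chi : R -> R) (n : nat).
Hypotheses (chi_smooth : smooth chi) (chi_range : forall r, 0 <= chi r <= 1).
Hypotheses (chi_one : forall r, r <= 1 / 2 -> chi r = 1).
Hypotheses (chi_zero : forall r, 3 / 4 <= r -> chi r = 0).
Local Notation L := (@lebesgue_rV R n).

(** The amplitude of a Gaussian state as a function of the distance to its centre. *)
Definition profile (h t : R) : R := chi (t / h `^ (3^-1)) * expR (- (t ^+ 2 / (2 * h))).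

Lemma measurable_cutoff : measurable_fun setT chi.
Proof.
apply: continuous_measurable_fun => t; apply: differentiable_continuous.
have := @chi_smooth 0%N t; rewrite /derive1n /= => H.
exact/derivable1_diffP.
Qed.

Lemma measurable_profile h : measurable_fun setT (profile h).
Proof.
apply: measurable_funM.
  by apply: (measurableT_comp measurable_cutoff); exact: measurable_funM.
apply: measurableT_comp => //; apply: measurableT_comp => //.
by apply: measurable_funM => //; exact: measurable_funX.
Qed.

Lemma profile_ge0 h t : 0 <= profile h t.
Proof. by rewrite mulr_ge0 ?expR_ge0//; case/andP: (chi_range (t / h `^ (3^-1))). Qed.

Lemma profile_le h t : profile h t <= expR (- (t ^+ 2 / (2 * h))).
Proof. by rewrite ler_piMl ?expR_ge0//; case/andP: (chi_range (t / h `^ (3^-1))). Qed.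

Lemma profile_le1 h t : 0 < h -> profile h t <= 1.
Proof.
move=> h0; apply: (le_trans (profile_le h t)).
by rewrite -expR0 ler_expR oppr_le0 divr_ge0 ?sqr_ge0// mulr_ge0// ltW.
Qed.

Lemma profile_eq0 h t : 0 < h -> h < 1 -> 3 / 4 <= t -> profile h t = 0.
Proof.
move=> h0 h1 t34; rewrite /profile chi_zero ?mul0r//.
have k0 : 0 < h `^ 3^-1 by rewrite powR_gt0.
have k1 : h `^ 3^-1 <= 1.
  apply: (@le_trans _ _ (1 `^ (3^-1))); last by rewrite powR1.
  by rewrite ge0_ler_powR ?nnegrE ?invr_ge0// ltW.
by rewrite ler_pdivlMr//; apply: le_trans t34; rewrite ler_piMr.
Qed.

Lemma height_ge0 (y : 'rV[R]_n) : 0 <= height y. Proof. exact: sqrtr_ge0. Qed.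

Lemma height_sqr (y : 'rV[R]_n) : dot y y <= 1 -> height y ^+ 2 = 1 - dot y y.
Proof. by move=> y1; rewrite sqr_sqrtr// subr_ge0. Qed.

Lemma height_le1 (y : 'rV[R]_n) : height y <= 1.
Proof. by rewrite -[leRHS]sqrtr1 ler_wsqrtr// gerBl dot_ge0. Qed.

Lemma measurable_height : measurable_fun setT (@height R n).
Proof.
apply: measurable_fun_sqrt; apply: measurable_funB => //.
exact: (measurable_dot (f := id) (g := id)).
Qed.

(** The squared amplitude divided by [w . xi] and by the Jacobian [height y], at the graph
    point over [y]: there [w . xi] is [height y], and the squared chord is [2 - 2 * height
    y]. *)
Definition overlap (h : R) (y : 'rV[R]_n) : R :=
  profile h (Num.sqrt (2 - 2 * height y)) ^+ 2 / height y ^+ 2.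

Lemma overlap_ge0 h y : 0 <= overlap h y.
Proof. by rewrite divr_ge0 ?sqr_ge0. Qed.

Lemma measurable_overlap h : measurable_fun setT (overlap h).
Proof.
have mh := measurable_height.
apply: measurable_funM.
  apply: measurable_funX; apply: (measurableT_comp (measurable_profile h)).
  apply: measurable_fun_sqrt; apply: measurable_funB => //.
  exact: measurable_funM.
by apply: measurable_fun_inv; exact: measurable_funX.
Qed.

(** On the support of the cutoff the chord is below 3/4, so [height y] is above 1/2 and the
    denominator costs a factor 4; and the squared chord is at least [dot y y]. *)
Lemma overlap_le h (y : 'rV[R]_n) : 0 < h -> h < 1 ->
  overlap h y <= 4 * expR (- (dot y y / h)).
Proof.
move=> h0 h1; rewrite /overlap; set q := height y; set r := Num.sqrt _.
have q0 : 0 <= q by exact: height_ge0.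
have q1 : q <= 1 by exact: height_le1.
have r2 : r ^+ 2 = 2 - 2 * q by rewrite sqr_sqrtr//; lra.
have [r34|r34] := leP (3 / 4) r.
  by rewrite profile_eq0// expr0n mul0r mulr_ge0 ?expR_ge0.
have [y1|y1] := leP (dot y y) 1; last first.
  rewrite /q /height ler0_sqrtr ?subr_le0 ?(ltW y1)// expr0n invr0 mulr0.
  by rewrite mulr_ge0 ?expR_ge0.
have q2 : q ^+ 2 = 1 - dot y y by exact: height_sqr.
have q12 : 1 / 2 <= q.
  have : r ^+ 2 <= (3 / 4) ^+ 2 by rewrite ler_pXn2r ?nnegrE ?sqrtr_ge0// ltW.
  by rewrite r2; lra.
rewrite mulrC; apply: ler_pM; rewrite ?invr_ge0 ?sqr_ge0//.
  rewrite -(invrK 4) lef_pV2 ?posrE ?exprn_gt0//; [nra|lra].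
apply: (@le_trans _ _ (expR (- (r ^+ 2 / (2 * h))) ^+ 2)).
  by rewrite ler_pXn2r ?nnegrE ?profile_ge0 ?expR_ge0// profile_le.
rewrite -expRM_natl ler_expR mulrN lerN2.
rewrite (_ : 2 * (r ^+ 2 / _) = r ^+ 2 / h); last by field; rewrite gt_eqF.
rewrite ler_pM2r ?invr_gt0// r2 -[dot y y](opprK) -[- dot y y](addKr 1) -q2.
nra.
Qed.

Lemma overlap_scaled_le h (u : 'rV[R]_n) : 0 < h -> h < 1 ->
  overlap h (Num.sqrt h *: u) <= 4 * gaussian u.
Proof.
move=> h0 h1; apply: (le_trans (overlap_le _ h0 h1)).
rewrite dotZl dotZr mulrA -expr2 sqr_sqrtr ?(ltW h0)// mulrAC divff ?gt_eqF// mul1r//.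
Qed.

(** The threshold makes [h * a] small enough for the point to lie over the unit ball, and
    the chord, whose square is at most [2 * h * a], shorter than half the cutoff radius. *)
Lemma overlap_scaledE h (u : 'rV[R]_n) (a := dot u u) : 0 < h -> h < ((1 + 8 * a)^-1) ^+ 3 ->
  overlap h (Num.sqrt h *: u) =
  expR (- (2 * a / (1 + Num.sqrt (1 - h * a)))) / Num.sqrt (1 - h * a) ^+ 2.
Proof.
move=> h0; set b := (_^-1) => hb.
have a0 : 0 <= a by exact: dot_ge0.
have b0 : 0 < b by rewrite invr_gt0; lra.
have ab : 8 * a * b <= 1.
  by rewrite /b ler_pdivrMr ?mul1r; lra.
have b1 : b <= 1 by rewrite invf_le1; lra.
have hb1 : h <= b by apply: (le_trans (ltW hb)); rewrite exprS ler_piMr ?exprn_ile1// ltW.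
have ha : h * a <= 1 / 8 by nra.
have sh : Num.sqrt h ^+ 2 = h by rewrite sqr_sqrtr// ltW.
rewrite /overlap /height dotZl dotZr mulrA -expr2 sh -/a.
set q := Num.sqrt (1 - h * a).
have q2 : q ^+ 2 = 1 - h * a by rewrite sqr_sqrtr; lra.
have q0 : 0 <= q by exact: sqrtr_ge0.
have q1 : q <= 1.
  by rewrite -[leRHS]sqrtr1 ler_wsqrtr// gerBl mulr_ge0// ltW.
have qa : 2 - 2 * q = 2 * (h * a) / (1 + q).
  by have -> : h * a = 1 - q ^+ 2 by [lra|]; field; lra.
set k := h `^ 3^-1.
have k0 : 0 < k by rewrite powR_gt0.
have k3 : k ^+ 3 = h.
  rewrite -powR_mulrn ?ltW// -powRrM mulVf ?powRr1// ltW//.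
have kb : k <= b.
  rewrite -(@ler_pXn2r _ 3) ?nnegrE// ?(ltW k0) ?(ltW b0)// k3; exact: ltW.
rewrite /profile chi_one ?mul1r; last first.
  rewrite -/k ler_pdivrMr// -[leRHS]gtr0_norm; last by lra.
  rewrite -sqrtr_sqr ler_wsqrtr// qa.
  rewrite ler_pdivrMr; last by lra.
  rewrite -k3; have : a * k <= 1 / 8 by nra.
  move=> ak; rewrite exprMn.
  apply: (@le_trans _ _ (2 * (1 / 8) * k ^+ 2)); first by nra.
  by rewrite (_ : 2^-1 ^+ 2 = 1 / 4 :> R); [nra|field].
rewrite -expRM_natl mulrN sqr_sqrtr; last by lra.
congr (expR (- _) / _); rewrite qa; field.
by rewrite gt_eqF//=; lra.
Qed.

Lemma overlap_scaled_cvg (u : 'rV[R]_n) (h_ : R^nat) : (forall k, 0 < h_ k) -> h_ @ \oo --> (0 : R) ->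
  overlap (h_ k) (Num.sqrt (h_ k) *: u) @[k --> \oo] --> gaussian u.
Proof.
move=> hp h0; set a := dot u u.
have a0 : 0 <= a by exact: dot_ge0.
pose q k := Num.sqrt (1 - h_ k * a).
have q1 : q @ \oo --> (1 : R).
  rewrite -[X in _ --> X]sqrtr1; apply: continuous_cvg; first exact: sqrt_continuous.
  rewrite -[X in _ --> X]subr0 -[X in 1 - X](mul0r a).
  by apply: cvgB; [exact: cvg_cst|apply: cvgM => //; exact: cvg_cst].
have lim : expR (- (2 * a / (1 + q k))) / q k ^+ 2 @[k --> \oo] --> gaussian u.
  rewrite /gaussian -/a (_ : expR (- a) = expR (- (2 * a / (1 + 1))) / (1 * 1)); last first.
    by rewrite mul1r divr1; congr (expR (- _)); field.
  under eq_fun do rewrite expr2.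
  apply: cvgM; last by apply: cvgV; [rewrite mul1r oner_neq0|exact: cvgM].
  apply: continuous_cvg; first exact: continuous_expR.
  apply: cvgN; apply: cvgM; first exact: cvg_cst.
  by apply: cvgV; [rewrite gt_eqF|apply: cvgD => //; exact: cvg_cst].
apply: cvg_trans lim; apply: near_eq_cvg.
have b0 : 0 < ((1 + 8 * a)^-1) ^+ 3 by rewrite exprn_gt0// invr_gt0; lra.
near=> k; apply/esym; apply: overlap_scaledE => //.
by near: k; exact: (cvgr_lt _ h0).
Unshelve. all: by end_near. Qed.

Definition normalizer (h : R) : \bar R := (\int[L]_y (overlap h y)%:E)%E.

Lemma normalizerE h : 0 < h ->
  normalizer h = ((Num.sqrt h ^+ n)%:E * \int[L]_u (overlap h (Num.sqrt h *: u))%:E)%E.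
Proof.
move=> h0; have r0 : 0 < Num.sqrt h by rewrite sqrtr_gt0.
have mo : measurable_fun setT (fun y => (overlap h y)%:E).
  by apply/measurable_EFinP; exact: measurable_overlap.
have o0 y : (0 <= (overlap h y)%:E)%E by rewrite lee_fin overlap_ge0.
have := ge0_integral_rV_affine 0 (lt0r_neq0 r0) mo o0.
under eq_integral do rewrite addr0.
move=> ->; rewrite gtr0_norm// muleA -EFinM divff ?mul1e//.
by rewrite expf_neq0// gt_eqF.
Qed.

Lemma overlap_scaled_integral_cvg (h_ : R^nat) :
  (forall k, 0 < h_ k) -> (forall k, h_ k < 1) -> h_ @ \oo --> (0 : R) ->
  (\int[L]_u (overlap (h_ k) (Num.sqrt (h_ k) *: u))%:E)%E @[k --> \oo] --> (Num.sqrt pi ^+ n)%:E.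
Proof.
move=> hp h1 h0.
have mo k : measurable_fun setT (fun u : 'rV[R]_n => (overlap (h_ k) (Num.sqrt (h_ k) *: u))%:E).
  apply/measurable_EFinP; apply: (measurableT_comp (measurable_overlap (h_ k))).
  exact: (measurable_rVZ (a := fun=> Num.sqrt (h_ k)) (f := id)).
have mg : measurable_fun setT (fun u : 'rV[R]_n => (gaussian u)%:E).
  by apply/measurable_EFinP; exact: measurable_gaussian.
have I4 : L.-integrable setT (fun u => (4 * gaussian u)%:E).
  apply: (@integrable_scale _ _ R L setT measurableT 4 (@gaussian R n)); apply: integrable_norm_lty => //.
    exact: measurable_gaussian.
  under eq_integral do rewrite ger0_norm ?gaussian_ge0//.
  by rewrite integral_gaussian ltry.
have pw u : (overlap (h_ k) (Num.sqrt (h_ k) *: u))%:E @[k --> \oo] --> (gaussian u)%:E.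
  by apply: cvg_EFin; [exact: nearW|exact: overlap_scaled_cvg].
have bd u k : (`|(overlap (h_ k) (Num.sqrt (h_ k) *: u))%:E| <= (4 * gaussian u)%:E)%E.
  by rewrite gee0_abs lee_fin ?overlap_ge0// overlap_scaled_le.
have [_ _] := @dominated_convergence _ _ R L setT measurableT
  (fun k u => (overlap (h_ k) (Num.sqrt (h_ k) *: u))%:E) (fun u => (gaussian u)%:E)
  (fun u => (4 * gaussian u)%:E) mo mg (aeW _ (fun u _ => pw u)) I4 (aeW _ (fun u k _ => bd u k)).
by rewrite integral_gaussian.
Qed.

Lemma overlap_scaled_fin_num h : 0 < h -> h < 1 ->
  (\int[L]_u (overlap h (Num.sqrt h *: u))%:E)%E \is a fin_num.
Proof.
move=> h0 h1.
rewrite ge0_fin_numE; last by apply: integral_ge0 => u _; rewrite lee_fin overlap_ge0.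
apply: (@le_lt_trans _ _ (\int[L]_u (4 * gaussian u)%:E)%E).
  apply: ge0_le_integral => //.
  - by move=> u _; rewrite lee_fin overlap_ge0.
  - apply/measurable_EFinP; apply: (measurableT_comp (measurable_overlap h)).
    exact: (measurable_rVZ (a := fun=> Num.sqrt h) (f := id)).
  - by apply/measurable_EFinP; apply: measurable_funM => //; exact: measurable_gaussian.
  - by move=> u _; rewrite lee_fin overlap_scaled_le.
under eq_integral do rewrite EFinM.
rewrite ge0_integralZl//; last 2 first.
- by apply/measurable_EFinP; exact: measurable_gaussian.
- by move=> u _; rewrite lee_fin gaussian_ge0.
by rewrite integral_gaussian -EFinM ltry.
Qed.

Lemma normalizer_fin_num h : 0 < h -> h < 1 -> normalizer h \is a fin_num.
Proof. by move=> h0 h1; rewrite normalizerE// fin_numM// overlap_scaled_fin_num. Qed.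

(** Dominated convergence along sequences, the bound being [overlap_scaled_le]. *)
Lemma normalizer_cvg :
  (fine (normalizer h) / Num.sqrt h ^+ n) @[h --> 0^'+] --> Num.sqrt (pi : R) ^+ n.
Proof.
apply/cvg_at_rightP => h_ [hp h0].
have [N _ hN] : \forall k \near \oo, h_ k < 1 by exact: (cvgr_lt _ h0).
have hN1 k : h_ (k + N)%N < 1 by apply: hN; rewrite /= leq_addl.
rewrite -(cvg_shiftn N).
have E k : fine (normalizer (h_ (k + N)%N)) / Num.sqrt (h_ (k + N)%N) ^+ n =
    fine (\int[L]_u (overlap (h_ (k + N)%N) (Num.sqrt (h_ (k + N)%N) *: u))%:E)%E.
  have r0 : Num.sqrt (h_ (k + N)%N) ^+ n != 0 by rewrite expf_neq0// sqrtr_eq0 -ltNge.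
  by rewrite normalizerE// fineM ?overlap_scaled_fin_num//= mulrAC divff ?mul1r.
under eq_fun do rewrite E.
apply: fine_cvg; apply: (overlap_scaled_integral_cvg (h_ := fun k => h_ (k + N)%N)) => //.
by rewrite (cvg_shiftn N).
Qed.

End profile.

(** * The reproducing constant *)

Section constant.
Context {R : realType}.
Variables (chi : R -> R) (n : nat).
Hypotheses (chi_smooth : smooth chi) (chi_range : forall r, 0 <= chi r <= 1).
Hypotheses (chi_one : forall r, r <= 1 / 2 -> chi r = 1).
Hypotheses (chi_zero : forall r, 3 / 4 <= r -> chi r = 0).

Let K (h : R) : R := fine (normalizer chi n h).

Definition reproducing_constant (h : R) : R := ((2 * pi * h) ^+ n * K h)^-1.

Let K_cvg : (K h / Num.sqrt h ^+ n) @[h --> 0^'+] --> Num.sqrt (pi : R) ^+ n.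
Proof. exact: normalizer_cvg. Qed.

Let l_gt0 : 0 < Num.sqrt (pi : R) ^+ n.
Proof. by rewrite exprn_gt0// sqrtr_gt0 pi_gt0. Qed.

Lemma normalizer_gt0 : \forall h \near 0^'+, 0 < fine (normalizer chi n h).
Proof.
near=> h.
have h0 : 0 < h by near: h; exact: nbhs_right_gt.
have : 0 < K h / Num.sqrt h ^+ n by near: h; exact: (cvgr_gt _ K_cvg).
by rewrite pmulr_lgt0// invr_gt0 exprn_gt0// sqrtr_gt0.
Unshelve. all: by end_near. Qed.

Let target (h : R) : R := 2 `^ ((n.+1%:R - 1) / 2) * (2 * pi * h) `^ (- (3 * (n.+1%:R - 1) / 2)).

Let targetE h : 0 < h -> target h = ((2 * pi * h) ^+ n * (Num.sqrt h ^+ n * Num.sqrt pi ^+ n))^-1.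
Proof.
move=> h0; have p0 : 0 < 2 * pi * h by rewrite !mulr_gt0// pi_gt0.
have n1 : n.+1%:R - 1 = n%:R :> R by rewrite -natr1 addrK.
rewrite /target !n1 powRN.
have -> : n%:R / 2 = 2^-1 * n%:R :> R by rewrite mulrC.
have -> : 3 * n%:R / 2 = 2^-1 * (3 * n)%:R :> R by rewrite natrM mulrC.
rewrite !powRrM !powR12_sqrt ?(ltW p0)// !powR_mulrn ?sqrtr_ge0//.
rewrite exprM (exprS (Num.sqrt _)) sqr_sqrtr ?(ltW p0)//.
rewrite -[2 * pi * h]mulrA !sqrtrM ?pi_ge0// !exprMn.
have s2 : Num.sqrt 2 ^+ n != 0 :> R by rewrite expf_neq0// gt_eqF// sqrtr_gt0.
have sp : Num.sqrt pi ^+ n != 0 :> R by rewrite gt_eqF.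
have sh : Num.sqrt h ^+ n != 0 :> R by rewrite expf_neq0// gt_eqF// sqrtr_gt0.
have h' : h ^+ n != 0 by rewrite expf_neq0// gt_eqF.
have p' : pi ^+ n != 0 :> R by rewrite expf_neq0// gt_eqF// pi_gt0.
have t' : 2 ^+ n != 0 :> R by rewrite expf_neq0.
by field; rewrite t' p' h' sh sp s2.
Qed.

(** The quotient of the two sides is the quotient of [normalizer_cvg] and its limit. *)
Lemma reproducing_constant_equiv : reproducing_constant ~_(0^'+) target.
Proof.
apply/eqaddoP => _/posnumP[e]; near=> h.
have h0 : 0 < h by near: h; exact: nbhs_right_gt.
have K0 : 0 < K h by near: h; exact: normalizer_gt0.
have s0 : 0 < Num.sqrt h ^+ n by rewrite exprn_gt0// sqrtr_gt0.
have p0 : 0 < (2 * pi * h) ^+ n by rewrite exprn_gt0// !mulr_gt0// pi_gt0.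
rewrite /= fctE /=.
have -> : reproducing_constant h = target h * (Num.sqrt pi ^+ n / (K h / Num.sqrt h ^+ n)).
  by rewrite targetE// /reproducing_constant; field; rewrite !gt_eqF.
rewrite -[X in _ - X]mulr1 -mulrBr normrM mulrC ler_wpM2r//.
near: h.
have : (Num.sqrt pi ^+ n / (K h / Num.sqrt h ^+ n)) @[h --> 0^'+] --> (1 : R).
  rewrite -[X in _ --> X](divff (lt0r_neq0 l_gt0)); apply: cvgM; first exact: cvg_cst.
  by apply: cvgV => //; rewrite gt_eqF.
move=> /cvgrPdist_le/(_ e%:num (gt0 e)) lim; near=> h; rewrite distrC; near: h.
exact: lim.
Unshelve. all: by end_near. Qed.

End constant.

Section transfer.
Context d1 d2 (T1 : measurableType d1) (T2 : measurableType d2) (R : realType).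
Variables (m1 : {measure set T1 -> \bar R}) (m2 : {measure set T2 -> \bar R}).
Variables (D Z : set T1) (phi : T2 -> T1) (k : T2 -> R).
Hypothesis k0 : forall y, 0 <= k y.
Hypothesis tr : forall F : T1 -> \bar R, measurable_fun D F ->
  (forall x, D x -> 0 <= F x)%E -> (forall x, D x -> Z x -> F x = 0%E) ->
  (\int[m1]_(x in D) F x = \int[m2]_y ((k y)%:E * F (phi y)))%E.

(** Positive and negative parts satisfy the change of variables separately. *)
Lemma Rintegral_transfer (u : T1 -> R) : measurable_fun D u ->
  (forall x, D x -> Z x -> u x = 0) ->
  Rintegral m1 D u = Rintegral m2 setT (fun y => k y * u (phi y)).
Proof.
move=> mu uZ; rewrite /Rintegral; congr fine; rewrite integralE [RHS]integralE.
have mu' : measurable_fun D (EFin \o u) by exact/measurable_EFinP.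
congr (_ - _)%E.
  rewrite tr.
  - apply: eq_integral => y _; rewrite !funeposE /= -!EFin_max -EFinM.
    by rewrite maxr_pMr// mulr0.
  - exact: measurable_funepos.
  - by move=> x _; rewrite funepos_ge0.
  - by move=> x Dx Zx; rewrite funeposE /= uZ// maxxx.
rewrite tr.
- apply: eq_integral => y _; rewrite !funenegE /= -!EFin_max -EFinM.
  by rewrite maxr_pMr// mulr0 mulrN.
- exact: measurable_funeneg.
- by move=> x _; rewrite funeneg_ge0.
- by move=> x Dx Zx; rewrite funenegE /= uZ// oppr0 maxxx.
Qed.

Lemma cintegral_transfer (f : T1 -> R[i]) : cmeasurable D f ->
  (forall x, D x -> Z x -> f x = 0) ->
  cintegral m1 D f = cintegral m2 setT (fun y => (k y)%:C * f (phi y)).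
Proof.
move=> [mRe mIm] fZ; apply: complex_eq.
  rewrite Re_cintegral Re_cintegral (Rintegral_transfer mRe); last first.
    by move=> x Dx Zx; rewrite fZ.
  by apply: eq_Rintegral => y _; rewrite partsE mul0r subr0.
rewrite Im_cintegral Im_cintegral (Rintegral_transfer mIm); last first.
  by move=> x Dx Zx; rewrite fZ.
by apply: eq_Rintegral => y _; rewrite partsE mul0r addr0.
Qed.

End transfer.

Section graph_coordinates.
Context {R : realType}.
Variable n : nat.
Local Notation L := (@lebesgue_rV R n).
Local Notation S := (@sphere R n.+1).
Local Notation sigma := (@sphere_measure R n.+1).
Local Notation V := ('rV[R]_n.+1).

Lemma enorm_sub_sphere (w xi : V) : S w -> S xi -> enorm (w - xi) = Num.sqrt (2 - 2 * dot w xi).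
Proof.
move=> Sw Sxi; rewrite /enorm; congr Num.sqrt.
rewrite dotDl !dotDr !dotNl !dotNr (sphere_dot Sw) (sphere_dot Sxi) (dotC xi w); ring.
Qed.

Variables (xi : V) (B : 'M[R]_(n, n.+1)).
Hypotheses (Sxi : S xi) (frB : orth_frames xi B).

Let xi1 : dot xi xi = 1. Proof. exact: sphere_dot. Qed.

Let xiBT : xi *m B^T = 0.
Proof. by rewrite -[LHS]trmxK trmx_mul trmxK frB.2 trmx0. Qed.

Lemma dot_frame y : dot (y *m B) xi = 0.
Proof. by rewrite dotE -mulmxA frB.2 mulmx0 mxE. Qed.

Lemma orth_frame_mul y : orth xi (y *m B).
Proof. exact: dot_frame. Qed.

Lemma frameK (y : 'rV[R]_n) : y *m B *m B^T = y.
Proof. by rewrite -mulmxA frB.1 mulmx1. Qed.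

(** An orthogonal matrix has orthonormal columns as well as rows. *)
Lemma frame_orth_proj w : w *m B^T *m B = orth_proj xi w.
Proof.
pose O : 'M[R]_(1 + n) := col_mx xi B.
have OO : O *m O^T = 1%:M.
  rewrite /O tr_col_mx mul_col_row frB.1 frB.2 xiBT.
  have -> : xi *m xi^T = 1%:M by apply/matrixP => i j; rewrite !ord1 -dotE xi1 mxE eqxx.
  by rewrite -scalar_mx_block.
have : O^T *m O = 1%:M by exact: mulmx1C.
rewrite /O tr_col_mx mul_row_col => /(congr1 (fun M : 'M[R]_n.+1 => w *m M)).
rewrite mulmxDr mulmx1 !mulmxA.
have -> : w *m xi^T = (dot w xi)%:M.
  by apply/matrixP => i j; rewrite !ord1 -dotE mxE eqxx.
by rewrite mul_scalar_mx /orth_proj => E; rewrite -[X in X - _]E addrAC subrr add0r.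
Qed.

Lemma orth_frame_proj v : orth xi v -> v *m B^T *m B = v.
Proof. by move=> ov; rewrite frame_orth_proj /orth_proj ov scale0r subr0. Qed.

Lemma dot_graph_point y : dot (graph_point xi B y) xi = height y.
Proof. by rewrite dotDl dotZl xi1 dot_frame mulr1 addr0. Qed.

Lemma graph_pointK y : graph_point xi B y *m B^T = y.
Proof. by rewrite mulmxDl -scalemxAl xiBT scaler0 add0r frameK. Qed.

Lemma orth_proj_graph y : orth_proj xi (graph_point xi B y) = y *m B.
Proof. by rewrite -frame_orth_proj graph_pointK. Qed.

Lemma sphere_graph_point y : height y != 0 -> S (graph_point xi B y).
Proof.
move=> hy; have y1 : dot y y <= 1.
  by rewrite leNgt; apply: contra hy => y1; rewrite /height ler0_sqrtr// subr_le0 ltW.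
rewrite /sphere /= /enorm dotDl !dotDr !dotZl !dotZr xi1 (dotC xi) dot_frame.
rewrite (dot_mulmx _ _ frB.1) !mulr0 addr0 add0r mulr1 -expr2 height_sqr//.
by rewrite subrK sqrtr1.
Qed.

Lemma graph_point_sphere w : S w -> 0 <= dot w xi -> graph_point xi B (w *m B^T) = w.
Proof.
move=> Sw w0; rewrite /graph_point frame_orth_proj.
suff -> : height (w *m B^T) = dot w xi by rewrite /orth_proj addrC subrK.
rewrite /height -(dot_mulmx _ _ frB.1) frame_orth_proj /orth_proj.
rewrite dotDl !dotDr !dotNl !dotNr !dotZl !dotZr (sphere_dot Sw) xi1 (dotC xi w).
by rewrite -[RHS]ger0_norm// -sqrtr_sqr; congr Num.sqrt; ring.
Qed.

Lemma measurable_graph_point : measurable_fun setT (graph_point xi B).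
Proof.
apply: measurable_rVD; last exact: measurable_mulmxr.
by apply: measurable_rVZ => //; exact: measurable_height.
Qed.

(** For functions known on the sphere only: extend by 0, and use that the Jacobian vanishes
    where the graph point leaves the sphere. *)
Lemma ge0_integral_sphere_graph (F : V -> \bar R) : measurable_fun S F ->
  (forall w, S w -> 0 <= F w)%E -> (forall w, S w -> dot w xi <= 0 -> F w = 0%E) ->
  (\int[sigma]_(w in S) F w = \int[L]_y (((height y)^-1)%:E * F (graph_point xi B y)))%E.
Proof.
move=> mF F0 Fxi; rewrite integral_mkcond (ge0_integral_graph Sxi frB).
- apply: eq_integral => y _; have [->|hy] := eqVneq (height y) 0.
    by rewrite invr0 !mul0e.
  by rewrite patchE mem_set//; exact: sphere_graph_point.
- by apply/(measurable_restrictT _ _).1 => //; exact: measurable_sphere.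
- by move=> w; rewrite patchE; case: ifPn => // /set_mem/F0.
- by move=> w wxi; rewrite patchE; case: ifPn => // /set_mem Sw; exact: Fxi.
Qed.

Lemma cintegral_sphere_graph (f : V -> R[i]) : cmeasurable S f ->
  (forall w, S w -> dot w xi <= 0 -> f w = 0) ->
  cintegral sigma S f =
  cintegral L setT (fun y => ((height y)^-1)%:C * f (graph_point xi B y)).
Proof.
move=> mf fxi; apply: (cintegral_transfer (Z := [set w | dot w xi <= 0])) => //.
  by move=> y; rewrite invr_ge0 height_ge0.
exact: ge0_integral_sphere_graph.
Qed.

End graph_coordinates.

Section hyperplane.
Context {R : realType}.
Variable n : nat.
Local Notation L := (@lebesgue_rV R n).
Local Notation V := ('rV[R]_n.+1).
Variable xi : V.
Hypothesis Sxi : sphere xi.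
Let B : 'M[R]_(n, n.+1) := orth_frame xi.
Let frB : orth_frames xi B. Proof. exact: orth_frameP. Qed.

Lemma measurable_orth : measurable (orth xi).
Proof.
rewrite -[X in measurable X]setTI (_ : orth xi = (fun x => dot x xi) @^-1` [set 0]) //.
by apply: (measurable_dot (f := id) (g := fun=> xi)).
Qed.

Lemma ge0_integral_orth (F : V -> \bar R) : measurable_fun (orth xi) F ->
  (forall x, orth xi x -> 0 <= F x)%E ->
  (\int[orth_lebesgue xi]_(x in orth xi) F x = \int[L]_y F (y *m B))%E.
Proof.
move=> mF F0; rewrite integral_mkcond.
have mG : measurable_fun setT (F \_ (orth xi)).
  by apply/(measurable_restrictT _ _).1 => //; exact: measurable_orth.
have G0 x : (0 <= (F \_ (orth xi)) x)%E by rewrite patchE; case: ifPn => // /set_mem/F0.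
transitivity (\int[L]_y ((F \_ (orth xi)) \o (fun y => y *m B)) y)%E.
  exact: (ge0_integral_pushforward (measurable_mulmxr B) L measurableT mG (fun y _ => G0 y)).
by apply: eq_integral => y _; rewrite /= patchE mem_set//; exact: (orth_frame_mul frB).
Qed.

Lemma cintegral_orth (f : V -> R[i]) : cmeasurable (orth xi) f ->
  cintegral (orth_lebesgue xi) (orth xi) f = cintegral L setT (fun y => f (y *m B)).
Proof.
move=> mf; rewrite (cintegral_transfer (D := orth xi) (Z := set0) (m2 := L)
  (phi := fun y => y *m B) (k := fun=> 1))//.
  by apply: eq_cintegral => y _; rewrite mul1r.
move=> F mF F0 _; rewrite ge0_integral_orth//.
by apply: eq_integral => y _; rewrite mul1e.
Qed.

(** A function on the hyperplane is its expression in the frame, composed with the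
    coordinate map. *)
Lemma cmeasurable_orth (f : V -> R[i]) (g : 'rV[R]_n -> R[i]) : cmeasurable setT g ->
  (forall y, f (y *m B) = g y) -> cmeasurable (orth xi) f.
Proof.
move=> mg fg; have E v : v \in orth xi -> g (v *m B^T) = f v.
  by move=> /set_mem ov; rewrite -fg (orth_frame_proj Sxi frB).
have [mR mI] := cmeasurable_comp mg (measurable_mulmxr B^T).
by split; [move: (measurable_funTS mR : measurable_fun (orth xi) _)
          |move: (measurable_funTS mI : measurable_fun (orth xi) _)];
  apply: eq_measurable_fun => v /E <-.
Qed.

Lemma sqnorm_L2_orth (f : V -> R[i]) (g : 'rV[R]_n -> R[i]) : cmeasurable setT g ->
  (forall y, f (y *m B) = g y) ->
  sqnorm_L2 (orth_lebesgue xi) (orth xi) f = sqnorm_L2 L setT g.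
Proof.
move=> mg fg; have mf := cmeasurable_orth mg fg.
rewrite /sqnorm_L2 ge0_integral_orth//.
- by apply: eq_integral => y _; rewrite fg.
- exact: measurable_cabs_sqr.
- by move=> x _; rewrite lee_fin sqr_ge0.
Qed.

End hyperplane.

(** * The fiber over a point of the sphere *)

Section set_integrals.
Context d (T : measurableType d) (R : realType) (m : {measure set T -> \bar R}).

Lemma cintegral_setI (D A : set T) (f : T -> R[i]) :
  cintegral m (D `&` A) f = cintegral m D (fun x => (\1_A x)%:C * f x).
Proof.
apply: complex_eq.
  rewrite Re_cintegral Re_cintegral /Rintegral integral_mkcondr; congr fine.
  apply: eq_integral => x _; rewrite patchE partsE mul0r subr0 indicE.
  by case: (x \in A); rewrite ?mul1r ?mul0r.
rewrite Im_cintegral Im_cintegral /Rintegral integral_mkcondr; congr fine.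
apply: eq_integral => x _; rewrite patchE partsE mul0r addr0 indicE.
by case: (x \in A); rewrite ?mul1r ?mul0r.
Qed.

Lemma cmeasurable_restr (D : set T) (f : T -> R[i]) : cmeasurable setT f -> cmeasurable D f.
Proof. by move=> [mR mI]; split; exact: measurable_funTS. Qed.

(** From (a + b)^2 <= 2 a^2 + 2 b^2; the constant 2 is harmless where the right side tends
    to 0. *)
Lemma sqnorm_L2_triangle (D : set T) (mD : measurable D) (f g t : T -> R[i]) :
  cmeasurable D f -> cmeasurable D g -> cmeasurable D t ->
  (sqnorm_L2 m D (fun x => f x - g x)%R <=
   2%:E * sqnorm_L2 m D (fun x => f x - t x)%R + 2%:E * sqnorm_L2 m D (fun x => g x - t x)%R)%E.
Proof.
move=> mf mg mt; have m1 := measurable_cabs_sqr (cmeasurableB mf mt).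
have m2 := measurable_cabs_sqr (cmeasurableB mg mt).
have c0 (z : R[i]) : (0 <= (cabs z ^+ 2)%:E)%E by rewrite lee_fin sqr_ge0.
rewrite /sqnorm_L2 -!ge0_integralZl//.
rewrite -ge0_integralD//; last 4 first.
- by move=> x _; rewrite mule_ge0.
- exact: emeasurable_funM.
- by move=> x _; rewrite mule_ge0.
- exact: emeasurable_funM.
apply: ge0_le_integral => //.
- exact: measurable_cabs_sqr (cmeasurableB mf mg).
- by apply: emeasurable_funD; exact: emeasurable_funM.
- move=> x _; rewrite -!EFinM -EFinD lee_fin.
  have := cabsD (f x - t x) (- (g x - t x)); rewrite cabsN.
  have -> : f x - t x + - (g x - t x) = f x - g x by ring.
  move=> H; have a0 := cabs_ge0 (f x - t x); have b0 := cabs_ge0 (g x - t x).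
  have d0 := cabs_ge0 (f x - g x).
  have : cabs (f x - g x) ^+ 2 <= (cabs (f x - t x) + cabs (g x - t x)) ^+ 2.
    by rewrite ler_pXn2r ?nnegrE// addr_ge0.
  move: (cabs (f x - t x)) (cabs (g x - t x)) (cabs (f x - g x)) => a b c.
  by have := sqr_ge0 (a - b); nra.
Qed.

End set_integrals.

Section sphere_finite.
Context {R : realType}.
Variable n : nat.
Local Notation S := (@sphere R n.+1).
Local Notation sigma := (@sphere_measure R n.+1).
Local Notation V := ('rV[R]_n.+1).

(** The cone over the whole sphere is the unit ball. *)
Lemma sphere_measure_fin : (sigma setT < +oo)%E.
Proof.
have -> : sigma setT = (\int[sigma]_w 1)%E by rewrite integral_cst// mul1e.
rewrite ge0_integral_sphereT//; under eq_integral do rewrite mule1.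
rewrite integral_indic//; last exact: measurable_unit_ball.
rewrite setIT lte_mul_pinfty ?lee_fin//; exact: (@lebesgue_eball_fin R n.+1 1).
Qed.

Lemma sphere_measure_S_fin : (sigma S < +oo)%E.
Proof.
apply: le_lt_trans sphere_measure_fin; apply: le_measure; rewrite ?inE//.
exact: measurable_sphere.
Qed.

End sphere_finite.

Section amplitude.
Context {R : realType}.
Variables (chi : R -> R) (n : nat).
Hypotheses (chi_smooth : smooth chi) (chi_range : forall r, 0 <= chi r <= 1).
Hypotheses (chi_zero : forall r, 3 / 4 <= r -> chi r = 0).
Variables (h : R) (h0 : 0 < h) (h1 : h < 1).
Local Notation S := (@sphere R n.+1).
Local Notation V := ('rV[R]_n.+1).
Local Notation amp := (amplitude chi h).
Implicit Types xi w : V.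

Lemma amplitude_sphere xi w : S xi -> S w ->
  amp xi w = profile chi h (Num.sqrt (2 - 2 * dot w xi)).
Proof. by move=> Sxi Sw; rewrite /amplitude enorm_sub_sphere. Qed.

Lemma amplitudeC xi w : amp xi w = amp w xi.
Proof. by rewrite /amplitude -opprB -scaleN1r enormZ normrN1 mul1r. Qed.

Lemma amplitude_ge0 xi w : 0 <= amp xi w. Proof. exact: profile_ge0. Qed.

Lemma amplitude_le1 xi w : amp xi w <= 1. Proof. exact: profile_le1. Qed.

Lemma amplitude_far xi w : S xi -> S w -> dot w xi <= 1 / 2 -> amp xi w = 0.
Proof.
move=> Sxi Sw wxi; rewrite amplitude_sphere// profile_eq0//.
apply: (@le_trans _ _ 1); first lra.
by rewrite -[leLHS]sqrtr1 ler_wsqrtr//; lra.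
Qed.

Lemma measurable_amplitude d (X : measurableType d) (u v : X -> V) :
  measurable_fun setT u -> measurable_fun setT v ->
  measurable_fun setT (fun x => amp (u x) (v x)).
Proof.
move=> mu mv; apply: (measurableT_comp (measurable_profile chi_smooth h)).
apply: (measurableT_comp (@measurable_enorm R n.+1)).
by apply: measurable_rVD => //; exact: measurable_rVN.
Qed.

End amplitude.

Section fiber.
Context {R : realType}.
Variables (chi : R -> R) (n : nat).
Hypotheses (chi_smooth : smooth chi) (chi_range : forall r, 0 <= chi r <= 1).
Hypotheses (chi_zero : forall r, 3 / 4 <= r -> chi r = 0).
Variables (h : R) (h0 : 0 < h) (h1 : h < 1).
Local Notation L := (@lebesgue_rV R n).
Local Notation S := (@sphere R n.+1).
Local Notation sigma := (@sphere_measure R n.+1).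
Local Notation V := ('rV[R]_n.+1).
Local Notation amp := (amplitude chi h).
Variables (f : V -> R[i]) (mf : cmeasurable setT f) (f2 : (sqnorm_L2 sigma S f < +oo)%E).
Variables (xi : V) (Sxi : S xi).
Local Notation B := (orth_frame xi : 'M[R]_(n, n.+1)).
Let frB : orth_frames xi B. Proof. exact: orth_frameP. Qed.
Local Notation gp := (graph_point xi B).
Let mgp := measurable_graph_point xi B.
Let mS := @measurable_sphere R n.

Let mamp : measurable_fun setT (amp xi).
Proof. exact: (measurable_amplitude chi_smooth h (u := fun=> xi) (v := id)). Qed.

(** The function whose Fourier transform is the coefficient: in graph coordinates around
    [xi] it is amplitude times [f], with the Jacobian of surface measure absorbed. *)
Definition fiber_density (y : 'rV[R]_n) : R[i] :=
  ((height y)^-1 * amp xi (gp y))%:C * f (gp y).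
Local Notation g := fiber_density.

Let amp_far w : S w -> dot w xi <= 1 / 2 -> amp xi w = 0.
Proof. by move=> Sw; exact: amplitude_far. Qed.

Let amp_neg w : S w -> dot w xi <= 0 -> amp xi w = 0.
Proof. by move=> Sw w0; apply: amp_far => //; lra. Qed.

Lemma coefficient_frame x : coefficient chi h f xi (x *m B) = ft h^-1 g x.
Proof.
rewrite /coefficient (cintegral_sphere_graph Sxi frB); last 2 first.
- apply: cmeasurable_restr; apply: cmeasurableM => //; apply: cmeasurableJ.
  apply: cmeasurableM; first exact: cmeasurable_real.
  apply: cmeasurable_expi; apply: measurableT_comp => //; apply: measurable_funM => //.
  exact: (measurable_dot (f := fun=> x *m B) (g := id)).
- move=> w Sw w0; have -> : gaussian_state chi h (x *m B) xi w = 0.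
    by rewrite /gaussian_state amp_neg// mul0r.
  by rewrite rmorph0 mul0r.
apply: eq_cintegral => y _; rewrite /gaussian_state /plane_wave /fiber_density.
have cj (a t : R) : (a%:C * expi (- t))^* = a%:C * expi t :> R[i].
  by rewrite /expi cosN sinN; apply: complex_eq; rewrite !partsE /=; ring.
apply: etrans (congr1 (fun z => ((height y)^-1)%:C * (z * f (gp y))) (cj _ _)) _.
move: (amp xi (gp y)) => a; rewrite rmorphM /=.
have -> : dot (x *m B) (gp y) = dot x y.
  by rewrite dotDr dotZr (dot_frame frB) mulr0 add0r (dot_mulmx _ _ frB.1).
rewrite (mulrC (dot x y)); ring.
Qed.

Let mg : cmeasurable setT g.
Proof.
apply: cmeasurableM; last exact: (cmeasurable_comp mf mgp).
apply: cmeasurable_real; apply: measurable_funM.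
  by apply: measurable_fun_inv; exact: measurable_height.
exact: (measurableT_comp mamp mgp).
Qed.

Let f2S : (\int[sigma]_(w in S) (cabs (f w) ^+ 2)%:E < +oo)%E. Proof. exact: f2. Qed.

Let mf2 : measurable_fun S (fun w => (cabs (f w) ^+ 2)%:E).
Proof.
apply/measurable_EFinP; apply: measurable_funX; apply: cmeasurable_cabs.
exact: cmeasurable_restr.
Qed.

(** Its integral is that of the amplitude times |f| over the sphere, which has finite
    measure. *)
Lemma cintegrable_fiber_density : cintegrable L setT g.
Proof.
apply/(cintegrableP _ measurableT); split => //.
pose F w := (amp xi w * cabs (f w))%:E.
have mF : measurable_fun S F.
  apply/measurable_EFinP; apply: measurable_funTS; apply: measurable_funM => //.
  exact: cmeasurable_cabs.
have F0 w : S w -> (0 <= F w)%E by move=> _; rewrite lee_fin mulr_ge0 ?amplitude_ge0 ?cabs_ge0.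
have -> : (\int[L]_y (cabs (g y))%:E = \int[sigma]_(w in S) F w)%E.
  rewrite (ge0_integral_sphere_graph Sxi frB mF F0); last first.
    by move=> w Sw w0; rewrite /F amp_neg// mul0r.
  apply: eq_integral => y _; rewrite /F -EFinM cabsM cabs_real ger0_norm.
    by congr EFin; exact/esym/mulrA.
  by apply: mulr_ge0; [rewrite invr_ge0 height_ge0|exact: amplitude_ge0].
apply: (@le_lt_trans _ _ (\int[sigma]_(w in S) (1 + (cabs (f w) ^+ 2)%:E))%E).
  apply: ge0_le_integral => //; first exact: emeasurable_funD.
  move=> w _; rewrite -EFinD lee_fin.
  have := amplitude_le1 chi_range h0 xi w; have := amplitude_ge0 chi_range h xi w.
  have := cabs_ge0 (f w); move: (amp xi w) (cabs (f w)) => a c; nra.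
rewrite ge0_integralD//; last by move=> w _; rewrite lee_fin sqr_ge0.
by rewrite lte_add_pinfty// integral_cst//= mul1e sphere_measure_S_fin.
Qed.
Local Notation Ig := cintegrable_fiber_density.

(** Squaring the density leaves one surplus factor 1 / (w . xi), at most 2 on the support of
    the amplitude. *)
Lemma fiber_density_L2 : (\int[L]_y (cabs (g y) ^+ 2)%:E < +oo)%E.
Proof.
pose F w := (amp xi w ^+ 2 * cabs (f w) ^+ 2 / dot w xi)%:E.
have mF : measurable_fun S F.
  apply/measurable_EFinP; apply: measurable_funTS; apply: measurable_funM.
    by apply: measurable_funM; apply: measurable_funX => //; exact: cmeasurable_cabs.
  by apply: measurable_fun_inv; exact: (measurable_dot (f := id) (g := fun=> xi)).
have F0 w : S w -> (0 <= F w)%E.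
  move=> Sw; rewrite lee_fin; have [w0|w0] := leP (dot w xi) 0.
    by rewrite amp_neg// expr0n !mul0r.
  by apply: divr_ge0; [apply: mulr_ge0; exact: sqr_ge0|exact: ltW].
(* One of the two factors 1 / height is the Jacobian, the other is 1 / (w . xi). *)
have -> : (\int[L]_y (cabs (g y) ^+ 2)%:E = \int[sigma]_(w in S) F w)%E.
  rewrite (ge0_integral_sphere_graph Sxi frB mF F0); last first.
    by move=> w Sw w0; rewrite /F amp_neg// expr0n !mul0r.
  apply: eq_integral => y _; rewrite /F -EFinM (dot_graph_point Sxi frB).
  rewrite cabsM cabs_real ger0_norm; last first.
    by apply: mulr_ge0; [rewrite invr_ge0 height_ge0|exact: amplitude_ge0].
  by congr EFin; rewrite !exprMn exprVn expr2 invfM; ring.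
apply: (@le_lt_trans _ _ (\int[sigma]_(w in S) (2%:E * (cabs (f w) ^+ 2)%:E))%E).
  apply: ge0_le_integral => //; first exact: emeasurable_funM.
  move=> w Sw; rewrite -EFinM lee_fin.
  have c0 : 0 <= cabs (f w) ^+ 2 by exact: sqr_ge0.
  have [w0|w0] := leP (dot w xi) (1 / 2).
    by rewrite amp_far// expr0n !mul0r mulr_ge0.
  rewrite ler_pdivrMr; last lra.
  have := amplitude_le1 chi_range h0 xi w; have := amplitude_ge0 chi_range h xi w.
  move: (amp xi w) (cabs (f w) ^+ 2) c0 => a c c0 a0 a1.
  have aa : a ^+ 2 <= 1 by rewrite exprn_ile1.
  nra.
rewrite ge0_integralZl//; first by rewrite lte_mul_pinfty.
by move=> w _; rewrite lee_fin sqr_ge0.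
Qed.
Local Notation g2 := fiber_density_L2.

Let s0 : h^-1 != 0. Proof. by rewrite invr_eq0 gt_eqF. Qed.

Let C : R := (2 * pi * h) ^+ n.

Let CE : (2 * pi / `|h^-1|) ^+ n = C.
Proof. by rewrite gtr0_norm ?invr_gt0// invrK. Qed.

(** The L^2 Fourier integral of the coefficient, as a function on the whole space. *)
Definition fiber_transform (v : V) : R[i] := C%:C * g (v *m B^T).
Local Notation U0 := fiber_transform.

Let U0E y : U0 (y *m B) = C%:C * g y.
Proof. by rewrite /U0 (frameK frB). Qed.

Lemma truncated_fourier_frame r y :
  truncated_fourier h xi (coefficient chi h f xi) r (y *m B) =
  ft (- h^-1) (truncate (eball r) (ft h^-1 g)) y.
Proof.
rewrite /truncated_fourier cintegral_setI.
have E z : (\1_[set x : V | enorm x <= r] (z *m B))%:C *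
    (plane_wave h (z *m B) (y *m B) * coefficient chi h f xi (z *m B)) =
    expi (- h^-1 * dot y z) * truncate (eball r) (ft h^-1 g) z.
  rewrite coefficient_frame /plane_wave (dot_mulmx _ _ frB.1) /truncate.
  have -> : \1_[set x : V | enorm x <= r] (z *m B) = \1_(eball r) z :> R.
    rewrite !indicE; congr (_%:R); congr nat_of_bool.
    by apply/idP/idP; rewrite !inE /eball /= (enorm_mulmx _ frB.1).
  rewrite (dotC y) mulrC mulrAC (mulrC (dot z y)) -mulNr; ring.
rewrite (cintegral_orth Sxi); first by apply: eq_cintegral => z _; exact: E.
apply: (cmeasurable_orth Sxi _ E); apply: cmeasurableM; first exact: cmeasurable_rV_wave.
by apply: cmeasurable_truncate; [exact: measurable_eball|exact: cmeasurable_ft Ig].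
Qed.

Lemma cmeasurable_truncated_fourier r :
  cmeasurable (orth xi) (truncated_fourier h xi (coefficient chi h f xi) r).
Proof.
apply: (cmeasurable_orth Sxi _ (truncated_fourier_frame r)); apply: cmeasurable_ft.
exact: (cintegrable_truncate_ft _ Ig (measurable_eball r) (lebesgue_eball_fin n r)).
Qed.

Lemma fiber_transformP : is_L2_fourier h xi (coefficient chi h f xi) U0.
Proof.
have mCg : cmeasurable setT (fun y => C%:C * g y) by apply: cmeasurableM => //; exact: cmeasurable_cst.
have mft : cmeasurable setT (ft h^-1 g) by exact: cmeasurable_ft Ig.
split.
- split; first exact: (cmeasurable_orth Sxi mft coefficient_frame).
  rewrite (sqnorm_L2_orth Sxi mft coefficient_frame) /sqnorm_L2 (plancherel s0 Ig).
  by rewrite lte_mul_pinfty ?g2// lee_fin CE exprn_ge0// !mulr_ge0 ?pi_ge0// ltW.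
- split; first exact: (cmeasurable_orth Sxi mCg U0E).
  rewrite (sqnorm_L2_orth Sxi mCg U0E) /sqnorm_L2.
  under eq_integral do rewrite cabsM exprMn EFinM.
  rewrite ge0_integralZl//; last 3 first.
  + exact: measurable_cabs_sqr.
  + by move=> y _; rewrite lee_fin sqr_ge0.
  + by rewrite lee_fin sqr_ge0.
  by rewrite lte_mul_pinfty ?g2// lee_fin sqr_ge0.
- have := fourier_inversion_L2 s0 Ig g2; rewrite CE; apply: cvg_trans.
  apply: near_eq_cvg; apply: nearW => r.
  rewrite (sqnorm_L2_orth Sxi (g := fun y => C%:C * g y - ft (- h^-1) (truncate (eball r) (ft h^-1 g)) y))//.
  + apply: cmeasurableB => //; apply: cmeasurable_ft.
    exact: (cintegrable_truncate_ft _ Ig (measurable_eball r) (lebesgue_eball_fin n r)).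
  + by move=> y; rewrite U0E truncated_fourier_frame.
Qed.

(** Where the amplitude vanishes both sides are 0; elsewhere [w] is the graph point over its
    projection, and the height there is [w . xi]. *)
Lemma fiber_transform_sphere w : S w ->
  (amp xi w)%:C * U0 (orth_proj xi w) = (C * amp xi w ^+ 2 / dot w xi)%:C * f w.
Proof.
move=> Sw; have [w0|w0] := leP (dot w xi) (1 / 2).
  by rewrite amp_far// expr0n mulr0 !mul0r.
have w00 : 0 <= dot w xi by lra.
have gw := graph_point_sphere Sxi frB Sw w00.
rewrite -(frame_orth_proj Sxi frB) U0E /fiber_density gw.
have -> : height (w *m B^T) = dot w xi by rewrite -(dot_graph_point Sxi frB) gw.
by rewrite !rmorphM /=; ring.
Qed.

Lemma L2_fourier_unique (F U1 U2 : V -> R[i]) :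
  (forall r, cmeasurable (orth xi) (truncated_fourier h xi F r)) ->
  is_L2_fourier h xi F U1 -> is_L2_fourier h xi F U2 ->
  sqnorm_L2 (orth_lebesgue xi) (orth xi) (fun x => U1 x - U2 x) = 0%E.
Proof.
move=> mT [_ [mU1 _] lim1] [_ [mU2 _] lim2]; set N := sqnorm_L2 _ _ _.
apply/eqP; rewrite eq_le; apply/andP; split; last first.
  by apply: integral_ge0 => x _; rewrite lee_fin sqr_ge0.
have lim : (2%:E * sqnorm_L2 (orth_lebesgue xi) (orth xi) (fun y => U1 y - truncated_fourier h xi F r y)%R +
    2%:E * sqnorm_L2 (orth_lebesgue xi) (orth xi) (fun y => U2 y - truncated_fourier h xi F r y)%R)%E
    @[r --> +oo] --> 0%E.
  rewrite -[X in _ --> X](adde0 0%E); apply: cvgeD => //.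
    by rewrite -[X in _ --> X](mule0 2%:E); exact: cvgeZl.
  by rewrite -[X in _ --> X](mule0 2%:E); exact: cvgeZl.
apply: (cvge_ge _ lim); apply: nearW => r.
by apply: sqnorm_L2_triangle => //; exact: measurable_orth.
Qed.

(** Transport |U1 - U2|^2 to the sphere with the weight amplitude^2 * (w . xi). The factor
    [w . xi] cancels the Jacobian, so the transported integral is bounded by the one over
    the hyperplane, which is 0. *)
Lemma fiber_value_unique (U1 U2 : V -> R[i]) :
  cmeasurable (orth xi) U1 -> cmeasurable (orth xi) U2 ->
  sqnorm_L2 (orth_lebesgue xi) (orth xi) (fun x => U1 x - U2 x) = 0%E ->
  {ae sigma, forall w, S w ->
    (amp xi w)%:C * U1 (orth_proj xi w) = (amp xi w)%:C * U2 (orth_proj xi w)}.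
Proof.
move=> mU1 mU2 N0; pose D x := cabs (U1 x - U2 x) ^+ 2.
have mD : measurable_fun (orth xi) D.
  by apply: measurable_funX; apply: cmeasurable_cabs; exact: cmeasurableB.
have D0 x : 0 <= D x by exact: sqr_ge0.
pose F w := (amp xi w ^+ 2 * dot w xi * D (orth_proj xi w))%:E.
have mproj : measurable_fun setT (@orth_proj R n.+1 xi).
  apply: measurable_rVD => //; apply: measurable_rVN; apply: measurable_rVZ => //.
  exact: (measurable_dot (f := id) (g := fun=> xi)).
have mF : measurable_fun S F.
  apply/measurable_EFinP; apply: measurable_funM.
    apply: measurable_funTS; apply: measurable_funM; first exact: measurable_funX.
    exact: (measurable_dot (f := id) (g := fun=> xi)).
  apply: (measurable_comp (measurable_orth xi) _ mD); last exact: measurable_funTS.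
  by move=> _ [w _ <-]; rewrite -(frame_orth_proj Sxi frB); exact: (orth_frame_mul frB).
have F0 w : S w -> (0 <= F w)%E.
  move=> Sw; rewrite lee_fin; have [w0|w0] := leP (dot w xi) 0.
    by rewrite amp_neg// expr0n !mul0r.
  by apply: mulr_ge0; [apply: mulr_ge0; [exact: sqr_ge0|exact: ltW]|exact: D0].
have IF : (\int[sigma]_(w in S) `|F w| = 0)%E.
  transitivity (\int[sigma]_(w in S) F w)%E.
    by apply: eq_integral => w /set_mem Sw; rewrite gee0_abs// F0.
  apply/eqP; rewrite eq_le; apply/andP; split; last by apply: integral_ge0 => w; exact: F0.
  rewrite -N0 /sqnorm_L2 (ge0_integral_orth Sxi); last 2 first.
  - exact/measurable_EFinP.
  - by move=> x _; rewrite lee_fin D0.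
  rewrite (ge0_integral_sphere_graph Sxi frB mF F0); last first.
    by move=> w Sw w0; rewrite /F amp_neg// expr0n !mul0r.
  have mDB : measurable_fun setT (fun y => D (y *m B)).
    apply: (measurable_comp (measurable_orth xi) _ mD); last exact: measurable_mulmxr.
    by move=> _ [y _ <-]; exact: (orth_frame_mul frB).
  have FE y : (((height y)^-1)%:E * F (gp y) <= (D (y *m B))%:E)%E.
    rewrite /F (dot_graph_point Sxi frB) (orth_proj_graph Sxi frB) -EFinM lee_fin.
    have [->|hy] := eqVneq (height y) 0; first by rewrite invr0 mul0r.
    have := amplitude_le1 chi_range h0 xi (gp y); have := amplitude_ge0 chi_range h xi (gp y).
    move: (amp xi (gp y)) => a a0 a1.
    have -> : (height y)^-1 * (a ^+ 2 * height y * D (y *m B)) = a ^+ 2 * D (y *m B) by field.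
    by rewrite ler_piMl// exprn_ile1.
  apply: ge0_le_integral => //.
  - move=> y _; apply: mule_ge0; first by rewrite lee_fin invr_ge0 height_ge0.
    rewrite /F lee_fin (dot_graph_point Sxi frB); apply: mulr_ge0; last exact: D0.
    by apply: mulr_ge0; [exact: sqr_ge0|exact: height_ge0].
  - apply/measurable_EFinP; under eq_fun do rewrite (dot_graph_point Sxi frB) (orth_proj_graph Sxi frB).
    apply: measurable_funM; first by apply: measurable_fun_inv; exact: measurable_height.
    apply: measurable_funM => //; apply: measurable_funM; last exact: measurable_height.
    by apply: measurable_funX; exact: (measurableT_comp mamp mgp).
  - exact/measurable_EFinP.
have := (ae_eq_integral_abs sigma mS mF).1 IF.
move=> /ae_imp; apply => w Fw Sw; have [w0|w0] := leP (dot w xi) (1 / 2).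
  by rewrite amp_far// !mul0r.
have key (a c e : R) : 0 < c -> a ^+ 2 * c * e ^+ 2 = 0 -> a = 0 \/ e = 0.
  move=> c0 /eqP; rewrite !mulf_eq0 (gt_eqF c0) orbF !orbb.
  by move=> /orP[] /eqP; [left|right].
have w00 : 0 < dot w xi by lra.
have := Fw Sw; rewrite /F /D /= => -[] /(key _ _ _ w00)[->|/cabs_eq0/subr0_eq->//].
by rewrite !mul0r.
Qed.

End fiber.

(** * The reproducing formula *)

Section sphere_sigma_finite.
Context {R : realType}.
Variable n : nat.

(** A name for surface measure under which it carries the sigma-finite structure that
    Tonelli requires. *)
Definition finite_sphere_measure : set 'rV[R]_n.+1 -> \bar R := @sphere_measure R n.+1.

HB.instance Definition _ := Measure.on finite_sphere_measure.

Let sphere_measure_sigma_finite : sigma_finite setT finite_sphere_measure.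
Proof.
exists (fun=> setT) => [|k]; first by apply/seteqP; split => // x _; exists 0%N.
by split => //; exact: sphere_measure_fin.
Qed.

HB.instance Definition _ := Measure_isSigmaFinite.Build _ _ _
  finite_sphere_measure sphere_measure_sigma_finite.

End sphere_sigma_finite.

Section null_slices.
Context d1 d2 (T1 : measurableType d1) (T2 : measurableType d2) (R : realType).
Variables (m1 : {sigma_finite_measure set T1 -> \bar R}).
Variables (m2 : {sigma_finite_measure set T2 -> \bar R}).

(** Both iterated integrals of the indicator of [N] vanish as soon as one does. *)
Lemma ae_swap (N : set (T1 * T2)) : measurable N ->
  (forall x, {ae m2, forall y, ~ N (x, y)}) ->
  {ae m2, forall y, {ae m1, forall x, ~ N (x, y)}}.
Proof.
move=> mN null; pose F (z : T1 * T2) : \bar R := (\1_N z)%:E.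
have mF : measurable_fun setT F by apply/measurable_EFinP; exact: measurable_indic.
have F0 z : (0 <= F z)%E by rewrite lee_fin indicE.
have FE z : `|F z|%E = F z by rewrite gee0_abs.
have I1 x : (\int[m2]_y F (x, y) = 0)%E.
  have mFx : measurable_fun setT (fun y => F (x, y)) by exact: (measurableT_comp mF (pair1_measurable x)).
  under eq_integral do rewrite -FE.
  apply/(ae_eq_integral_abs m2 measurableT mFx).
  by apply: (ae_imp (null x)) => y Ny _; rewrite /F indicE memNset.
have mI : measurable_fun setT (fun y => (\int[m1]_x F (x, y))%E).
  exact: (measurable_fun_fubini_tonelli_G (m1 := m1) F mF F0).
have I0 y : (0 <= \int[m1]_x F (x, y))%E by exact: integral_ge0.
have : (\int[m2]_y `|\int[m1]_x F (x, y)| = 0)%E.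
  under eq_integral do rewrite gee0_abs//.
  rewrite -(fubini_tonelli (m1 := m1) (m2 := m2) F mF F0).
  by under eq_integral do rewrite I1; rewrite integral0.
move=> /(ae_eq_integral_abs m2 measurableT mI) /ae_imp; apply => y /(_ I) /= Iy.
have mFy : measurable_fun setT (fun x => F (x, y)) by exact: (measurableT_comp mF (pair2_measurable y)).
have : (\int[m1]_x `|F (x, y)| = 0)%E by under eq_integral do rewrite FE.
move=> /(ae_eq_integral_abs m1 measurableT mFy) /ae_imp; apply => x /(_ I) /= /eqP.
by rewrite eqe indicE pnatr_eq0 eqb0 => /negP; rewrite inE.
Qed.

End null_slices.

Section reproducing.
Context {R : realType}.
Variables (chi : R -> R) (n : nat).
Hypotheses (chi_smooth : smooth chi) (chi_range : forall r, 0 <= chi r <= 1).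
Hypotheses (chi_zero : forall r, 3 / 4 <= r -> chi r = 0).
Variables (h : R) (h0 : 0 < h) (h1 : h < 1).
Hypothesis K0 : 0 < fine (normalizer chi n h).
Local Notation S := (@sphere R n.+1).
Local Notation sigma := (@sphere_measure R n.+1).
Local Notation V := ('rV[R]_n.+1).
Local Notation amp := (amplitude chi h).
Let mS := @measurable_sphere R n.
Let C : R := (2 * pi * h) ^+ n.

(** The weight with which the fiber over [xi] reproduces the value at [w]. *)
Definition sphere_kernel (xi w : V) : R := amp xi w ^+ 2 / dot w xi.

Let C0 : 0 < C. Proof. by rewrite exprn_gt0// !mulr_gt0// pi_gt0. Qed.

Lemma measurable_sphere_kernel : measurable_fun setT (fun z : V * V => sphere_kernel z.1 z.2).
Proof.
apply: measurable_funM.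
  by apply: measurable_funX; exact: (measurable_amplitude chi_smooth).
by apply: measurable_fun_inv; exact: measurable_dot.
Qed.

Lemma sphere_kernel_ge0 xi w : S xi -> S w -> 0 <= sphere_kernel xi w.
Proof.
move=> Sxi Sw; rewrite /sphere_kernel; have [w0|w0] := leP (dot w xi) (1 / 2).
  by rewrite (amplitude_far chi_zero h0 h1 Sxi Sw w0) expr0n mul0r.
by apply: divr_ge0; [exact: sqr_ge0|lra].
Qed.

(** The kernel is symmetric in its arguments; take graph coordinates around [w]. *)
Lemma integral_sphere_kernel w : S w ->
  (\int[sigma]_(xi in S) (sphere_kernel xi w)%:E = normalizer chi n h)%E.
Proof.
move=> Sw; have frB := orth_frameP Sw.
have mk : measurable_fun S (fun xi => (sphere_kernel xi w)%:E).
  apply/measurable_EFinP; apply: measurable_funTS.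
  exact: (measurableT_comp measurable_sphere_kernel (pair2_measurable w)).
rewrite (ge0_integral_sphere_graph Sw frB mk); last 2 first.
- by move=> xi Sxi; rewrite lee_fin sphere_kernel_ge0.
- move=> xi Sxi; rewrite dotC => w0; rewrite /sphere_kernel.
  by rewrite (amplitude_far chi_zero h0 h1 Sxi Sw) ?expr0n ?mul0r//; lra.
apply: eq_integral => y _; rewrite -EFinM; congr EFin.
have [hy|hy] := eqVneq (height y) 0.
  by rewrite /overlap hy invr0 mul0r expr0n invr0 mulr0.
rewrite /sphere_kernel amplitudeC (amplitude_sphere chi h Sw (sphere_graph_point Sw frB hy)).
rewrite (dotC w) !(dot_graph_point Sw frB) /overlap; field => //.
Qed.

Lemma integrable_sphere_kernel w : S w -> sigma.-integrable S (fun xi => (sphere_kernel xi w)%:E).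
Proof.
move=> Sw; have mk : measurable_fun S (sphere_kernel^~ w).
  apply: measurable_funTS.
  exact: (measurableT_comp measurable_sphere_kernel (pair2_measurable w)).
have fin : (\int[sigma]_(xi in S) `|sphere_kernel xi w|%:E < +oo)%E.
  rewrite (_ : (\int[sigma]_(x in S) _)%E = normalizer chi n h); last first.
    rewrite -(integral_sphere_kernel Sw); apply: eq_integral => xi /set_mem Sxi.
    by rewrite ger0_norm// sphere_kernel_ge0.
  have := normalizer_fin_num n chi_smooth chi_range chi_zero h0 h1.
  by rewrite fin_numE ltey => /andP[].
exact: (integrable_norm_lty mk fin).
Qed.

Variables (f : V -> R[i]) (mf : cmeasurable setT f) (f2 : (sqnorm_L2 sigma S f < +oo)%E).

Definition fiber_integral (z : V * V) : R[i] := (C * sphere_kernel z.1 z.2)%:C * f z.2.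
Local Notation G0 := fiber_integral.

Let G0E xi w : S xi -> S w ->
  G0 (xi, w) = (amp xi w)%:C * fiber_transform chi h f xi (orth_proj xi w).
Proof.
move=> Sxi Sw; rewrite fiber_transform_sphere// /fiber_integral /sphere_kernel /=.
by rewrite mulrA.
Qed.

Lemma cmeasurable_fiber_integral : cmeasurable (S `*` S) G0.
Proof.
apply: cmeasurable_restr; apply: cmeasurableM.
  apply: cmeasurable_real; apply: measurable_funM => //; exact: measurable_sphere_kernel.
exact: (cmeasurable_comp mf measurable_snd).
Qed.

Lemma fiber_integralP : is_fiber_integral chi h f G0.
Proof.
split; first exact: cmeasurable_fiber_integral.
move=> xi Sxi; exists (fiber_transform chi h f xi); split.
  exact: fiber_transformP.
by apply: aeW => w Sw; exact: G0E.
Qed.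

Let mSS : measurable (S `*` S). Proof. exact: measurableX. Qed.

(** For every [xi], [fiber_value_unique] gives equality at almost every [w]; [ae_swap],
    applied to the measurable set where the two functions differ, exchanges the quantifiers.
    *)
Lemma fiber_integral_unique G : is_fiber_integral chi h f G ->
  {ae sigma, forall w, S w -> {ae sigma, forall xi, S xi -> G (xi, w) = G0 (xi, w)}}.
Proof.
move=> [mG GP]; pose N := (S `*` S) `&` [set z | G z != G0 z].
have mN : measurable N.
  have := cmeasurable_cabs (cmeasurableB mG cmeasurable_fiber_integral).
  move=> /(_ mSS (~` [set 0]) (measurableC (measurable_set1 _))).
  congr measurable; apply/seteqP; split => z /= [Sz Gz]; split => //=.
    by apply/eqP => GG; apply: Gz; rewrite GG subrr cabs0.
  by move=> /cabs_eq0/subr0_eq GG; move: Gz; rewrite /= GG eqxx.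
have null xi : {ae @finite_sphere_measure R n, forall w, ~ N (xi, w)}.
  have [Sxi|Sxi] := pselect (S xi); last first.
    by apply: aeW => w [[/= /Sxi]].
  have [U [UP UE]] := GP xi Sxi.
  have U0 := fiber_transformP chi_smooth chi_range chi_zero h0 h1 mf f2 Sxi.
  have N0 := L2_fourier_unique
    (cmeasurable_truncated_fourier chi_smooth chi_range chi_zero h0 h1 mf f2 Sxi) UP U0.
  have [_ [mU _] _] := UP; have [_ [mU0 _] _] := U0.
  have UU := fiber_value_unique chi_smooth chi_range chi_zero h0 h1 Sxi mU mU0 N0.
  apply: (ae_imp2 UE UU) => w Gw Uw [[/= _ Sw] /negP]; apply; apply/eqP.
  by rewrite Gw// Uw// G0E.
have swap : {ae sigma, forall w, {ae sigma, forall xi, ~ N (xi, w)}}.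
  exact: (ae_swap (@finite_sphere_measure R n) mN null).
apply: (ae_imp swap) => w Nw Sw.
apply: (ae_imp Nw) => xi Nxi Sxi; apply/eqP; apply: contra_notT Nxi => GG.
by split.
Qed.

Lemma reproducing_formula G : is_fiber_integral chi h f G ->
  {ae sigma, forall w, S w ->
    cintegrable sigma S (fun xi => G (xi, w)) /\
    f w = (reproducing_constant chi n h)%:C * cintegral sigma S (fun xi => G (xi, w))}.
Proof.
move=> GP; apply: (ae_imp (fiber_integral_unique GP)) => w GG Sw.
have Gw := GG Sw; have [[mGR mGI] _] := GP.
have mpair : measurable_fun S (fun xi : V => (xi, w)).
  by apply: measurable_funTS; exact: pair2_measurable.
have sub : [set (xi, w) | xi in S] `<=` S `*` S by move=> _ [xi Sxi <-].
have mG : cmeasurable S (fun xi => G (xi, w)).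
  by split; [exact: (measurable_comp mSS sub mGR mpair)|exact: (measurable_comp mSS sub mGI mpair)].
have Ik : cintegrable sigma S (fun xi => (sphere_kernel xi w)%:C).
  split; first exact: integrable_sphere_kernel.
  by apply: eq_integrable (integrable0 _ _).
pose c := C%:C * f w.
have IcK : cintegrable sigma S (fun xi => c * (sphere_kernel xi w)%:C) by exact: cintegrableZl.
have E xi : G0 (xi, w) = c * (sphere_kernel xi w)%:C.
  by rewrite /fiber_integral /c rmorphM /=; ring.
have Gw' : {ae sigma, forall xi, S xi -> G (xi, w) = c * (sphere_kernel xi w)%:C}.
  by apply: (ae_imp Gw) => xi Gxi Sxi; rewrite Gxi// E.
split; first exact: ae_cintegrable Gw'.
rewrite (ae_cintegral mS mG (cintegrable_measurable IcK) Gw') cintegralZl//.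
have -> : cintegral sigma S (fun xi => (sphere_kernel xi w)%:C) = (fine (normalizer chi n h))%:C.
  apply: complex_eq; rewrite ?Re_cintegral ?Im_cintegral /Rintegral.
    by rewrite -(integral_sphere_kernel Sw).
  by rewrite integral0.
rewrite /c /reproducing_constant -/C.
have CK : C * fine (normalizer chi n h) != 0 by rewrite mulf_neq0// gt_eqF.
transitivity (((C * fine (normalizer chi n h))^-1 * (C * fine (normalizer chi n h)))%:C * f w).
  by rewrite mulVf// mul1r.
by rewrite !rmorphM /=; ring.
Qed.

End reproducing.

Section arbitrary_representative.
Context {R : realType}.
Variables (chi : R -> R) (n : nat) (h : R).
Local Notation S := (@sphere R n.+1).
Local Notation sigma := (@sphere_measure R n.+1).
Local Notation V := ('rV[R]_n.+1).

(** A square integrable [f] is only assumed measurable on the sphere; extending it by 0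
    changes neither the coefficients nor the fiber integrals and makes it measurable on the
    whole space. *)
Lemma coefficient_truncate (f : V -> R[i]) : coefficient chi h (truncate S f) = coefficient chi h f.
Proof.
apply/funext => xi; apply/funext => x; apply: eq_cintegral => w Sw.
by rewrite /truncate indicE mem_set// mul1r.
Qed.

Lemma is_fiber_integral_truncate (f : V -> R[i]) G :
  is_fiber_integral chi h (truncate S f) G <-> is_fiber_integral chi h f G.
Proof. by rewrite /is_fiber_integral coefficient_truncate. Qed.

Lemma sqnorm_truncate (f : V -> R[i]) : sqnorm_L2 sigma S (truncate S f) = sqnorm_L2 sigma S f.
Proof.
by apply: eq_integral => w Sw; rewrite /truncate indicE Sw mul1r.
Qed.

Lemma cmeasurable_truncate_restr (f : V -> R[i]) : cmeasurable S f -> cmeasurable setT (truncate S f).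
Proof.
have mS := @measurable_sphere R n.
have E (u : V -> R) : measurable_fun S u -> measurable_fun setT (fun w => \1_S w * u w).
  move=> /(measurable_restrictT _ mS).1; congr measurable_fun; apply/funext => w.
  by rewrite patchE indicE; case: ifP; rewrite ?mul1r ?mul0r.
move=> [mR mI]; split.
  rewrite (_ : (fun _ => _) = fun w => \1_S w * complex.Re (f w)); first exact: E.
  by apply/funext => w; rewrite partsE mul0r subr0.
rewrite (_ : (fun _ => _) = fun w => \1_S w * complex.Im (f w)); first exact: E.
by apply/funext => w; rewrite partsE mul0r addr0.
Qed.

End arbitrary_representative.

Theorem lemma3 (R : realType) (d : nat) (d_gt0 : (0 < d)%N)
    (chi : R -> R) (chi_smooth : smooth chi)
    (chi_range : forall r, 0 <= chi r <= 1)
    (chi_one : forall r, r <= 1 / 2 -> chi r = 1)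
    (chi_zero : forall r, 3 / 4 <= r -> chi r = 0) :
  exists c : R -> R,
    (\forall h \near 0^'+, forall f : 'rV[R]_d -> R[i],
       is_L2 (@sphere_measure R d) (@sphere R d) f ->
       (exists G, is_fiber_integral chi h f G) /\
       (forall G, is_fiber_integral chi h f G ->
          {ae @sphere_measure R d, forall w, sphere w ->
             cintegrable (@sphere_measure R d) (@sphere R d)
               (fun xi => G (xi, w)) /\
             f w = (c h)%:C * cintegral (@sphere_measure R d) (@sphere R d)
                                (fun xi => G (xi, w))})) /\
    c ~_(0^'+) (fun h => 2 `^ ((d%:R - 1) / 2) *
                         (2 * pi * h) `^ (- (3 * (d%:R - 1) / 2))).
Proof.
case: d d_gt0 => // n _; exists (reproducing_constant chi n); split; last first.
  exact: reproducing_constant_equiv.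
have K := normalizer_gt0 n chi_smooth chi_range chi_one chi_zero.
(* Smallness of h enters twice: below 1 the cutoff radius keeps the support in the hemisphere,
   and near 0 the normalizing integral is positive. *)
near=> h => f [mf f2].
have h0 : 0 < h by near: h; exact: nbhs_right_gt.
have h1 : h < 1 by near: h; exact: nbhs_right_lt.
have K0 : 0 < fine (normalizer chi n h) by near: h; exact: K.
have mf' := cmeasurable_truncate_restr mf.
have f2' : (sqnorm_L2 (@sphere_measure R n.+1) (@sphere R n.+1) (truncate (@sphere R n.+1) f) < +oo)%E.
  by rewrite sqnorm_truncate.
split.
  exists (fiber_integral chi h (truncate (@sphere R n.+1) f)); apply: (is_fiber_integral_truncate chi h f _).1.
  exact: (fiber_integralP chi_smooth chi_range chi_zero h0 h1 mf' f2').
move=> G /(is_fiber_integral_truncate chi h f G).2 GP.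
apply: (ae_imp (reproducing_formula chi_smooth chi_range chi_zero h0 h1 K0 mf' f2' GP)).
by move=> w Gw Sw; have := Gw Sw; rewrite {1}/truncate indicE mem_set// mul1r.
Unshelve. all: by end_near. Qed.
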